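(* Fix an integer $q\ge2$. For $c\in\mathbb{R}$ let $\nu_c$ be the unique maximizing measure of $f_c(x)=\log\left|\frac{\sin\pi q(x+c)}{\sin\pi(x+c)}\right|$, i.e. the unique $T$-invariant Borel probability measure $\mu$ on $\mathbb{T}$ maximizing $\int f_c\,d\mu$. Let $\mathcal{P}=\{c\in\mathbb{R}:\nu_c \text{ is not supported on a periodic orbit of } T\}$. Then the closure $\overline{\mathcal{P}}$ is nowhere dense and has Hausdorff dimension zero.
   Context: $\mathbb{T}=\mathbb{R}/\mathbb{Z}$, $T(x)=qx\bmod1$. (The existence and uniqueness of $\nu_c$ for every $c$ is established in the paper.) *)

(* Defs.v *)
From HB Require Import structures.
From mathcomp Require Import all_boot all_order all_algebra.
From mathcomp Require Import all_classical all_reals all_analysis.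
Set Implicit Arguments. Unset Strict Implicit. Unset Printing Implicit Defensive.
Import Order.TTheory GRing.Theory Num.Theory.
Import numFieldNormedType.Exports.
Local Open Scope classical_set_scope.
Local Open Scope ring_scope.

Section Defs.
Variable R : realType.

(* The circle T = R/Z is modelled by the fundamental domain [0,1) in R;
   the doubling-type map T(x) = q x mod 1. *)
Definition Tq (q : nat) (x : R) : R := q%:R * x - (Num.floor (q%:R * x))%:~R.

(* f_c(x) = log | sin(pi q (x+c)) / sin(pi (x+c)) |, extended by continuity
   (value log q) at the removable singularities, and -oo at the zeros. *)
Definition fc (q : nat) (c : R) (x : R) : \bar R :=
  let y := pi * (x + c) in
  if sin y == 0 then (ln q%:R)%:E
  else if sin (q%:R * y) == 0 then -oo%E
  else (ln `|sin (q%:R * y) / sin y|)%:E.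

Definition Tinvariant (q : nat) (mu : probability R R) : Prop :=
  mu [set` `[0%R, 1%R[] = 1%E /\
  forall A : set R, measurable A -> mu (Tq q @^-1` A) = mu A.

Definition maximizing (q : nat) (c : R) (mu : probability R R) : Prop :=
  Tinvariant q mu /\
  forall nu : probability R R, Tinvariant q nu ->
    (\int[nu]_x fc q c x <= \int[mu]_x fc q c x)%E.

Definition periodic_orbit_supported (q : nat) (mu : probability R R) : Prop :=
  exists (x : R) (n : nat), (0 < n)%N /\ iter n (Tq q) x = x /\
    mu [set iter k (Tq q) x | k in [set k : nat | (k < n)%N]] = 1%E.

(* The set P: parameters c whose maximizing measure (unique by the paper)
   is not supported on a periodic orbit. *)
Definition Pset (q : nat) : set R :=
  [set c | exists mu, maximizing q c mu /\ ~ periodic_orbit_supported q mu].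

Definition nowhere_dense (A : set R) : Prop := interior (closure A) = set0.

Definition diam (U : set R) : R := sup [set `|x - y| | x in U & y in U].

Definition hcontrib (s : R) (U : set R) : R :=
  if pselect (U = set0) then 0 else powR (diam U) s.

Definition hausdorff_pre (s d : R) (E : set R) : \bar R :=
  ereal_inf [set (\sum_(0 <= i <oo) (hcontrib s (U i))%:E)%E |
     U in [set U : nat -> set R |
       E `<=` \bigcup_i U i /\
       forall i x y, U i x -> U i y -> `|x - y| <= d]].

Definition hausdorff_measure (s : R) (E : set R) : \bar R :=
  ereal_sup [set hausdorff_pre s d E | d in [set d : R | 0 < d]].

Definition hausdorff_dim (E : set R) : \bar R :=
  ereal_inf [set s%:E | s in [set s : R | 0 <= s /\ hausdorff_measure s E = 0%E]].

End Defs.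

(* Main.v *)
(* In the coordinate [z = x + c] the function [fc] is concave on the main lobe [|z| < 1/q].  Fix an
   arc [-a - c, -a - c + 1/q] inside that lobe; summing [fc] along the inverse branch of [T] with
   values in this arc gives a function [psi] such that [fc + psi - psi o T] is constant on the arc.
   It descends to the circle when [kap = 0], which a suitable [a] achieves by the intermediate value
   theorem; concavity on the main lobe and the decay of the side lobes then make the constant the
   strict maximum, so every maximizing measure is carried by the arc.

   On an orbit that stays in an arc of length [1/q], [T] preserves the cyclic order, hence there is a
   rotation number [rho].  If [rho] is rational the measure sits on one periodic orbit.  Otherwise
   the left end [g] of the arc is determined up to [O(q^-n)] by the integers [floor (j rho)], j <= n,
   and so, since the solution [a] of [kap = 0] has an explicit modulus of continuity in [g], is
   [c = - a - g] up to [O(2^-N)] when [n = 2 N].  There are only [O(N^2)] possible sequences of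
   floors, so the parameters of absolute value at most [L] are covered by [O(N^2)] intervals of
   length [O(2^-N)], and the same intervals, slightly enlarged, cover the closure. *)
Require Import Defs.
From HB Require Import structures.
From mathcomp Require Import all_boot all_order all_algebra.
From mathcomp Require Import complex.
From mathcomp Require Import all_classical all_reals all_analysis.
From mathcomp Require Import measurable_realfun.
From mathcomp Require Import zify ring lra.
Set Implicit Arguments.
Unset Strict Implicit.
Unset Printing Implicit Defensive.
Import Order.TTheory GRing.Theory Num.Theory.
Import numFieldNormedType.Exports.
Local Open Scope classical_set_scope.
Local Open Scope ring_scope.

(** * Sines, cotangents and the main lobe of the potential *)

Section Cotangent.
Variable R : realType.
Implicit Types x y z : R.

(** The dependence of [kap] on [th] is delicate. Moving [th] displaces the jumps of the inverse
    branch, so changes in the partial sums of [Psi] are not contracted: they may double with each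
    term, while the tail after [n] terms is [O(2^-n)]. The resulting modulus [2^n |th - th'| + 2^-n]
    is the reason why [2 N] floors are spent on a precision [2^-N]. For fixed [th], in contrast,
    [kap] grows in [a] at a rate bounded below, because the slope of the potential decreases at
    least at unit speed; this turns the modulus of [kap] into one for its zeros.

    That the constant is really attained as a maximum requires invariant measures whose integrals
    approach it. They are taken on periodic orbits that shadow a backward orbit inside the arc and
    may leave it slightly. The value [-oo] of [fc] is handled by truncation from below.

    The growth of [psi] across the complement of the arc is bounded by a rearrangement argument:
    only the part of [phi] with the largest slopes can be collected there.

    The rotation number is a space average of digits, so no limit along orbits is taken. *)

Lemma MVT_open (f df : R -> R) (lo hi x y : R) :
  (forall z, lo < z < hi -> is_derive z 1 f (df z)) ->
  lo < x -> x < y -> y < hi ->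
  exists2 z, x < z < y & f y - f x = df z * (y - x).
Proof.
move=> fdf lox xy yhi.
have dx z : x <= z <= y -> is_derive z 1 f (df z).
  by move=> /andP[xz zy]; apply: fdf; rewrite (lt_le_trans lox xz) (le_lt_trans zy yhi).
have [] := @MVT R f df x y xy.
- by move=> z; rewrite in_itv/= => /andP[xz zy]; apply: dx; rewrite !ltW.
- apply: continuous_in_subspaceT => z; rewrite inE/= in_itv/= => /dx dz.
  by apply: differentiable_continuous; apply/derivable1_diffP; case: dz.
- by move=> z; rewrite in_itv/= => xzy ->; exists z.
Qed.

Definition cotan x : R := cos x / sin x.

Lemma cotanB x y : sin x != 0 -> sin y != 0 ->
  cotan x - cotan y = sin (y - x) / (sin x * sin y).
Proof. by move=> sx sy; rewrite /cotan sinB; field; rewrite sx sy. Qed.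

Lemma cotanN x : cotan (- x) = - cotan x.
Proof. by rewrite /cotan cosN sinN invrN mulrN. Qed.

Lemma cotanDpi x : cotan (x + pi) = cotan x.
Proof. by rewrite /cotan cosDpi sinDpi invrN mulrNN. Qed.

Lemma cotan_piB x : cotan (pi - x) = - cotan x.
Proof. by rewrite addrC cotanDpi cotanN. Qed.

Lemma sin_neq0_pi x : 0 < x < pi -> sin x != 0.
Proof. by move=> x0pi; rewrite gt_eqF// sin_gt0_pi. Qed.

Lemma sin_le_id x : 0 <= x -> sin x <= x.
Proof.
rewrite le_eqVlt => /predU1P[<-|x0]; first by rewrite sin0.
have [|z _] := @MVT R sin cos 0 x x0 (fun z _ => is_derive_sin z).
  by apply: continuous_subspaceT => z; exact: continuous_sin.
rewrite sin0 !subr0 => ->.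
by rewrite ler_piMl ?cos_le1// ltW.
Qed.

Lemma ltr_cotan x y : 0 < x -> x < y -> y < pi -> cotan y < cotan x.
Proof.
move=> x0 xy ypi; have sx : 0 < sin x by apply: sin_gt0_pi; rewrite x0 (lt_trans xy).
have sy : 0 < sin y by apply: sin_gt0_pi; rewrite (lt_trans x0 xy).
rewrite -subr_gt0 cotanB ?gt_eqF// divr_gt0 ?mulr_gt0//.
by apply: sin_gt0_pi; rewrite subr_gt0 xy/=; lra.
Qed.

Lemma ler_cotan x y : 0 < x -> x <= y -> y < pi -> cotan y <= cotan x.
Proof.
by move=> x0; rewrite le_eqVlt => /predU1P[-> //|xy] ypi; exact/ltW/ltr_cotan.
Qed.

Lemma cotan_ge0 x : 0 < x -> x <= pi / 2 -> 0 <= cotan x.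
Proof.
move=> x0 xpi; have p0 := pi_gt0 R.
rewrite /cotan divr_ge0//; first by apply: cos_ge0_pihalf; rewrite xpi andbT; lra.
by apply/ltW/sin_gt0_pi; lra.
Qed.

Lemma cotan_gt0 x : 0 < x -> x < pi / 2 -> 0 < cotan x.
Proof.
move=> x0 xpi; have p0 := pi_gt0 R.
rewrite /cotan divr_gt0//; first by apply: cos_gt0_pihalf; rewrite xpi andbT; lra.
by apply/sin_gt0_pi; lra.
Qed.

Lemma is_derive_cotan x : sin x != 0 -> is_derive x 1 cotan (- (sin x ^+ 2)^-1).
Proof.
move=> sx; rewrite /cotan.
have ds : is_derive x 1 (fun y : R => (sin y)^-1) (- (sin x) ^- 2 *: cos x).
  by have := @is_deriveV R sin x (cos x) 1 sx (is_derive_sin x).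
apply: (is_derive_eq (is_deriveM (is_derive_cos x) ds)).
rewrite /GRing.scale/=.
transitivity (- ((cos x ^+ 2 + sin x ^+ 2) / sin x ^+ 2)); first by field.
by rewrite cos2Dsin2 mul1r.
Qed.

(** The derivative of [cotan] is [- 1 / sin^2], hence at most [-1]. This is the source of the
    uniform concavity of [pot]. *)
Lemma cotan_expand x y : 0 < x -> x <= y -> y < pi -> y - x <= cotan x - cotan y.
Proof.
move=> x0; rewrite le_eqVlt => /predU1P[<- _|xy ypi]; first by rewrite !subrr.
have [|z /andP[xz zy] e] := @MVT_open cotan (fun z => - (sin z ^+ 2)^-1) 0 pi x y _ x0 xy ypi.
  by move=> z /sin_neq0_pi; exact: is_derive_cotan.
have -> : cotan x - cotan y = (sin z ^+ 2)^-1 * (y - x).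
  by rewrite -opprB e mulNr opprK.
rewrite ler_peMl ?subr_ge0 ?(ltW xy)//.
have sz : 0 < sin z by apply: sin_gt0_pi; lra.
by rewrite invf_ge1 ?exprn_gt0// expr_le1 ?sin_le1// ltW.
Qed.

Lemma cotanB_le x y s : 0 < s -> s <= sin x -> s <= sin y -> x <= y ->
  cotan x - cotan y <= (y - x) / s ^+ 2.
Proof.
move=> s0 sx sy xy; have sx0 := lt_le_trans s0 sx; have sy0 := lt_le_trans s0 sy.
rewrite cotanB ?gt_eqF//.
rewrite ler_pdivrMr ?mulr_gt0// mulrAC ler_pdivlMr ?exprn_gt0//.
apply: (@le_trans _ _ ((y - x) * s ^+ 2)).
  by rewrite ler_wpM2r ?exprn_ge0 ?(ltW s0)// sin_le_id// subr_ge0.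
by rewrite ler_wpM2l ?subr_ge0// expr2 ler_pM// ltW.
Qed.

Lemma is_derive_lnsin x : 0 < sin x -> is_derive x 1 (fun y : R => ln (sin y)) (cotan x).
Proof.
move=> sx.
apply: (is_derive_eq (is_derive1_comp (is_derive1_ln sx) (is_derive_sin x))).
by rewrite /cotan mulrC.
Qed.

(** Concavity of [ln sin]: its derivative [cotan] is decreasing on [(0, pi)]. *)
Lemma lnsin_tangent x y : 0 < x < pi -> 0 < y < pi ->
  ln (sin y) - ln (sin x) <= cotan x * (y - x).
Proof.
move=> /andP[x0 xpi] /andP[y0 ypi].
have d z : 0 < z < pi -> is_derive z 1 (fun y : R => ln (sin y)) (cotan z).
  by move=> /sin_gt0_pi; exact: is_derive_lnsin.
have [xy|yx|->] := ltgtP x y; last by rewrite !subrr mulr0.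
  have [z /andP[xz zy] ->] := MVT_open d x0 xy ypi.
  by rewrite ler_wpM2r ?subr_ge0 ?(ltW xy)// ler_cotan// ?ltW// (lt_trans zy).
have [z /andP[xz zy] e] := MVT_open d y0 yx xpi.
rewrite -opprB e -[y - x]opprB mulrN lerN2.
by rewrite ler_wpM2r ?subr_ge0 ?(ltW yx)// ler_cotan// ?ltW// (lt_trans y0).
Qed.

Lemma cotan_half x : sin x != 0 -> cotan (x / 2) = (1 + cos x) / sin x.
Proof.
have -> : x = x / 2 *+ 2 by rewrite mulr2n -splitr.
move: (x / 2) => h; have -> : h *+ 2 / 2 = h by field.
rewrite sin_mulr2n cos_mulr2n -mulr_natl !mulf_eq0 !negb_or => /andP[_ /andP[ch sh]].
by rewrite /cotan; field; rewrite sh ch.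
Qed.

End Cotangent.

(** * The product formula for the sine, from roots of unity *)

Section SineProduct.
Variable R : realType.
Implicit Types x y : R.

Definition cis x : R[i] := (cos x +i* sin x)%C.

Lemma cisD x y : cis (x + y) = cis x * cis y.
Proof. by rewrite /cis cosD sinD; apply/eqP; rewrite eq_complex/= [_ * sin y + _]addrC eqxx addrC mulrC eqxx. Qed.

Lemma cis0 : cis 0 = 1.
Proof. by rewrite /cis cos0 sin0. Qed.

Lemma cisX x n : cis (n%:R * x) = cis x ^+ n.
Proof.
elim: n => [|n ih]; first by rewrite mul0r cis0.
by rewrite -natr1 mulrDl mul1r cisD ih exprSr.
Qed.

Lemma norm_cisB1 x : `|1 - cis x| = (2 * `|sin (x / 2)|)%:C%C.
Proof.
rewrite normc_def/= sub0r; congr (_%:C)%C.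
have -> : (1 - cos x) ^+ 2 + (- sin x) ^+ 2 = (2 * sin (x / 2)) ^+ 2.
  rewrite sqrrN [sin x ^+ 2]sin2cos2 exprMn sin2cos2.
  have -> : x = (x / 2) *+ 2 by rewrite mulr2n -splitr.
  move: (x / 2) => h; have -> : h *+ 2 / 2 = h by field.
  by rewrite cos_mulr2n; ring.
by rewrite sqrtr_sqr normrM ger0_norm.
Qed.

Lemma norm_cis x : `|cis x| = 1.
Proof. by rewrite normc_def/= cos2Dsin2 sqrtr1. Qed.

Lemma cis_eq1 x : 0 < x < pi *+ 2 -> cis x != 1.
Proof.
move=> /andP[x0 x2pi]; apply/eqP => /eqP; rewrite eq_sym -subr_eq0 -normr_eq0 norm_cisB1.
rewrite eq_complex/= eqxx andbT mulf_eq0 normr_eq0 pnatr_eq0/=.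
by apply/negP/sin_neq0_pi; rewrite divr_gt0//= ltr_pdivrMr// mulr_natr.
Qed.

Lemma cis_primitive_root n : (0 < n)%N -> n.-primitive_root (cis (2 * pi / n%:R)).
Proof.
move=> n0; rewrite /primitive_root_of_unity n0; apply/forallP => i.
have nN0 : n%:R != 0 :> R by rewrite pnatr_eq0 -lt0n.
rewrite unity_rootE -cisX; have := ltn_ord i; rewrite leq_eqVlt => /predU1P[->|lt_in].
  by rewrite mulrCA mulfV// mulr1 mulr_natl /cis cos2pi sin2pi !eqxx.
rewrite (ltn_eqF lt_in); apply/eqP/negbTE/cis_eq1; have p0 := pi_gt0 R.
have n0R : 0 < n%:R :> R by rewrite ltr0n.
have -> : i.+1%:R * (2 * pi / n%:R) = (i.+1%:R / n%:R) * (pi *+ 2) :> R by rewrite -mulr_natl; field.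
have p2 : 0 < pi *+ 2 :> R by rewrite pmulrn_lgt0.
rewrite mulr_gt0 ?divr_gt0 ?ltr0n//= gtr_pMl//.
by rewrite ltr_pdivrMr// mul1r ltr_nat.
Qed.

(* Take absolute values in [X^n - 1 = prod (X - w^i)] at [X = exp (- 2 i x)]. *)
Lemma norm_sin_nat x n : (0 < n)%N ->
  2 * `|sin (n%:R * x)| = \prod_(0 <= i < n) (2 * `|sin (x + i%:R * (pi / n%:R))|).
Proof.
move=> n0; have nN0 : n%:R != 0 :> R by rewrite pnatr_eq0 -lt0n.
have /(congr1 (fun p => `|p.[cis (- (2 * x))]|)) := factor_Xn_sub_1 (cis_primitive_root n0).
have h (z : R[i]) : ('X^n - 1).[z] = z ^+ n - 1 by rewrite !hornerE.
rewrite horner_prod normr_prod [X in _ = `|X|]h.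
have E (y z : R) : `|cis y - cis z| = (2 * `|sin ((z - y) / 2)|)%:C%C.
  by rewrite -norm_cisB1 -[LHS]mul1r -[in X in X * _](norm_cis (- y)) -normrM mulrBr -!cisD addNr cis0 [- y + z]addrC.
rewrite -cisX -[X in _ = `|_ - X|]cis0 E sub0r mulrN opprK => e.
have -> : n%:R * x = n%:R * (2 * x) / 2 by field.
apply: (fmorph_inj (real_complex R)); rewrite -[LHS]e rmorph_prod.
apply: eq_bigr => i _; rewrite hornerXsubC -cisX E; congr ((2 * `|sin _|)%:C)%C.
by field.
Qed.

(** [(X^n - 1) / (X - 1)] has value [n] at [1], and its linear factors have modulus
    [2 |sin (i pi / n)|] there. *)
Lemma prod_sin_roots n : (0 < n)%N ->
  \prod_(1 <= i < n) (2 * `|sin (i%:R * (pi / n%:R))|) = n%:R :> R.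
Proof.
move=> n0; have := factor_Xn_sub_1 (cis_primitive_root n0).
rewrite big_ltn// expr0 subrX1 => /(mulfI (negbT (polyXsubC_eq0 _)))/(congr1 (fun p => `|p.[1]|)).
rewrite horner_prod normr_prod horner_sum [X in _ = `|X|](eq_bigr (fun=> 1)); last first.
  by move=> i _; rewrite hornerXn expr1n.
rewrite sumr_const card_ord normr_nat => e; apply: (fmorph_inj (real_complex R)).
rewrite [RHS]rmorph_nat -[RHS]e rmorph_prod; apply: eq_bigr => i _.
rewrite hornerXsubC -cisX norm_cisB1; congr ((2 * `|sin _|)%:C)%C.
by field; rewrite pnatr_eq0 -lt0n.
Qed.

End SineProduct.

Section Potential.
Variables (R : realType) (q : nat).
Hypothesis hq : (2 <= q)%N.
Implicit Types x y z : R.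

Let q_gt0 : 0 < q%:R :> R. Proof. by rewrite ltr0n; lia. Qed.

Let q_ge2 : 2 <= q%:R :> R. Proof. by rewrite ler_nat. Qed.

(* [fc q c x = pot (x + c)] on the main lobe, by the product formula for [sin (q y) / sin y]. *)
Definition pot z : R := \sum_(1 <= k < q) ln (2 * sin (pi * (z + k%:R / q%:R))).

(** The derivative of [pot]. Tangent inequalities suffice for most purposes; differentiability
    itself is proved only for the comparison of translates of [pot]. *)
Definition dpot z : R := pi * \sum_(1 <= k < q) cotan (pi * (z + k%:R / q%:R)).

Lemma pot_arg z k : `|z| < q%:R^-1 -> (1 <= k < q)%N -> 0 < pi * (z + k%:R / q%:R) < (pi : R).
Proof.
move=> /ltr_normlP[z1 z2] /andP[k1 kq]; have p0 := pi_gt0 R.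
rewrite pmulr_rgt0// -ltr_pdivlMl// mulVf ?gt_eqF//.
have : q%:R^-1 <= k%:R / q%:R :> R by rewrite ler_peMl ?invr_ge0 ?(ltW q_gt0)// ler1n.
have : k%:R / q%:R <= 1 - q%:R^-1 :> R.
  by rewrite ler_pdivrMr// mulrBl mul1r mulVf ?gt_eqF// lerBrDr natr1 ler_nat.
lra.
Qed.

Lemma pot_tangent y z : `|y| < q%:R^-1 -> `|z| < q%:R^-1 ->
  pot y - pot z <= dpot z * (y - z).
Proof.
move=> hy hz; rewrite /pot /dpot -sumrB mulr_sumr mulr_suml.
apply: ler_sum_nat => k hk.
have /andP[a0 api] := pot_arg hy hk; have /andP[b0 bpi] := pot_arg hz hk.
rewrite !lnM ?posrE ?sin_gt0_pi ?a0 ?b0// opprD addrACA subrr add0r.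
apply: le_trans (lnsin_tangent _ _) _; rewrite ?a0 ?b0//.
by rewrite le_eqVlt; apply/orP; left; apply/eqP; ring.
Qed.

(** Each cotangent drops by at least [pi (y - z)], so all summands are nonnegative and the one with
    [k = 1], present because [q >= 2], is already enough. *)
Lemma dpot_expand y z : `|y| < q%:R^-1 -> `|z| < q%:R^-1 -> z <= y ->
  y - z <= dpot z - dpot y.
Proof.
move=> hy hz zy; have p2 := pi_ge2 R.
rewrite /dpot -mulrBr -sumrB.
have e k : (1 <= k < q)%N ->
    pi * (y - z) <= cotan (pi * (z + k%:R / q%:R)) - cotan (pi * (y + k%:R / q%:R)) :> R.
  move=> hk; have /andP[a0 api] := pot_arg hy hk; have /andP[b0 bpi] := pot_arg hz hk.
  have -> : pi * (y - z) = pi * (y + k%:R / q%:R) - pi * (z + k%:R / q%:R) by ring.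
  by apply: cotan_expand => //; rewrite ler_wpM2l ?pi_ge0// lerD2r.
have : pi * (y - z) <= \sum_(1 <= k < q) (cotan (pi * (z + k%:R / q%:R)) - cotan (pi * (y + k%:R / q%:R))).
  rewrite big_ltn//; apply: (le_trans (e 1%N _)); first by rewrite hq.
  rewrite lerDl big_nat_cond; apply: sumr_ge0 => k; rewrite andbT => hk.
  apply: le_trans (e k _); first by rewrite mulr_ge0 ?pi_ge0 ?subr_ge0.
  by move: hk; lia.
move: (\sum_(1 <= k < q) _) => S h.
have : y - z <= S by apply: le_trans h; rewrite ler_peMl ?subr_ge0//; lra.
have : 0 <= S by apply: le_trans h; rewrite mulr_ge0 ?pi_ge0 ?subr_ge0.
nra.
Qed.

Lemma dpot_le y z : `|y| < q%:R^-1 -> `|z| < q%:R^-1 -> z <= y -> dpot y <= dpot z.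
Proof.
by move=> hy hz zy; have := dpot_expand hy hz zy; rewrite -[_ <= dpot z]subr_ge0; apply: le_trans; rewrite subr_ge0.
Qed.

(** Two tangent inequalities are chained at the midpoint [m]; strictness comes from the strict
    change of [dpot] between [m] and [z]. *)
Lemma pot_tangent_lt y z : `|y| < q%:R^-1 -> `|z| < q%:R^-1 -> y != z ->
  pot y - pot z < dpot z * (y - z).
Proof.
move=> hy hz yz; pose m := (y + z) / 2.
have hm : `|m| < q%:R^-1.
  move: hy hz => /ltr_normlP[? ?] /ltr_normlP[? ?]; apply/ltr_normlP; rewrite /m; split; lra.
have e1 := pot_tangent hy hm; have e2 := pot_tangent hm hz.
have e3 : (dpot m - dpot z) * (y - m) < 0.
  have -> : y - m = (y - z) / 2 by rewrite /m; field.
  case: (ltgtP y z) yz => // lt _.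
    have : m <= z by rewrite /m; lra.
    move=> /(dpot_expand hz hm); have -> : z - m = (z - y) / 2 by rewrite /m; field.
    by move=> h; rewrite pmulr_rlt0; lra.
  have : z <= m by rewrite /m; lra.
  move=> /(dpot_expand hm hz); have -> : m - z = (y - z) / 2 by rewrite /m; field.
  by move=> h; rewrite pmulr_llt0; lra.
have -> : dpot z * (y - z) = dpot z * (y - m) + dpot z * (m - z) by ring.
lra.
Qed.

(** The reindexing [k -> q - k] reflects every argument about [pi / 2]. *)
Lemma potN z : pot (- z) = pot z.
Proof.
rewrite /pot big_nat_rev/=; apply: eq_big_nat => k hk.
congr (ln (2 * _)).
have -> : pi * (- z + (1 + q - k.+1)%:R / q%:R) = pi - pi * (z + k%:R / q%:R) :> R.
  rewrite subSS natrB; last by move: hk; lia.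
  by field; rewrite gt_eqF.
by rewrite addrC sinDpi sinN opprK.
Qed.

Lemma dpotN z : dpot (- z) = - dpot z.
Proof.
rewrite /dpot big_nat_rev/= -mulrN -sumrN; congr (_ * _); apply: eq_big_nat => k hk.
have -> : pi * (- z + (1 + q - k.+1)%:R / q%:R) = pi - pi * (z + k%:R / q%:R) :> R.
  rewrite subSS natrB; last by move: hk; lia.
  by field; rewrite gt_eqF.
exact: cotan_piB.
Qed.

End Potential.

Section PotentialBounds.
Variables (R : realType) (q : nat).
Hypothesis hq : (2 <= q)%N.
Implicit Types x y z : R.


Let q_gt0 : 0 < q%:R :> R. Proof. by rewrite ltr0n; lia. Qed.

Let q_ge2 : 2 <= q%:R :> R. Proof. by rewrite ler_nat. Qed.

Lemma ler_sin_pi e x : 0 <= e -> e <= x -> x <= pi - e -> sin e <= sin x :> R.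
Proof.
move=> e0 ex xe; have p0 := pi_gt0 R.
have mono (u v : R) : 0 <= u -> u <= v -> v <= pi / 2 -> sin u <= sin v :> R.
  move=> u0; rewrite le_eqVlt => /predU1P[-> //|uv] vpi.
  by apply/ltW; rewrite ltr_sin ?in_itv/=; lra.
have [xp|xp] := leP x (pi / 2); first exact: mono.
have -> : sin x = sin (pi - x) by rewrite addrC sinDpi sinN opprK.
by apply: mono; lra.
Qed.

Lemma ln_prod_nat m n (F : nat -> R) : (forall k, (m <= k < n)%N -> 0 < F k) ->
  ln (\prod_(m <= k < n) F k) = \sum_(m <= k < n) ln (F k).
Proof.
move=> F0; rewrite big_nat_cond [RHS]big_nat_cond.
pose K (u v : R) := 0 < u /\ ln u = v.
suff [] : K (\prod_(m <= k < n | (m <= k < n)%N && true) F k)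
  (\sum_(m <= k < n | (m <= k < n)%N && true) ln (F k)) by [].
apply: (big_ind2 K); first by split; [|exact: ln1].
  by move=> u v u' v' [u0 <-] [u0' <-]; split; rewrite ?mulr_gt0// lnM.
by move=> k; rewrite andbT => /F0.
Qed.

Lemma sin_lobe_neq0 z : `|z| < q%:R^-1 -> z != 0 ->
  sin (pi * z) != 0 /\ sin (q%:R * (pi * z)) != 0.
Proof.
have p0 := pi_gt0 R; have q2 := q_ge2.
have aux (u : R) : 0 < u -> u < q%:R^-1 -> sin (pi * u) != 0 /\ sin (q%:R * (pi * u)) != 0.
  move=> u0 uq.
  have qu1 : q%:R * u < 1 by rewrite -[ltRHS](mulfV (lt0r_neq0 q_gt0)) ltr_pM2l.
  split; apply: sin_neq0_pi.
    rewrite mulr_gt0//= gtr_pMr// (lt_trans uq)// invf_lt1//; lra.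
  by rewrite mulrCA !mulr_gt0//= gtr_pMr.
move=> /ltr_normlP[z1 z2]; case: (ltgtP z 0) => // z0 _; last exact: aux.
have [] := aux (- z) _ z1; first by rewrite oppr_gt0.
by rewrite !mulrN !sinN !oppr_eq0.
Qed.

(** In the product formula for [2 |sin (q pi z)|] the factor of index [0] is [2 |sin (pi z)|]; the
    others are positive on the main lobe and have the sum of logarithms [pot z]. *)
Lemma pot_ratio z : `|z| < q%:R^-1 -> z != 0 ->
  pot q z = ln `|sin (q%:R * (pi * z)) / sin (pi * z)|.
Proof.
move=> zq z0; have [sz sqz] := sin_lobe_neq0 zq z0.
rewrite /pot -ln_prod_nat; last first.
  by move=> k hk; rewrite mulr_gt0// sin_gt0_pi// pot_arg.
congr ln; apply: (@mulfI _ (2 * `|sin (pi * z)|)).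
  by rewrite mulf_neq0// normr_eq0.
rewrite normrM normfV.
have -> (u v : R) : v != 0 -> 2 * v * (u / v) = 2 * u by move=> v0; field.
  2: by rewrite normr_eq0.
rewrite norm_sin_nat; last by lia.
rewrite [RHS]big_ltn; last by lia.
rewrite mul0r addr0; congr (_ * _); apply: eq_big_nat => k hk.
rewrite gtr0_norm; first by congr (2 * sin _); ring.
have -> : pi * z + k%:R * (pi / q%:R) = pi * (z + k%:R / q%:R) by ring.
by rewrite sin_gt0_pi// pot_arg.
Qed.

Lemma pot0 : pot q 0 = ln q%:R :> R.
Proof.
have h0 : `|0 : R| < q%:R^-1 by rewrite normr0 invr_gt0.
rewrite /pot -ln_prod_nat; last first.
  by move=> k hk; rewrite mulr_gt0// sin_gt0_pi// pot_arg.
congr ln; rewrite -[RHS]prod_sin_roots; last by lia.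
apply: eq_big_nat => k hk; have /sin_gt0_pi := pot_arg hq h0 hk.
by rewrite add0r mulrCA => /gtr0_norm ->.
Qed.

Lemma sin_eq0_lobe z : `|z| < q%:R^-1 -> (sin (pi * z) == 0) = (z == 0).
Proof.
move=> zq; have [->|z0] := eqVneq z 0; first by rewrite mulr0 sin0 eqxx.
by have [/negbTE] := sin_lobe_neq0 zq z0.
Qed.

Lemma fc_lobe c x : `|x + c| < q%:R^-1 -> fc q c x = (pot q (x + c))%:E.
Proof.
move=> zq; rewrite /fc sin_eq0_lobe//.
have [->|z0] := eqVneq (x + c) 0; first by rewrite pot0.
by have [_ /negbTE ->] := sin_lobe_neq0 zq z0; rewrite -pot_ratio.
Qed.

Lemma sinDnpi (n : nat) x : `|sin (x + n%:R * pi)| = `|sin x|.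
Proof.
elim: n => [|n ih]; first by rewrite mul0r addr0.
by rewrite -natr1 mulrDl mul1r addrA sinDpi normrN.
Qed.

Lemma norm_sinDzpi (n : int) x : `|sin (x + n%:~R * pi)| = `|sin x|.
Proof.
case: n => n; first exact: sinDnpi.
by rewrite NegzE mulrNz mulNr -[in RHS](@subrK _ (n.+1%:R * pi) x) sinDnpi.
Qed.

Lemma fc_ratioE c x : fc q c x =
  if `|sin (pi * (x + c))| == 0 then (ln q%:R)%:E
  else if `|sin (q%:R * (pi * (x + c)))| == 0 then -oo%E
  else (ln (`|sin (q%:R * (pi * (x + c)))| / `|sin (pi * (x + c))|))%:E.
Proof. by rewrite /fc !normr_eq0 normrM normfV. Qed.

Lemma fcDz c x (n : int) : fc q c (x + n%:~R) = fc q c x.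
Proof.
rewrite !fc_ratioE.
have -> : pi * (x + n%:~R + c) = pi * (x + c) + n%:~R * pi by ring.
have -> : q%:R * (pi * (x + c) + n%:~R * pi) = q%:R * (pi * (x + c)) + (q%:Z * n)%:~R * pi.
  by rewrite intrM; ring.
by rewrite !norm_sinDzpi.
Qed.

(** The reflection [b -> 1/q - b] preserves [|sin (q pi b)|], so only the denominators
    contribute. *)
Lemma pot_reflect b : 0 < b < q%:R^-1 ->
  pot q (q%:R^-1 - b) - pot q b = ln (sin (pi * b)) - ln (sin (pi * (q%:R^-1 - b))) :> R.
Proof.
move=> /andP[b0 bq]; have p0 := pi_gt0 R; have q2 := q_ge2.
have lobe (u : R) : 0 < u -> u < q%:R^-1 ->
    pot q u = ln `|sin (q%:R * (pi * u))| - ln (sin (pi * u)).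
  move=> u0 uq; have nu : `|u| < q%:R^-1 by rewrite gtr0_norm.
  have [s1 s2] := sin_lobe_neq0 nu (lt0r_neq0 u0).
  rewrite pot_ratio ?lt0r_neq0// normrM normfV ln_div ?posrE ?normr_gt0//.
  rewrite [`|sin (pi * u)|]gtr0_norm// sin_gt0_pi// mulr_gt0//= gtr_pMr//.
  by rewrite (lt_trans uq)// invf_lt1//; lra.
rewrite !lobe ?subr_gt0//; last by lra.
have -> : q%:R * (pi * (q%:R^-1 - b)) = - (q%:R * (pi * b)) + 1%:R * pi.
  by field; rewrite gt_eqF.
by rewrite sinDnpi sinN normrN; ring.
Qed.

(** At distance [e] from the ends of the lobe all the sines involved are at least
    [s = sin (pi e)]. *)
Lemma dpot_lipschitz e : 0 < e -> e < q%:R^-1 ->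
  exists2 K : R, 0 < K & forall y z, `|y| <= q%:R^-1 - e -> `|z| <= q%:R^-1 - e ->
    z <= y -> dpot q z - dpot q y <= K * (y - z).
Proof.
move=> e0 eq; have p0 := pi_gt0 R; have q2 := q_ge2; pose s := sin (pi * e) : R.
have s0 : 0 < s.
  by rewrite sin_gt0_pi// mulr_gt0//= gtr_pMr// (lt_trans eq)// invf_lt1//; lra.
exists (pi * \sum_(1 <= k < q) (pi / s ^+ 2)).
  by rewrite sumr_const_nat -mulr_natl !mulr_gt0 ?invr_gt0 ?exprn_gt0 ?ltr0n ?subn_gt0.
move=> y z hy hz zy.
have sk (w : R) k : `|w| <= q%:R^-1 - e -> (1 <= k < q)%N -> s <= sin (pi * (w + k%:R / q%:R)).
  move=> /ler_normlP[w1 w2] /andP[k1 kq].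
  have h1 : q%:R^-1 <= k%:R / q%:R :> R by rewrite ler_peMl ?invr_ge0 ?(ltW q_gt0)// ler1n.
  have h2 : k%:R / q%:R <= 1 - q%:R^-1 :> R.
    by rewrite ler_pdivrMr// mulrBl mul1r mulVf ?gt_eqF// lerBrDr natr1 ler_nat.
  apply: ler_sin_pi.
  - by rewrite mulr_ge0 ?ltW.
  - by rewrite ler_pM2l//; lra.
  - by rewrite -[X in _ <= X - _]mulr1 -mulrBr ler_pM2l//; lra.
rewrite /dpot -mulrBr -sumrB -mulrA ler_pM2l// mulr_suml.
apply: ler_sum_nat => k hk; apply: le_trans (cotanB_le s0 (sk _ _ hz hk) (sk _ _ hy hk) _) _.
  by rewrite ler_pM2l// lerD2r.
by rewrite le_eqVlt; apply/orP; left; apply/eqP; ring.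
Qed.

(** At the right end of the lobe the sine with [k = q - 1] is [sin (pi e)], whose logarithm tends to
    minus infinity; the logarithms of the other sines are at most [0]. *)
Lemma pot_unbounded (M : R) : exists2 e, 0 < e < (2 * q%:R)^-1 & pot q (q%:R^-1 - e) < M.
Proof.
have p0 := pi_gt0 R; have q2 := q_ge2.
(* Chosen so that [ln (pi r) = M - (q - 1) ln 2 - 1]: the term [(q - 1) ln 2] collects the factors
   [2] in [pot], and the [1] gives strictness. *)
pose r := expR (M - (q%:R - 1) * ln 2 - 1) / pi : R.
have r0 : 0 < r by rewrite divr_gt0// expR_gt0.
pose e := Num.min r (3 * q%:R)^-1 : R.
have q3 : 0 < (3 * q%:R)^-1 :> R by rewrite invr_gt0 mulr_gt0.
have e0 : 0 < e by rewrite lt_min r0.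
have e3 : e <= (3 * q%:R)^-1 by rewrite ge_min lexx orbT.
have er : e <= r by rewrite ge_min lexx.
have h3 : (3 * q%:R)^-1 = q%:R^-1 / 3 :> R by field; rewrite gt_eqF.
have h2 : (2 * q%:R)^-1 = q%:R^-1 / 2 :> R by field; rewrite gt_eqF.
have iq : 0 < q%:R^-1 :> R by rewrite invr_gt0.
have iq2 : q%:R^-1 <= 2^-1 :> R by rewrite lef_pV2 ?posrE.
exists e; first by rewrite e0/=; lra.
have hz : `|q%:R^-1 - e| < q%:R^-1 by rewrite ger0_norm; lra.
have S1 k : (1 <= k < q)%N -> 0 < sin (pi * (q%:R^-1 - e + k%:R / q%:R)).
  by move=> hk; rewrite sin_gt0_pi// pot_arg.
have -> : pot q (q%:R^-1 - e) = \sum_(1 <= k < q) ln (sin (pi * (q%:R^-1 - e + k%:R / q%:R)))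
    + (q%:R - 1) * ln 2.
  rewrite /pot -[(q%:R - 1)](@natrB _ q 1) ?mulr_natl -?sumr_const_nat -?big_split; last exact: ltnW.
  by apply: eq_big_nat => k hk; rewrite lnM ?posrE ?S1// addrC.
suff : \sum_(1 <= k < q) ln (sin (pi * (q%:R^-1 - e + k%:R / q%:R))) <= M - (q%:R - 1) * ln 2 - 1.
  by lra.
have [p pq] : exists p, q = p.+1 by exists q.-1; rewrite prednK// ltnW.
have -> : index_iota 1 q = index_iota 1 p.+1 by rewrite pq.
rewrite big_nat_recr/=; last by rewrite -ltnS -pq.
apply: (@le_trans _ _ (ln (sin (pi * (q%:R^-1 - e + p%:R / q%:R))))).
  rewrite gerDr big_nat_cond; apply: sumr_le0 => k; rewrite andbT => hk.
  by apply: ln_le0; exact: sin_le1.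
have -> : pi * (q%:R^-1 - e + p%:R / q%:R) = - (pi * e) + pi.
  have -> : p%:R = q%:R - 1 :> R by rewrite pq -natr1 addrK.
  by field; rewrite gt_eqF.
rewrite sinDpi sinN opprK -[leRHS]expRK ler_ln ?posrE ?expR_gt0//.
  apply: le_trans (sin_le_id _) _; first by rewrite mulr_ge0 ?ltW.
  by rewrite mulrC -ler_pdivlMr.
rewrite sin_gt0_pi// mulr_gt0//= gtr_pMr//; lra.
Qed.

End PotentialBounds.

(** * The transfer series and its slopes *)

Section FractionalPart.
Variable R : realType.
Implicit Types x y : R.

Definition frac x : R := x - (Num.floor x)%:~R.

Lemma frac_ge0 x : 0 <= frac x.
Proof. by rewrite /frac subr_ge0 floor_le. Qed.

Lemma frac_lt1 x : frac x < 1.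
Proof. by rewrite /frac ltrBlDl -[1]/(1%:~R) -intrD floorD1_gt. Qed.

Lemma fracDz x (n : int) : frac (x + n%:~R) = frac x.
Proof. by rewrite /frac floorDrz ?intr_int// intrKfloor intrD; ring. Qed.

Lemma floor_small x : 0 <= x -> x < 1 -> Num.floor x = 0.
Proof. by move=> x0 x1; apply: floor_def; rewrite x0. Qed.

Lemma frac_small x : 0 <= x -> x < 1 -> frac x = x.
Proof. by move=> x0 x1; rewrite /frac floor_small// subr0. Qed.

Lemma frac_eqz x y (n : int) : x = y + n%:~R -> frac x = frac y.
Proof. by move=> ->; rewrite fracDz. Qed.

Lemma fracK x : frac x = x + (- Num.floor x)%:~R.
Proof. by rewrite /frac intrN. Qed.

End FractionalPart.

(* [slopes l L a b u]: all difference quotients of [u] on [a, b] lie in [l, L]. *)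
Definition slopes (R : realType) (l L a b : R) (u : R -> R) :=
  forall x y, a <= x -> x <= y -> y <= b -> l * (y - x) <= u y - u x <= L * (y - x).

Section Transfer.
Variables (R : realType) (q : nat).
Hypothesis hq : (2 <= q)%N.
Implicit Types (th x y t l L : R) (u v phi : R -> R).

Let q_gt0 : 0 < q%:R :> R. Proof. by rewrite ltr0n; lia. Qed.

Let q_ge2 : 2 <= q%:R :> R. Proof. by rewrite ler_nat. Qed.

Lemma slopesD l L l' L' a b u v : slopes l L a b u -> slopes l' L' a b v ->
  slopes (l + l') (L + L') a b (fun t => u t + v t).
Proof.
move=> su sv x y ax xy yb; have := su x y ax xy yb; have := sv x y ax xy yb.
by move=> /andP[? ?] /andP[? ?]; rewrite !mulrDl opprD addrACA !lerD.
Qed.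

Lemma slopesN l L a b u : slopes l L a b u -> slopes (- L) (- l) a b (fun t => - u t).
Proof.
move=> su x y ax xy yb; have /andP[? ?] := su x y ax xy yb.
by rewrite -opprD !mulNr !lerN2; apply/andP.
Qed.

Lemma slopesS l L l' L' a b u : l' <= l -> L <= L' -> slopes l L a b u -> slopes l' L' a b u.
Proof.
move=> ll LL su x y ax xy yb; have /andP[h1 h2] := su x y ax xy yb.
apply/andP; split; [apply: le_trans h1|apply: (le_trans h2)];
  by rewrite ler_wpM2r ?subr_ge0.
Qed.

(* The action on primitives of [u' |-> (u' o tau) / q], where [tau] is the inverse branch of
   [t |-> q t + th] with values in [0, 1/q). *)
Definition trans th u t : R :=
  u (frac (t - th) / q%:R) - u 0 + (Num.floor (t - th))%:~R * (u q%:R^-1 - u 0).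

Lemma branch_itv t : 0 <= frac t / q%:R /\ frac t / q%:R <= q%:R^-1.
Proof.
by rewrite divr_ge0 ?frac_ge0 ?(ltW q_gt0)// ler_piMl ?invr_ge0 ?(ltW q_gt0)// (ltW (frac_lt1 t)).
Qed.

(** Between consecutive integers of [t - th] the slope of [u] is divided by [q]. A longer interval
    is cut into two end pieces and [j' - j - 1] full branches, over each of which [u] runs through
    all of [[0, 1/q]]. *)
Lemma trans_slopes l L a b th u : slopes l L 0 q%:R^-1 u -> slopes (l / q%:R) (L / q%:R) a b (trans th u).
Proof.
move=> su x y _ xy _; rewrite /trans.
have iq : 0 < q%:R^-1 :> R by rewrite invr_gt0.
set p := frac (x - th); set p' := frac (y - th).
set j := Num.floor (x - th); set j' := Num.floor (y - th).
have yx : (y - x) / q%:R = p' / q%:R - p / q%:R + (j' - j)%:~R * q%:R^-1.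
  by rewrite /p /p' /frac -/j -/j' intrB; ring.
have [p0 p1] := branch_itv (x - th); have [p0' p1'] := branch_itv (y - th).
rewrite -/p -/p' in p0 p1 p0' p1'.
have jj' : j <= j' by apply: le_floor; rewrite lerD2r.
rewrite -!mulrA ![q%:R^-1 * _]mulrC yx.
have [e|nej] := eqVneq j j'.
  rewrite e subrr mul0r addr0.
  have -> : u (p' / q%:R) - u 0 + j'%:~R * (u q%:R^-1 - u 0) -
    (u (p / q%:R) - u 0 + j'%:~R * (u q%:R^-1 - u 0)) = u (p' / q%:R) - u (p / q%:R) by ring.
  apply: su => //; rewrite ler_pM2r// /p /p' /frac -/j -/j' e.
  by rewrite !lerD2r.
have lt_jj' : j + 1 <= j' by rewrite lezD1 lt_neqAle nej.
have m0 : 0 <= (j' - j - 1)%:~R :> R by rewrite ler0z; lia.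
have /andP[h1 h2] := su _ _ (lexx 0) p0' p1'.
have /andP[h3 h4] := su _ _ p0 p1 (lexx _).
have /andP[h5 h6] := su _ _ (lexx 0) (ltW iq) (lexx _).
have k5 : (j' - j - 1)%:~R * (l * (q%:R^-1 - 0)) <= (j' - j - 1)%:~R * (u q%:R^-1 - u 0) by rewrite ler_wpM2l.
have k6 : (j' - j - 1)%:~R * (u q%:R^-1 - u 0) <= (j' - j - 1)%:~R * (L * (q%:R^-1 - 0)) by rewrite ler_wpM2l.
move: h1 h2 h3 h4 k5 k6; rewrite !intrB; move: (p / _) (p' / _) (j%:~R) (j'%:~R) => P P' J J'.
move: (q%:R^-1) => r; move: (u P) (u P') (u 0) (u r) => uP uP' u0 ur.
by move=> h1 h2 h3 h4 k5 k6; apply/andP; split; lra.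
Qed.

Lemma transD th u v t : trans th (fun s => u s + v s) t = trans th u t + trans th v t.
Proof. by rewrite /trans; ring. Qed.

Lemma transBD th phi u v t : trans th (fun s => phi s + u s) t - trans th (fun s => phi s + v s) t =
  trans th (fun s => u s - v s) t.
Proof. by rewrite /trans; ring. Qed.

Lemma transDz th u t (n : int) : trans th u (t + n%:~R) = trans th u t + n%:~R * (u q%:R^-1 - u 0).
Proof.
have e : t + n%:~R - th = t - th + n%:~R by ring.
by rewrite /trans e fracDz floorDrz ?intr_int// intrKfloor intrD; ring.
Qed.

Lemma trans_branch th u s : 0 <= s -> s <= q%:R^-1 -> trans th u (q%:R * s + th) = u s - u 0.
Proof.
move=> s0; rewrite /trans addrK le_eqVlt => /predU1P[->|sq].
  rewrite mulfV ?gt_eqF// /frac -[1]/(1%:~R) intrKfloor subrr mul0r; ring.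
have qs1 : q%:R * s < 1 by rewrite -[ltRHS](mulfV (lt0r_neq0 q_gt0)) ltr_pM2l.
have qs0 : 0 <= q%:R * s by rewrite mulr_ge0 ?(ltW q_gt0).
by rewrite frac_small// floor_small// mul0r addr0 mulrAC mulfV ?mul1r// gt_eqF.
Qed.

Lemma trans_bound M th u t : slopes (- M) M 0 q%:R^-1 u -> `|trans th u t| <= M / q%:R * `|t - th|.
Proof.
move=> su; have z : trans th u th = 0.
  by have := @trans_branch th u 0; rewrite mulr0 add0r subrr; apply => //; rewrite invr_ge0 (ltW q_gt0).
have sl a b := @trans_slopes (- M) M a b th u su.
have [h|h] := leP th t.
  have := sl _ _ th t (lexx _) h (lexx _); rewrite z subr0 mulNr mulNr => h'.
  by rewrite ler_norml [`|t - th|]ger0_norm ?subr_ge0.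
have := sl _ _ t th (lexx _) (ltW h) (lexx _); rewrite z sub0r => /andP[h1 h2].
rewrite [`|t - th|]ltr0_norm ?subr_lt0// opprB ler_norml; apply/andP; split; lra.
Qed.

(** Partial sums of the series obtained by iterating the fixed point equation
    [Psi = trans (phi + Psi)] from zero. *)
Fixpoint psin th phi n : R -> R :=
  if n is n'.+1 then trans th (fun s => phi s + psin th phi n' s) else fun=> 0.

Definition Psi th phi t : R := limn (fun n => psin th phi n t).

(** The difference of consecutive sums is the image under [trans] of the preceding difference, so
    its slopes are divided by [q]. *)
Lemma psin_step M th phi n a b : 0 <= M -> slopes (- M) M 0 q%:R^-1 phi ->
  slopes (- (M / q%:R ^+ n.+1)) (M / q%:R ^+ n.+1) a b (fun t => psin th phi n.+1 t - psin th phi n t).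
Proof.
move=> M0 sphi; elim: n a b => [|n ih] a b.
  move=> x y ax xy yb; rewrite expr1 !subr0.
  have := @trans_slopes (- M) M a b th (fun s => phi s + 0) _ x y ax xy yb.
  by rewrite mulNr; apply => x' y' *; rewrite !addr0; exact: sphi.
pose d := fun t => psin th phi n.+1 t - psin th phi n t.
have := @trans_slopes _ _ a b th d (ih 0 q%:R^-1).
have -> : - (M / q%:R ^+ n.+1) / q%:R = - (M / q%:R ^+ n.+2).
  by rewrite [q%:R ^+ n.+2]exprSr invfM; ring.
have -> : M / q%:R ^+ n.+1 / q%:R = M / q%:R ^+ n.+2 by rewrite [q%:R ^+ n.+2]exprSr invfM; ring.
move=> sd x y ax xy yb; have := sd x y ax xy yb.
by rewrite -!(transBD _ phi).
Qed.

Lemma psin_step_bound M th phi n t : 0 <= M -> slopes (- M) M 0 q%:R^-1 phi ->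
  `|psin th phi n.+1 t - psin th phi n t| <= M / q%:R ^+ n.+1 * `|t - th|.
Proof.
move=> M0 sphi; case: n => [|n].
  rewrite expr1 subr0; apply: trans_bound.
  by move=> x' y' *; rewrite /= !addr0; exact: sphi.
have -> : psin th phi n.+2 t - psin th phi n.+1 t =
    trans th (fun t => psin th phi n.+1 t - psin th phi n t) t.
  by rewrite -(transBD _ phi).
apply: le_trans (trans_bound th t (psin_step th n M0 sphi)) _.
by rewrite [q%:R ^+ n.+2]exprSr invfM mulrA.
Qed.

Lemma psin_cvg M th phi t : 0 <= M -> slopes (- M) M 0 q%:R^-1 phi ->
  (fun n => psin th phi n t) @ \oo --> Psi th phi t.
Proof.
move=> M0 sphi; pose d n := psin th phi n.+1 t - psin th phi n t.
have e : (fun n => psin th phi n t) = series d.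
  apply/funext; elim => [|n ih]; first by rewrite /series/= big_geq.
  by rewrite seriesSr -ih /d addrC subrK.
suff : cvgn (series d) by rewrite -e.
apply: normed_cvg; pose z := `|t - th| * M / q%:R.
have z0 : 0 <= z by rewrite /z !mulr_ge0 ?invr_ge0 ?(ltW q_gt0).
apply: (@series_le_cvg _ _ (geometric z q%:R^-1)).
- by move=> n /=.
- by move=> n /=; rewrite mulr_ge0// exprn_ge0// invr_ge0 ltW.
- move=> n /=; apply: le_trans (psin_step_bound th n t M0 sphi) _.
  by rewrite /z exprS invfM exprVn le_eqVlt; apply/orP; left; apply/eqP; ring.
- apply: is_cvg_geometric_series; rewrite gtr0_norm ?invr_gt0// invf_lt1//.
  by have := q_ge2; lra.
Qed.

(** The cohomological equation in disguise: read along the inverse branch it is [Psi_branch]. *)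
Lemma PsiE M th phi t : 0 <= M -> slopes (- M) M 0 q%:R^-1 phi ->
  Psi th phi t = trans th (fun s => phi s + Psi th phi s) t.
Proof.
move=> M0 sphi; have c s := @psin_cvg M th phi s M0 sphi.
have h1 : (fun n => psin th phi n.+1 t) @ \oo --> Psi th phi t.
  by have := c t; rewrite -cvg_shiftS.
suff h2 : (fun n => psin th phi n.+1 t) @ \oo --> trans th (fun s => phi s + Psi th phi s) t.
  exact: cvg_unique h1 h2.
have c' s : (fun n => phi s + psin th phi n s) @ \oo --> phi s + Psi th phi s.
  by apply: cvgD; [exact: cvg_cst | exact: c].
rewrite /= /trans; apply: cvgD.
  by apply: cvgB; exact: c'.
by apply: cvgMl_tmp; apply: cvgB; exact: c'.
Qed.

End Transfer.

Section TransferFixedPoint.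
Variables (R : realType) (q : nat).
Hypothesis hq : (2 <= q)%N.
Implicit Types (th x y t l L M : R) (u v phi : R -> R).

Let q_gt0 : 0 < q%:R :> R. Proof. by rewrite ltr0n; lia. Qed.

Let q_ge2 : 2 <= q%:R :> R. Proof. by rewrite ler_nat. Qed.

Let iq_gt0 : 0 < q%:R^-1 :> R. Proof. by rewrite invr_gt0. Qed.

Lemma slopes_ge0 M u : slopes (- M) M 0 q%:R^-1 u -> 0 <= M.
Proof.
move=> /(_ 0 q%:R^-1 (lexx _) (ltW iq_gt0) (lexx _)); have := iq_gt0.
by rewrite subr0 => h /andP[h1 h2]; rewrite -(pmulr_lge0 _ h); lra.
Qed.

Lemma Psi_cvg M th phi t : slopes (- M) M 0 q%:R^-1 phi ->
  psin q th phi n t @[n --> \oo] --> Psi q th phi t.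
Proof. by move=> s; exact: psin_cvg (slopes_ge0 s) s. Qed.

(** The common factor is the geometric sum [1/q + ... + 1/q^n]. *)
Lemma psin_slopes l L th phi n a b : slopes l L 0 q%:R^-1 phi ->
  slopes (l * ((1 - q%:R^-1 ^+ n) / (q%:R - 1))) (L * ((1 - q%:R^-1 ^+ n) / (q%:R - 1))) a b
    (psin q th phi n).
Proof.
move=> sphi; have q2 := q_ge2; elim: n a b => [|n ih] a b.
  by move=> x y *; rewrite expr0 !subrr mul0r !mulr0 mul0r lexx.
have := @trans_slopes R q hq _ _ a b th _ (slopesD sphi (ih 0 q%:R^-1)).
suff e c : (c + c * ((1 - q%:R^-1 ^+ n) / (q%:R - 1))) / q%:R =
  c * ((1 - q%:R^-1 ^+ n.+1) / (q%:R - 1)) :> R by rewrite !e.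
by rewrite exprS; field; rewrite !gt_eqF//; lra.
Qed.

Lemma Psi_slopes M l L th phi a b : slopes (- M) M 0 q%:R^-1 phi -> slopes l L 0 q%:R^-1 phi ->
  slopes (l / (q%:R - 1)) (L / (q%:R - 1)) a b (Psi q th phi).
Proof.
move=> sM sphi x y ax xy yb.
have cP t := Psi_cvg (th := th) (t := t) sM.
have cq : q%:R^-1 ^+ n @[n --> \oo] --> (0 : R).
  by apply: cvg_expr; rewrite gtr0_norm// invf_lt1//; have := q_ge2; lra.
have cs c : c * ((1 - q%:R^-1 ^+ n) / (q%:R - 1)) * (y - x) @[n --> \oo] -->
    c * ((1 - 0) / (q%:R - 1)) * (y - x).
  apply: cvgMr_tmp; apply: cvgMl_tmp; apply: cvgMr_tmp; apply: cvgB => //; exact: cvg_cst.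
have e c : c / (q%:R - 1) * (y - x) = c * ((1 - 0) / (q%:R - 1)) * (y - x).
  by rewrite subr0 mul1r.
rewrite !e.
have cd : psin q th phi n y - psin q th phi n x @[n --> \oo] --> Psi q th phi y - Psi q th phi x.
  exact: cvgB.
apply/andP; split.
  apply: (ler_cvg_to (cs l) cd); apply: nearW => n.
  by have /andP[] := psin_slopes th n sphi ax xy yb.
apply: (ler_cvg_to cd (cs L)); apply: nearW => n.
by have /andP[] := psin_slopes th n sphi ax xy yb.
Qed.

Lemma psinD th u v n t :
  psin q th (fun s => u s + v s) n t = psin q th u n t + psin q th v n t.
Proof.
elim: n t => [|n ih] t /=; first by rewrite addr0.
by rewrite -transD /trans !ih; ring.
Qed.

Lemma PsiD M M' th u v t : slopes (- M) M 0 q%:R^-1 u -> slopes (- M') M' 0 q%:R^-1 v ->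
  Psi q th (fun s => u s + v s) t = Psi q th u t + Psi q th v t.
Proof.
move=> su sv; have suv : slopes (- (M + M')) (M + M') 0 q%:R^-1 (fun s => u s + v s).
  by rewrite opprD; exact: slopesD.
have h1 := Psi_cvg (th := th) (t := t) suv.
suff h2 : psin q th (fun s => u s + v s) n t @[n --> \oo] --> Psi q th u t + Psi q th v t.
  exact: cvg_unique h1 h2.
rewrite (funext (fun n => psinD th u v n t)).
by apply: cvgD; [exact: Psi_cvg su | exact: Psi_cvg sv].
Qed.

Lemma psinN th u n t : psin q th (fun s => - u s) n t = - psin q th u n t.
Proof. by elim: n t => [|n ih] t /=; rewrite ?oppr0// /trans !ih; ring. Qed.

Lemma PsiN M th u t : slopes (- M) M 0 q%:R^-1 u ->
  Psi q th (fun s => - u s) t = - Psi q th u t.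
Proof.
move=> su; have suN : slopes (- M) M 0 q%:R^-1 (fun s => - u s).
  by have := slopesN su; rewrite opprK.
have h1 := Psi_cvg (th := th) (t := t) suN.
suff h2 : psin q th (fun s => - u s) n t @[n --> \oo] --> - Psi q th u t.
  exact: cvg_unique h1 h2.
rewrite (funext (fun n => psinN th u n t)).
by apply: cvgN; exact: Psi_cvg su.
Qed.

(* The amount by which [Psi] grows over a period. *)
Definition kap th phi : R := phi q%:R^-1 + Psi q th phi q%:R^-1 - (phi 0 + Psi q th phi 0).

Lemma PsiDz M th phi t (n : int) : slopes (- M) M 0 q%:R^-1 phi ->
  Psi q th phi (t + n%:~R) = Psi q th phi t + n%:~R * kap th phi.
Proof.
by move=> s; rewrite (PsiE hq th _ (slopes_ge0 s) s) transDz -(PsiE hq th _ (slopes_ge0 s) s).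
Qed.

Lemma Psi_branch M th phi s : slopes (- M) M 0 q%:R^-1 phi -> 0 <= s -> s <= q%:R^-1 ->
  Psi q th phi (q%:R * s + th) = phi s + Psi q th phi s - (phi 0 + Psi q th phi 0).
Proof.
by move=> sphi s0 s1; rewrite (PsiE hq th _ (slopes_ge0 sphi) sphi) trans_branch.
Qed.

(* Total variation of [Psi] over the gap: each point of [0, 1/q] first enters the gap only once. *)
Lemma Psi_gap M th phi : slopes (- M) M 0 q%:R^-1 phi ->
  Psi q th phi 1 - Psi q th phi q%:R^-1 = phi q%:R^-1 - phi 0.
Proof. by move=> s; have := PsiDz th 0 1 s; rewrite add0r mul1r /kap => ->; ring. Qed.

(** For nondecreasing [phi] the function [Psi] is nondecreasing too, so an increment over part of
    the gap is at most the total one of [Psi_gap]. *)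
Lemma Psi_gap_ge0 M th phi t t' : slopes 0 M 0 q%:R^-1 phi ->
  q%:R^-1 <= t -> t <= t' -> t' <= 1 ->
  0 <= Psi q th phi t' - Psi q th phi t <= phi q%:R^-1 - phi 0.
Proof.
move=> sphi qt tt t1.
have sM : slopes (- M) M 0 q%:R^-1 phi.
  apply: (slopesS _ _ sphi) => //; rewrite oppr_le0.
  have /andP[h1 h2] := sphi 0 q%:R^-1 (lexx _) (ltW iq_gt0) (lexx _).
  by have := le_trans h1 h2; rewrite mul0r subr0 pmulr_lge0.
have m x y : x <= y -> Psi q th phi x <= Psi q th phi y.
  move=> xy; have := @Psi_slopes M 0 M th phi x y sM sphi x y (lexx _) xy (lexx _).
  by rewrite !mul0r subr_ge0 => /andP[].
have := Psi_gap th sM; have := m _ _ qt; have := m _ _ tt; have := m _ _ t1.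
move: (Psi q th phi q%:R^-1) (Psi _ _ _ t) (Psi _ _ _ t') (Psi _ _ _ 1) => a b c d.
by move: (phi q%:R^-1) (phi 0) => p p' h1 h2 h3 h4; apply/andP; split; lra.
Qed.

(* [phi = phi1 + phi2]: the total variation bound is used for [phi1], the slope bound for [phi2]. *)
Lemma gap_split K M lam th phi phi1 t t' : slopes (- M) M 0 q%:R^-1 phi ->
  slopes 0 K 0 q%:R^-1 phi1 ->
  (forall x y, 0 <= x -> x <= y -> y <= q%:R^-1 ->
    phi y - phi x - (phi1 y - phi1 x) <= lam * (y - x)) ->
  q%:R^-1 <= t -> t <= t' -> t' <= 1 ->
  Psi q th phi t' - Psi q th phi t <=
  phi1 q%:R^-1 - phi1 0 + lam * (t' - t) / (q%:R - 1).
Proof.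
move=> sM s1 h2 qt tt t1; pose phi2 t := phi t - phi1 t.
have K0 : 0 <= K.
  have /andP[k1 k2] := s1 0 q%:R^-1 (lexx _) (ltW iq_gt0) (lexx _).
  by have := le_trans k1 k2; rewrite mul0r subr0 pmulr_lge0.
have M0 := slopes_ge0 sM.
have sK : slopes (- K) K 0 q%:R^-1 phi1 by apply: (slopesS _ _ s1); rewrite ?oppr_le0.
have s2 : slopes (- (M + K)) lam 0 q%:R^-1 phi2.
  move=> x y x0 xy y1; have := h2 x y x0 xy y1.
  have /andP[h3 h4] := s1 x y x0 xy y1; have /andP[h5 h6] := sM x y x0 xy y1.
  by rewrite /phi2 => h7; apply/andP; split; lra.
have sK2 : slopes (- (M + K + `|lam|)) (M + K + `|lam|) 0 q%:R^-1 phi2.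
  have l0 := normr_ge0 lam; have l1 := ler_norm lam.
  by apply: (slopesS _ _ s2); lra.
have e r : Psi q th phi r = Psi q th phi1 r + Psi q th phi2 r.
  rewrite -(PsiD th r sK sK2); congr (Psi _ _ _ _); apply/funext => x.
  by rewrite /phi2 addrC subrK.
have /andP[_ h3] := Psi_gap_ge0 th s1 qt tt t1.
have /andP[_ h4] := Psi_slopes th sK2 s2 (lexx t) tt (lexx t').
rewrite !e mulrAC; lra.
Qed.

(* [gap_split] with [phi1 t = phi (min t s) - lam * min t s]. *)
Lemma bathtub M lam s th phi t t' : 0 <= s -> s <= q%:R^-1 ->
  slopes (- M) M 0 q%:R^-1 phi -> slopes lam M 0 s phi -> slopes (- M) lam s q%:R^-1 phi ->
  q%:R^-1 <= t -> t <= t' -> t' <= 1 ->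
  Psi q th phi t' - Psi q th phi t <=
  phi s - phi 0 - lam * s + lam * (t' - t) / (q%:R - 1).
Proof.
move=> s0 s1 sM sl sr qt tt t1.
pose phi1 r := phi (Num.min r s) - lam * Num.min r s.
have M0 := slopes_ge0 sM; have l0 := normr_ge0 lam.
have := @gap_split (M + `|lam|) M lam th phi phi1 t t' sM.
rewrite /phi1 (min_r s1) (min_l s0) mulr0 subr0 [_ - lam * s - _]addrAC; apply => //.
- move=> x y x0 xy y1.
  have [x'0 xy' ys d] : [/\ 0 <= Num.min x s, Num.min x s <= Num.min y s, Num.min y s <= s &
      Num.min y s - Num.min x s <= y - x].
    split.
    + by rewrite le_min x0.
    + by rewrite le_min ge_min xy ge_min lexx orbT.
    + by rewrite ge_min lexx orbT.
    + by rewrite /Num.min; case: ltP => ?; case: ltP => ?; lra.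
  move: (Num.min x s) (Num.min y s) x'0 xy' ys d => x' y' x'0 xy' ys d.
  have /andP[h1 h2] := sl x' y' x'0 xy' ys.
  have h3 : - lam * (y' - x') <= `|lam| * (y' - x').
    by rewrite ler_wpM2r ?subr_ge0// -normrN ler_norm.
  have h4 : (M + `|lam|) * (y' - x') <= (M + `|lam|) * (y - x) by rewrite ler_wpM2l// addr_ge0.
  by rewrite mul0r; apply/andP; split; lra.
- move=> x y x0 xy y1; rewrite /Num.min; case: ltP => ys; case: ltP => xs; try lra.
  + have /andP[_ h5] := sr s y (lexx s) ys y1; lra.
  + have /andP[_ h5] := sr x y xs xy y1; lra.
Qed.

(** Here the large slopes are to the right of [s], so the part in excess of [lam] is
    [phi (max t s) - lam * max t s]. *)
Lemma bathtub_convex M lam s th phi t t' : 0 <= s -> s <= q%:R^-1 ->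
  slopes (- M) M 0 q%:R^-1 phi -> slopes (- M) lam 0 s phi -> slopes lam M s q%:R^-1 phi ->
  q%:R^-1 <= t -> t <= t' -> t' <= 1 ->
  Psi q th phi t' - Psi q th phi t <=
  phi q%:R^-1 - phi s - lam * (q%:R^-1 - s) + lam * (t' - t) / (q%:R - 1).
Proof.
move=> s0 s1 sM sl sr qt tt t1.
pose phi1 r := phi (Num.max r s) - lam * Num.max r s.
have M0 := slopes_ge0 sM; have l0 := normr_ge0 lam.
have e (a b c d : R) : a - b - c * (d - s) = a - c * d - (b - c * s) by ring.
have := @gap_split (M + `|lam|) M lam th phi phi1 t t' sM.
rewrite /phi1 (max_l s1) (max_r s0) e; apply => //.
- move=> x y x0 xy y1.
  have [x'0 xy' ys d] : [/\ s <= Num.max x s, Num.max x s <= Num.max y s, Num.max y s <= q%:R^-1 &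
      Num.max y s - Num.max x s <= y - x].
    split.
    + by rewrite le_max lexx orbT.
    + by rewrite ge_max le_max xy le_max lexx orbT.
    + by rewrite ge_max y1.
    + by rewrite /Num.max; case: ltP => ?; case: ltP => ?; lra.
  move: (Num.max x s) (Num.max y s) x'0 xy' ys d => x' y' x'0 xy' ys d.
  have /andP[h1 h2] := sr x' y' x'0 xy' ys.
  have h3 : - lam * (y' - x') <= `|lam| * (y' - x').
    by rewrite ler_wpM2r ?subr_ge0// -normrN ler_norm.
  have h4 : (M + `|lam|) * (y' - x') <= (M + `|lam|) * (y - x) by rewrite ler_wpM2l// addr_ge0.
  by rewrite mul0r; apply/andP; split; lra.
- move=> x y x0 xy y1; rewrite /Num.max; case: ltP => ys; case: ltP => xs; try lra.
  + have /andP[_ h5] := sl x y x0 xy (ltW ys); lra.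
  + have /andP[_ h5] := sl x s x0 (ltW xs) (lexx s); lra.
Qed.

(** [bathtub_convex] for [- phi]. Applied up to [t' = 1], it bounds [Psi] at earlier points of the
    gap from above. *)
Lemma bathtub_lower M lam s th phi t t' : 0 <= s -> s <= q%:R^-1 ->
  slopes (- M) M 0 q%:R^-1 phi -> slopes lam M 0 s phi -> slopes (- M) lam s q%:R^-1 phi ->
  q%:R^-1 <= t -> t <= t' -> t' <= 1 ->
  phi q%:R^-1 - phi s - lam * (q%:R^-1 - s) + lam * (t' - t) / (q%:R - 1) <=
  Psi q th phi t' - Psi q th phi t.
Proof.
move=> s0 s1 sM sl sr qt tt t1.
have sMN : slopes (- M) M 0 q%:R^-1 (fun r => - phi r).
  by have := slopesN sM; rewrite opprK.
have srN : slopes (- lam) M s q%:R^-1 (fun r => - phi r).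
  by have := slopesN sr; rewrite opprK.
have := bathtub_convex th s0 s1 sMN (slopesN sl) srN qt tt t1.
by rewrite !(PsiN _ _ sM) !mulNr; lra.
Qed.

(** The slopes of [phi + Psi] lie between [l q / (q - 1)] and [L q / (q - 1)], and the interval has
    length [1/q]. *)
Lemma kap_slopes M l L th phi : slopes (- M) M 0 q%:R^-1 phi -> slopes l L 0 q%:R^-1 phi ->
  l / (q%:R - 1) <= kap th phi <= L / (q%:R - 1).
Proof.
move=> sM sl; have q2 := q_ge2.
have /andP[h1 h2] := sl _ _ (lexx _) (ltW iq_gt0) (lexx _).
have /andP[h3 h4] := Psi_slopes th sM sl (lexx 0) (ltW iq_gt0) (lexx _).
have e (c : R) : c / (q%:R - 1) = c * (q%:R^-1 - 0) + c / (q%:R - 1) * (q%:R^-1 - 0).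
  by field; rewrite !gt_eqF//; lra.
by rewrite (e l) (e L) /kap; apply/andP; split; lra.
Qed.

Lemma kapD M M' th u v : slopes (- M) M 0 q%:R^-1 u -> slopes (- M') M' 0 q%:R^-1 v ->
  kap th (fun s => u s + v s) = kap th u + kap th v.
Proof. by move=> su sv; rewrite /kap !(PsiD _ _ su sv); ring. Qed.

(** An interval of length at most [1/q < 1] crosses at most one jump of the inverse branch, so the
    increment is made of at most two increments of [u]. *)
Lemma trans_increment (eps : R) th u x y :
  (forall x y, 0 <= x -> x <= y -> y <= q%:R^-1 -> `|u y - u x| <= eps) ->
  0 <= x -> x <= y -> y <= q%:R^-1 -> `|trans q th u y - trans q th u x| <= 2 * eps.
Proof.
move=> ue x0 xy y1; have q2 := q_ge2; have iq := iq_gt0.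
have iq1 : q%:R^-1 < 1 :> R by rewrite invf_lt1//; lra.
have eps0 : 0 <= eps by apply: le_trans (ue 0 0 _ _ _); rewrite ?normr_ge0// ltW.
rewrite /trans.
have [p0 p1] := branch_itv hq (x - th); have [p0' p1'] := branch_itv hq (y - th).
have le_floor : Num.floor (x - th) <= Num.floor (y - th) by apply: le_floor; rewrite lerD2r.
have floor_le : Num.floor (y - th) <= Num.floor (x - th) + 1.
  rewrite -ltzD1 -addrA floor_lt_int !intrD; have := floorD1_gt (x - th); rewrite intrD; lra.
have [e|ne] := eqVneq (Num.floor (x - th)) (Num.floor (y - th)).
  have pp : frac (x - th) / q%:R <= frac (y - th) / q%:R.
    by rewrite ler_pM2r// /frac e; lra.
  have := ue _ _ p0 pp p1'; rewrite -e.
  move: (frac (y - th) / q%:R) (frac (x - th) / q%:R) => p' p /ler_normlP[h1 h2].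
  by apply/ler_normlP; split; lra.
have -> : Num.floor (y - th) = Num.floor (x - th) + 1.
  by apply/eqP; rewrite eq_le floor_le lezD1 lt_neqAle ne.
have /ler_normlP[h1 h2] := ue _ _ (lexx 0) p0' p1'.
have /ler_normlP[h3 h4] := ue _ _ p0 p1 (lexx _).
rewrite intrD; move: h1 h2 h3 h4; move: (frac (y - th) / q%:R) (frac (x - th) / q%:R) => p' p.
by move=> h1 h2 h3 h4; apply/ler_normlP; split; lra.
Qed.

(** The bound [E_n] satisfies [E_(n+1) = 2 E_n + 2 M |th - th'|]. The factor [2] is that of
    [trans_increment], applied to the change accumulated so far. The other term comes from changing
    [th] in the last [trans] only, which translates a function with slopes at most [M]. *)
Lemma psin_diff_th M th th' phi n : slopes (- M) M 0 q%:R^-1 phi ->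
  forall x y, 0 <= x -> x <= y -> y <= q%:R^-1 ->
  `|psin q th phi n y - psin q th' phi n y - (psin q th phi n x - psin q th' phi n x)|
  <= 2 * M * (2 ^+ n - 1) * `|th - th'|.
Proof.
move=> sM; have M0 := slopes_ge0 sM; have q2 := q_ge2.
elim: n => [|n ih] x y x0 xy y1.
  by rewrite /= !subrr normr0 !(mulr0, mul0r).
pose w s := psin q th phi n s - psin q th' phi n s.
pose u s := phi s + psin q th phi n s.
pose u' s := phi s + psin q th' phi n s.
have su : slopes (- (2 * M)) (2 * M) 0 q%:R^-1 u.
  have z0 : 0 <= q%:R^-1 ^+ n :> R by rewrite exprn_ge0// ltW.
  have z1 : q%:R^-1 ^+ n <= 1 :> R by rewrite exprn_ile1// ?invf_le1 ?(ltW iq_gt0)//; lra.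
  have c0 : 0 <= (1 - q%:R^-1 ^+ n) / (q%:R - 1) :> R by rewrite divr_ge0; lra.
  have c1 : (1 - q%:R^-1 ^+ n) / (q%:R - 1) <= 1 :> R by rewrite ler_pdivrMr; lra.
  have k : M * ((1 - q%:R^-1 ^+ n) / (q%:R - 1)) <= M by rewrite ler_piMr.
  by apply: (slopesS _ _ (slopesD sM (psin_slopes th n sM))); lra.
have shift t : `|trans q th u t - trans q th' u t| <= M * `|th - th'|.
  have -> : trans q th u t = trans q th' u (t - th + th') by rewrite /trans addrK.
  have st c d := trans_slopes hq (a := c) (b := d) th' su.
  have k : 2 * M / q%:R <= M by rewrite ler_pdivrMr//; nra.
  have [h|h] := leP t (t - th + th').
    have := st _ _ t (t - th + th') (lexx _) h (lexx _).
    have -> : t - th + th' - t = `|th - th'| by rewrite ler0_norm; lra.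
    have : 2 * M / q%:R * `|th - th'| <= M * `|th - th'| by rewrite ler_wpM2r.
    by move=> k1 /andP[k2 k3]; apply/ler_normlP; split; lra.
  have := st _ _ (t - th + th') t (lexx _) (ltW h) (lexx _).
  have -> : t - (t - th + th') = `|th - th'| by rewrite gtr0_norm; lra.
  have : 2 * M / q%:R * `|th - th'| <= M * `|th - th'| by rewrite ler_wpM2r.
  by move=> k1 /andP[k2 k3]; apply/ler_normlP; split; lra.
have e t : psin q th phi n.+1 t - psin q th' phi n.+1 t =
    trans q th u t - trans q th' u t + trans q th' w t.
  by rewrite /= -/u -/u' /w -(transBD _ _ phi) -/u -/u'; ring.
have /ler_normlP[k1 k2] := shift x; have /ler_normlP[k3 k4] := shift y.
have /ler_normlP[k5 k6] := trans_increment th' (ih : forall x y, _ -> _ -> _ -> `|w y - w x| <= _) x0 xy y1.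
rewrite !e exprS; move: k1 k2 k3 k4 k5 k6.
move: (trans q th' w y) (trans q th' w x) (trans q th u x) (trans q th u y) (trans q th' u x)
  (trans q th' u y) (2 ^+ n) (`|th - th'|) => t1 t2 t3 t4 t5 t6 z d.
by move=> k1 k2 k3 k4 k5 k6; apply/ler_normlP; split; lra.
Qed.

Lemma psin_cauchy M th phi m n : slopes (- M) M 0 q%:R^-1 phi ->
  `|psin q th phi (n + m) q%:R^-1 - psin q th phi (n + m) 0 -
    (psin q th phi n q%:R^-1 - psin q th phi n 0)| <= M * (2^-1 ^+ n - 2^-1 ^+ (n + m)).
Proof.
move=> sM; have M0 := slopes_ge0 sM; have q2 := q_ge2; have iq := iq_gt0.
elim: m => [|m ih]; first by rewrite addn0 !subrr normr0 mulr0.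
have /andP[h1 h2] := psin_step hq th (n + m) M0 sM (lexx 0) (ltW iq_gt0) (lexx _).
have iq2 : q%:R^-1 <= 2^-1 :> R by rewrite lef_pV2 ?posrE.
have k : M / q%:R ^+ (n + m).+1 * (q%:R^-1 - 0) <= M * 2^-1 ^+ (n + m).+1.
  rewrite subr0 -mulrA ler_wpM2l//.
  apply: (@le_trans _ _ (q%:R ^+ (n + m).+1)^-1); last by rewrite -exprVn lerXn2r// nnegrE ltW.
  by rewrite ler_piMr ?invr_ge0 ?exprn_ge0 ?(ltW q_gt0)//; lra.
move: ih => /ler_normlP[k1 k2]; rewrite addnS.
have e : 2^-1 ^+ (n + m).+1 = 2^-1 ^+ (n + m) / 2 :> R by rewrite exprSr.
rewrite e in k *; move: k k1 k2 h1 h2; rewrite subr0.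
move: (psin q th phi (n + m).+1 _) (psin q th phi (n + m).+1 _) (psin q th phi (n + m) _)
  (psin q th phi (n + m) _) => a1 a2 a3 a4.
by move=> k k1 k2 h1 h2; apply/ler_normlP; split; lra.
Qed.

Lemma kap_psin M th phi n : slopes (- M) M 0 q%:R^-1 phi ->
  `|kap th phi - (phi q%:R^-1 - phi 0 + (psin q th phi n q%:R^-1 - psin q th phi n 0))|
  <= M * 2^-1 ^+ n.
Proof.
move=> sM; have M0 := slopes_ge0 sM.
pose d m := psin q th phi (n + m) q%:R^-1 - psin q th phi (n + m) 0.
have cd : d m @[m --> \oo] --> Psi q th phi q%:R^-1 - Psi q th phi 0.
  have c t : psin q th phi (n + m) t @[m --> \oo] --> Psi q th phi t.
    have := Psi_cvg (th := th) (t := t) sM; rewrite -(cvg_shiftn n).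
    by under eq_fun do rewrite addnC.
  by apply: cvgB; exact: c.
have dn m : `|d m - (psin q th phi n q%:R^-1 - psin q th phi n 0)| <= M * 2^-1 ^+ n.
  apply: le_trans (psin_cauchy th m n sM) _.
  by rewrite ler_wpM2l// gerBl exprn_ge0.
have : `|Psi q th phi q%:R^-1 - Psi q th phi 0 - (psin q th phi n q%:R^-1 - psin q th phi n 0)|
    <= M * 2^-1 ^+ n.
  apply/ler_normlP; split.
    rewrite lerNl -lerBlDr opprK; apply: (cvgr_to_ge cd); apply: nearW => m.
    by have /ler_normlP[] := dn m; lra.
  rewrite lerBlDr; apply: (cvgr_to_le cd); apply: nearW => m.
  by have /ler_normlP[] := dn m; lra.
by congr (is_true (Num.norm _ <= _)); rewrite /kap; ring.
Qed.

(** Truncation costs [M 2^-n] for each of the two parameters. The integer [n] stays free, to be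
    balanced against [|th - th'|]. *)
Lemma kap_diff_th M th th' phi n : slopes (- M) M 0 q%:R^-1 phi ->
  `|kap th phi - kap th' phi| <= 2 * M * 2 ^+ n * `|th - th'| + 2 * M * 2^-1 ^+ n.
Proof.
move=> sM; have M0 := slopes_ge0 sM; have iq := iq_gt0.
have /ler_normlP[h1 h2] := kap_psin th n sM; have /ler_normlP[h3 h4] := kap_psin th' n sM.
have /ler_normlP[h5 h6] := psin_diff_th th th' n sM (lexx 0) (ltW iq) (lexx _).
have d0 := normr_ge0 (th - th'); have : 0 <= M * `|th - th'| by rewrite mulr_ge0.
by move=> h7; apply/ler_normlP; split; lra.
Qed.

End TransferFixedPoint.

(** * Sturmian condition *)

Section SideLobes.
Variables (R : realType) (q : nat).
Hypothesis hq : (3 <= q)%N.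
Implicit Types a b w y : R.

Local Notation r := (@GRing.inv R q%:R).

Let q_ge2 : (2 <= q)%N. Proof. exact: ltnW. Qed.

Definition lns y : R := ln (sin (pi * y)).

Lemma itv_pi y : 0 < y < 1 -> 0 < pi * y < (pi : R).
Proof.
by move=> /andP[y0 y1]; have p0 := pi_gt0 R; rewrite mulr_gt0//= gtr_pMr.
Qed.

Lemma lns_tangent x y : 0 < x < 1 -> 0 < y < 1 -> lns y - lns x <= pi * cotan (pi * x) * (y - x).
Proof.
move=> hx hy; apply: le_trans (lnsin_tangent (itv_pi hx) (itv_pi hy)) _.
by rewrite -mulrBr mulrCA mulrA.
Qed.

Lemma ler_cotan_pi x y : 0 < x -> x <= y -> y < 1 -> cotan (pi * y) <= cotan (pi * x) :> R.
Proof.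
move=> x0 xy y1; have p0 := pi_gt0 R.
by apply: ler_cotan; rewrite ?mulr_gt0// ?ler_pM2l// gtr_pMr.
Qed.

Let nq0 : q%:R != 0 :> R. Proof. by rewrite pnatr_eq0; lia. Qed.

Lemma natq_itv (k : nat) : (0 < k < q)%N -> r <= k%:R / q%:R <= 1 - r.
Proof.
move=> /andP[k0 kq]; have q0 : 0 < q%:R :> R by rewrite ltr0n; lia.
rewrite ler_peMl ?invr_ge0 ?(ltW q0) ?ler1n//=.
by rewrite ler_pdivrMr// mulrBl mul1r mulVf// lerBrDr natr1 ler_nat.
Qed.

Lemma invq_bounds : 0 < r /\ r <= 1 / 3.
Proof.
have q0 : 0 < q%:R :> R by rewrite ltr0n; lia.
by rewrite invr_gt0; split => //; rewrite div1r lef_pV2 ?posrE// ler_nat.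
Qed.

Lemma sum_last (F : nat -> R) :
  \sum_(1 <= k < q) F k = \sum_(1 <= k < q.-1) F k + F (q - 1)%N.
Proof.
have [p pq] : exists p, q = p.+2 by exists q.-2; lia.
by rewrite pq big_nat_recr//= subn1.
Qed.

(** The sum in [dpot] without its last term, which blows up at the right end of the lobe. After a
    shift by [1/q] it is the sum without its first term, so the same quantity appears in
    [dpot_small] and [dpot_large]. *)
Definition middle_cotan b : R := \sum_(1 <= j < q.-1) cotan (pi * (b + j%:R / q%:R)).

Lemma rev_arg b (j : nat) : (0 < j < q)%N ->
  pi * (b + (q - j)%:R / q%:R) = pi - pi * (j%:R / q%:R - b) :> R.
Proof. by move=> /andP[_ jq]; rewrite natrB ?(ltW jq)//; [field | exact: ltnW]. Qed.

(** Term [q - 1 - j] equals [- cotan (pi ((j + 1)/q - b))]; paired with term [j] it gives a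
    nonnegative sum, since [b + j/q <= (j + 1)/q - b] when [2 b <= 1/q]. *)
Lemma middle_cotan_ge0 b : 0 < b -> b <= (2 * q%:R)^-1 -> 0 <= middle_cotan b.
Proof.
move=> b0; have [r0 r3] := invq_bounds.
have -> : (2 * q%:R)^-1 = r / 2 :> R by field.
move=> b1; rewrite -(pmulr_lge0 _ (ltr0Sn R 1)) mulrDr mulr1.
rewrite {2}/middle_cotan big_nat_rev/= /middle_cotan -big_split/=.
rewrite big_nat_cond; apply: sumr_ge0 => j; rewrite andbT => /andP[j1 jq].
have -> : (1 + q.-1 - j.+1 = q - j.+1)%N by lia.
rewrite rev_arg ?cotan_piB; last by apply/andP; split; lia.
have /andP[h1 h2] : r <= j%:R / q%:R <= 1 - r by apply: natq_itv; lia.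
rewrite subr_ge0.
have e : j.+1%:R / q%:R = j%:R / q%:R + r :> R by rewrite -natr1 mulrDl mul1r.
have /andP[h3 h4] : r <= j.+1%:R / q%:R <= 1 - r by apply: natq_itv; lia.
rewrite e in h3 h4; rewrite e; apply: ler_cotan_pi; lra.
Qed.

(** The sum decreases in [b]. At [b = 0] the full cotangent sum vanishes by oddness, so the sum
    without its last term is [cotan (pi / q)]. *)
Lemma middle_cotan_le b : 0 <= b -> b < r -> middle_cotan b <= cotan (pi * r).
Proof.
move=> b0 br; have [r0 r3] := invq_bounds.
have S0 : \sum_(1 <= k < q) cotan (pi * (0 + k%:R / q%:R)) = 0 :> R.
  have := dpotN q_ge2 (0 : R); rewrite oppr0 /dpot => /eqP.
  rewrite -subr_eq0 opprK -mulr2n mulrn_eq0/= mulf_eq0 => /predU1P[p0|/eqP//].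
  by have := pi_gt0 R; rewrite p0 ltxx.
have -> : cotan (pi * r) = \sum_(1 <= j < q.-1) cotan (pi * (0 + j%:R / q%:R)) :> R.
  move: S0; rewrite sum_last => /eqP; rewrite addr_eq0 => /eqP ->.
  by rewrite rev_arg ?cotan_piB ?opprK ?subr0 ?mulr1n ?mul1r//; lia.
apply: ler_sum_nat => j hj.
have /andP[h1 h2] : r <= j%:R / q%:R <= 1 - r by apply: natq_itv; lia.
by apply: ler_cotan_pi; lra.
Qed.

Lemma dpot_small b : dpot q b = pi * (middle_cotan b - cotan (pi * (r - b))).
Proof.
rewrite /dpot /middle_cotan; congr (_ * _).
rewrite sum_last; congr (_ + _).
by rewrite rev_arg ?cotan_piB ?mulr1n ?mul1r//; lia.
Qed.

Lemma dpot_large b : dpot q (b - r) = pi * (cotan (pi * b) + middle_cotan b).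
Proof.
rewrite /dpot /middle_cotan; congr (_ * _).
rewrite big_add1 big_ltn; last by lia.
congr (_ + _); first by congr (cotan (pi * _)); field.
by apply: eq_big_nat => k _; congr (cotan (pi * _)); rewrite -[k.+1%:R]natr1; field.
Qed.

(** The pairing of [middle_cotan_ge0] again: two points [j/q] and [(j + 1)/q] move towards each
    other by [b], which by concavity does not lower the sum of [lns]. *)
Lemma lns_sum_ge0 b : 0 < b -> b <= (2 * q%:R)^-1 ->
  0 <= \sum_(1 <= j < q.-1) (lns (b + j%:R / q%:R) - lns (j%:R / q%:R)).
Proof.
move=> b0; have [r0 r3] := invq_bounds.
have -> : (2 * q%:R)^-1 = r / 2 :> R by field.
move=> b1; rewrite -(pmulr_lge0 _ (ltr0Sn R 1)) mulrDr mulr1.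
rewrite {2}big_nat_rev/= -big_split/=.
rewrite big_nat_cond; apply: sumr_ge0 => j; rewrite andbT => /andP[j1 jq].
have -> : (1 + q.-1 - j.+1 = q - j.+1)%N by lia.
have lnsr c : lns (c + (q - j.+1)%:R / q%:R) = lns (j.+1%:R / q%:R - c).
  rewrite /lns rev_arg; last by apply/andP; split; lia.
  by rewrite addrC sinDpi sinN opprK.
have -> : (q - j.+1)%:R / q%:R = 0 + (q - j.+1)%:R / q%:R :> R by rewrite add0r.
rewrite [b + (0 + _)]addrA addr0 !lnsr subr0.
have /andP[h1 h2] : r <= j%:R / q%:R <= 1 - r by apply: natq_itv; lia.
have e : j.+1%:R / q%:R = j%:R / q%:R + r :> R by rewrite -natr1 mulrDl mul1r.
have /andP[h3 h4] : r <= j.+1%:R / q%:R <= 1 - r by apply: natq_itv; lia.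
rewrite e in h3 h4; rewrite e; move: (j%:R / q%:R) h1 h2 h3 h4 => u h1 h2 h3 h4.
have t1 := @lns_tangent (b + u) u; have t2 := @lns_tangent (u + r - b) (u + r).
have c1 : cotan (pi * (u + r - b)) <= cotan (pi * (b + u)) :> R by apply: ler_cotan_pi; lra.
have k1 : lns u - lns (b + u) <= pi * cotan (pi * (b + u)) * (u - (b + u)) by apply: t1; lra.
have k2 : lns (u + r) - lns (u + r - b) <= pi * cotan (pi * (u + r - b)) * (u + r - (u + r - b)).
  by apply: t2; lra.
have k3 : pi * cotan (pi * (u + r - b)) * b <= pi * cotan (pi * (b + u)) * b.
  by rewrite ler_wpM2r// ?(ltW b0)// ler_wpM2l// pi_ge0.
lra.
Qed.

(** By [lns_sum_ge0] the drop is at most [lns r - lns (r - b)]; and [lns r < lns (r + b)] because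
    [r + b <= 1/2], which holds for [q >= 3]. *)
Lemma pot_drop_lt b : 0 < b -> b <= (2 * q%:R)^-1 -> pot q 0 - pot q b < lns (r + b) - lns (r - b).
Proof.
move=> b0 b1; have S := lns_sum_ge0 b0 b1; move: b1; have [r0 r3] := invq_bounds.
have -> : (2 * q%:R)^-1 = r / 2 :> R by field.
move=> b1; have p0 := pi_gt0 R.
have lobe c : 0 <= c -> c < r -> pot q c = \sum_(1 <= j < q.-1) lns (c + j%:R / q%:R) + lns (r - c)
    + (q%:R - 1) * ln 2.
  move=> c0 cr.
  have -> : pot q c = \sum_(1 <= j < q) lns (c + j%:R / q%:R) + (q%:R - 1) * ln 2.
    rewrite /pot -[(q%:R - 1)](@natrB _ q 1) ?mulr_natl -?sumr_const_nat -?big_split; last by lia.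
    apply: eq_big_nat => k hk; rewrite lnM ?posrE//; first by rewrite addrC.
    by apply: sin_gt0_pi; apply: (pot_arg q_ge2) => //; rewrite ger0_norm.
  congr (_ + _); rewrite sum_last; congr (_ + _).
  by rewrite /lns rev_arg ?mulr1n ?mul1r; [rewrite addrC sinDpi sinN opprK | lia].
rewrite lobe// lobe ?(ltW b0)//; last by lra.
rewrite sumrB in S; rewrite subr0.
have -> : \sum_(1 <= j < q.-1) lns (0 + j%:R / q%:R) = \sum_(1 <= j < q.-1) lns (j%:R / q%:R).
  by apply: eq_bigr => j _; rewrite add0r.
have : lns r < lns (r + b).
  rewrite /lns ltr_ln ?posrE; try by apply: sin_gt0_pi; apply: itv_pi; lra.
  have hp : pi * (r + b) <= pi * (1 / 2) by rewrite ler_pM2l//; lra.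
  have k0 : 0 < pi * r by rewrite mulr_gt0.
  have k1 : pi * r < pi * (r + b) by rewrite ltr_pM2l// ltrDl.
  by rewrite ltr_sin ?in_itv/=; lra.
lra.
Qed.

Lemma cotan_half_gap : cotan (pi * (r / 2)) - cotan (pi * r) = (sin (pi * r))^-1 :> R.
Proof.
have [r0 r3] := invq_bounds.
have s0 : sin (pi * r) != 0 :> R by apply/sin_neq0_pi/itv_pi; lra.
rewrite mulrA cotan_half// /cotan; field; exact: s0.
Qed.

(** For [q >= 4] the right side is at least [1]. For [q = 3] there is equality,
    [cos (pi / 3) = 1/2], found from [cos (2 pi / 3) = - cos (pi / 3)]. *)
Lemma cos_pi_div_le : cos (pi * r) <= (q%:R - 2) / 2 :> R.
Proof.
have [r0 r3] := invq_bounds; have p0 := pi_gt0 R.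
have [q4|q3] := leqP 4 q.
  have : 4 <= q%:R :> R by rewrite ler_nat.
  have := cos_le1 (pi * r); lra.
have {q3} q3 : q = 3%N by lia.
have c3 : cos (pi * r *+ 2) = - cos (pi * r) :> R.
  by rewrite -[in RHS]cosN -cosDpi q3; congr cos; field.
have c0 : 0 < cos (pi * r) :> R by apply: cos_gt0_pihalf; rewrite q3; lra.
move: c3 c0; rewrite cos_mulr2n q3; move: (cos _) => c c3 c0.
have : (2 * c - 1) * (c + 1) = 0 by move: c3; rewrite expr2 => c3; lra.
by move/eqP; rewrite mulf_eq0 => /orP[|] /eqP ?; lra.
Qed.

(* [gain w] bounds from below [pot z - pot y] for [z] in the main lobe, [|z| = w], and [y] in a
   side lobe congruent to [z] modulo [1 / q]. *)
Definition gain w : R :=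
  if w <= r / 2 then lns (r + w) - lns w else lns (2 * r - w) - lns w.

(** [lns y] is governed by the distance of [y] to [0] and [1], which is at least the smaller of
    [r + w] and [2 r - w]; the test in [gain] tells which one that is. *)
Lemma side_gain w y : 0 < w -> w < r -> (r + w <= y <= 1 - 2 * r + w) \/ (2 * r - w <= y <= 1 - r - w) ->
  gain w <= lns y - lns w.
Proof.
move=> w0 wr hy; have [r0 r3] := invq_bounds; have p0 := pi_gt0 R.
have mono e : 0 < e -> e <= y -> y <= 1 - e -> lns e <= lns y.
  move=> e0 ey ye; rewrite /lns ler_ln ?posrE; try by apply: sin_gt0_pi; apply: itv_pi; lra.
  apply: ler_sin_pi; rewrite ?mulr_ge0 ?pi_ge0 ?(ltW e0) ?ler_pM2l//.
  by rewrite -[X in X - _]mulr1 -mulrBr ler_pM2l.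
rewrite /gain; case: (leP w (r / 2)) => wh; rewrite lerD2r; apply: mono; lra.
Qed.

(** The left side is the bound of [loss_left] and [loss_right] for the growth of [Psi] into the gap.
    If [b <= a], the case [w = a] is [pot_drop_lt], and tangent lines carry it down to [r / 2] and
    from there to smaller [w]. If [a < b], reflection expresses everything through the short length
    [a]. *)
Lemma gain_lt a b w : 0 < a -> 0 < b -> a + b = r -> 0 < w -> w <= a ->
  pot q 0 - pot q b - dpot q b * (a - w) / (q%:R - 1) < gain w.
Proof.
move=> a0 b0 ab w0 wa; have [r0 r3] := invq_bounds; have p0 := pi_gt0 R.
have h2 : (2 * q%:R)^-1 = r / 2 by field.
have q3 : 3 <= q%:R :> R by rewrite ler_nat.
have s0 : 0 < sin (pi * r) :> R by apply/sin_gt0_pi/itv_pi; lra.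
have ca : a = r - b by lra.
have cgap := cotan_half_gap.
have divq (x : R) : 0 <= x -> x / (q%:R - 1) <= x / 2.
  by move=> x0; rewrite ler_wpM2l// lef_pV2 ?posrE; lra.
have [ba|ab'] := leP b a.
  have b2 : b <= (2 * q%:R)^-1 by rewrite h2; lra.
  have P0 := middle_cotan_ge0 b0 b2.
  have L0 := pot_drop_lt b0 b2; rewrite -ca in L0.
  have D0 : - dpot q b <= pi * cotan (pi * a).
    by rewrite dpot_small -ca -mulrN ler_pM2l//; lra.
  have cota : 0 < cotan (pi * a).
    apply: cotan_gt0; first by rewrite mulr_gt0.
    by apply: (@lt_le_trans _ _ (pi * (1 / 2))); [rewrite ltr_pM2l//; lra | lra].
  have D1 v : 0 <= a - v -> - dpot q b * (a - v) / (q%:R - 1) <= pi * cotan (pi * a) / 2 * (a - v).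
    move=> av; rewrite mulrAC ler_wpM2r//.
    apply: (@le_trans _ _ (pi * cotan (pi * a) / (q%:R - 1))).
      by rewrite ler_wpM2r// invr_ge0; lra.
    by apply: divq; rewrite mulr_ge0 ?ltW.
  have big v : r / 2 <= v -> v <= a -> pot q 0 - pot q b - dpot q b * (a - v) / (q%:R - 1)
      < lns (2 * r - v) - lns v.
    move=> v0 va.
    have t1 : lns (2 * r - a) - lns (2 * r - v) <=
        pi * cotan (pi * (2 * r - v)) * (2 * r - a - (2 * r - v)).
      by clear -r0 r3 v0 va a0 b0 ab; apply: lns_tangent; lra.
    have t2 : lns v - lns a <= pi * cotan (pi * a) * (v - a).
      by clear -r0 r3 v0 va a0 b0 ab; apply: lns_tangent; lra.
    have c1 : 0 <= pi * cotan (pi * (2 * r - v)) * (a - v).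
      rewrite mulr_ge0 ?subr_ge0// mulr_ge0 ?(ltW p0)//; apply: cotan_ge0.
        by rewrite mulr_gt0//; lra.
      by apply: (@le_trans _ _ (pi * (1 / 2))); [rewrite ler_pM2l//; lra | lra].
    have c2 : 0 <= pi * cotan (pi * a) * (a - v).
      by rewrite mulr_ge0 ?subr_ge0// mulr_ge0 ?(ltW p0) ?(ltW cota).
    have d : - dpot q b * (a - v) / (q%:R - 1) <= pi * cotan (pi * a) / 2 * (a - v).
      by apply: D1; lra.
    have e : lns (r + b) = lns (2 * r - a) by congr lns; lra.
    rewrite e in L0.
    lra.
  rewrite /gain; case: (leP w (r / 2)) => wh; last by apply: big; lra.
  have B := big (r / 2) (lexx _).
  have t1 : lns (r + r / 2) - lns (r + w) <= pi * cotan (pi * (r + w)) * (r + r / 2 - (r + w)).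
    by clear -r0 r3 w0 wh; apply: lns_tangent; lra.
  have t2 : lns w - lns (r / 2) <= pi * cotan (pi * (r / 2)) * (w - r / 2).
    by clear -r0 r3 w0 wh; apply: lns_tangent; lra.
  have c1 : cotan (pi * (r + w)) <= cotan (pi * r).
    by clear -r0 r3 w0 wh; apply: ler_cotan_pi; lra.
  have c2 : cotan (pi * a) <= cotan (pi * (r / 2)).
    by clear -r0 r3 a0 b0 ab ba; apply: ler_cotan_pi; lra.
  have c3 : cotan (pi * (r / 2)) <= 2 * (sin (pi * r))^-1.
    rewrite [pi * (r / 2)]mulrA cotan_half ?gt_eqF// ler_wpM2r ?invr_ge0 ?(ltW s0)//.
    by have := cos_le1 (pi * r); lra.
  have e : lns (r + r / 2) = lns (2 * r - r / 2) by congr lns; lra.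
  have d0 : 0 <= r / 2 - w by lra.
  have X : - dpot q b / (q%:R - 1) <= pi * (sin (pi * r))^-1.
    apply: (@le_trans _ _ (pi * cotan (pi * a) / (q%:R - 1))).
      by rewrite ler_wpM2r// invr_ge0; lra.
    apply: le_trans (divq _ _) _; first by rewrite mulr_ge0 ?ltW.
    by rewrite -mulrA ler_wpM2l ?(ltW p0)//; lra.
  have k1 := ler_wpM2r d0 X.
  have k2 := ler_wpM2r d0 (ler_wpM2l (ltW p0) c1).
  have k3 : pi * (cotan (pi * (r / 2)) - cotan (pi * r)) * (r / 2 - w) =
      pi * (sin (pi * r))^-1 * (r / 2 - w) by rewrite cgap.
  have B' : pot q 0 - pot q b - dpot q b * (a - r / 2) / (q%:R - 1) < lns (2 * r - r / 2) - lns (r / 2).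
    by apply: B; lra.
  lra.
have a2 : a <= (2 * q%:R)^-1 by rewrite h2; lra.
have L0 := pot_drop_lt a0 a2.
have P1 := @middle_cotan_le a (ltW a0); have {}P1 : middle_cotan a <= cotan (pi * r) by apply: P1; lra.
have cb : b = r - a by lra.
have Db : - dpot q b = pi * (cotan (pi * a) + middle_cotan a).
  by rewrite -(dpotN q_ge2) -dpot_large cb opprB.
have refl : pot q (r - a) - pot q a = lns a - lns (r - a).
  by apply: (pot_reflect q_ge2); rewrite a0/=; lra.
have -> : gain w = lns (r + w) - lns w by rewrite /gain ifT//; lra.
have t1 : lns (r + a) - lns (r + w) <= pi * cotan (pi * (r + w)) * (r + a - (r + w)).
  by clear -r0 r3 a0 b0 ab w0 wa; apply: lns_tangent; lra.
have t2 : lns w - lns a <= pi * cotan (pi * a) * (w - a).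
  by clear -r0 r3 a0 b0 ab w0 wa; apply: lns_tangent; lra.
have c1 : cotan (pi * (r + w)) <= cotan (pi * r).
  by clear -r0 r3 a0 b0 ab w0 wa; apply: ler_cotan_pi; lra.
have c2 : cotan (pi * (r / 2)) <= cotan (pi * a).
  by clear -r0 r3 a0 b0 ab ab'; apply: ler_cotan_pi; lra.
(* It suffices to replace [a] by [r / 2]; after clearing [sin (pi / q)] the claim is
   [2 cos (pi / q) <= q - 2]. *)
have c3 : q%:R * cotan (pi * r) <= (q%:R - 2) * cotan (pi * a).
  apply: (@le_trans _ _ ((q%:R - 2) * cotan (pi * (r / 2)))); last first.
    by rewrite ler_wpM2l//; lra.
  rewrite [pi * (r / 2)]mulrA cotan_half ?gt_eqF// /cotan !mulrA ler_wpM2r ?invr_ge0 ?(ltW s0)//.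
  by have := cos_pi_div_le; lra.
have d0 : 0 <= a - w by lra.
have X : - dpot q b / (q%:R - 1) <= pi * (cotan (pi * a) - cotan (pi * r)).
  rewrite Db -mulrA ler_pM2l// ler_pdivrMr; last by lra.
  lra.
have k1 := ler_wpM2r d0 X.
have k2 := ler_wpM2r d0 (ler_wpM2l (ltW p0) c1).
rewrite -cb in refl L0.
lra.
Qed.

End SideLobes.

Section SturmianCondition.
Variables (R : realType) (q : nat).
Hypothesis hq : (2 <= q)%N.
Implicit Types x y t s : R.

Local Notation r := (@GRing.inv R q%:R).

Lemma natq_ge2 : 2 <= q%:R :> R. Proof. by rewrite ler_nat. Qed.

Lemma invq_gt0 : 0 < r. Proof. by have := natq_ge2; rewrite invr_gt0; lra. Qed.

Lemma invq_le2 : r <= 1 / 2.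
Proof. by have q2 := natq_ge2; rewrite div1r lef_pV2 ?posrE//; lra. Qed.

Lemma mulqV : q%:R * r = 1 :> R.
Proof. by have := natq_ge2 => q2; rewrite mulfV// gt_eqF//; lra. Qed.

Lemma dpot0 : dpot q 0 = 0 :> R.
Proof. by have := dpotN hq (0 : R); rewrite oppr0 => h; lra. Qed.

Variables a b : R.
Hypotheses (a0 : 0 < a) (b0 : 0 < b) (ab : a + b = r :> R).

(** The potential in the coordinate [t = x + a + c], in which the arc is [[0, 1/q]] and the top of
    the lobe is at [t = a]. *)
Definition phi t : R := pot q (t - a).

Definition phi_lip : R := dpot q (- a) - dpot q b.

Lemma lobe_itv z : - r < z -> z < r -> `|z| < r.
Proof. by move=> z1 z2; rewrite ltr_norml z1. Qed.

Local Ltac sides := have ? := a0; have ? := b0; have ? := ab.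

Lemma dpot_b_le0 : dpot q b <= 0.
Proof. by sides; rewrite -dpot0; apply: (dpot_le hq); [apply: lobe_itv; lra..|exact: ltW]. Qed.

Lemma dpot_Na_ge0 : 0 <= dpot q (- a).
Proof. by sides; rewrite -dpot0; apply: (dpot_le hq); [apply: lobe_itv; lra..|lra]. Qed.

Lemma phi_slopes_sub s s' : 0 <= s -> s' <= r -> slopes (dpot q (s' - a)) (dpot q (s - a)) s s' phi.
Proof.
sides; move=> s0 s1 x y sx xy ys; rewrite /phi.
have lx : `|x - a| < r by apply: lobe_itv; lra.
have ly : `|y - a| < r by apply: lobe_itv; lra.
have ls : `|s - a| < r by apply: lobe_itv; lra.
have ls' : `|s' - a| < r by apply: lobe_itv; lra.
have t1 := pot_tangent hq ly lx; have t2 := pot_tangent hq lx ly.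
have d1 : dpot q (s' - a) <= dpot q (y - a) by apply: (dpot_le hq) => //; lra.
have d2 : dpot q (x - a) <= dpot q (s - a) by apply: (dpot_le hq) => //; lra.
have k1 : dpot q (s' - a) * (y - x) <= dpot q (y - a) * (y - x) by rewrite ler_wpM2r ?subr_ge0.
have k2 : dpot q (x - a) * (y - x) <= dpot q (s - a) * (y - x) by rewrite ler_wpM2r ?subr_ge0.
by apply/andP; split; lra.
Qed.

Lemma phi_slopes : slopes (dpot q b) (dpot q (- a)) 0 r phi.
Proof.
sides; have := @phi_slopes_sub 0 r (lexx _) (lexx _).
by rewrite sub0r -ab addrAC subrr add0r.
Qed.

Lemma phi_lipschitz : slopes (- phi_lip) phi_lip 0 r phi.
Proof.
sides; have h1 := dpot_b_le0; have h2 := dpot_Na_ge0.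
by apply: (slopesS _ _ phi_slopes); rewrite /phi_lip; lra.
Qed.

Lemma phi_slopes_hi s : 0 <= s -> s <= r -> slopes (dpot q (s - a)) phi_lip 0 s phi.
Proof.
sides; move=> s0 s1; have := phi_slopes_sub (lexx 0) s1; rewrite sub0r.
have h1 := dpot_b_le0.
by apply: slopesS; rewrite /phi_lip; lra.
Qed.

Lemma phi_slopes_lo s : 0 <= s -> s <= r -> slopes (- phi_lip) (dpot q (s - a)) s r phi.
Proof.
sides; move=> s0 s1; have := phi_slopes_sub s0 (lexx r).
have -> : r - a = b by lra.
have h2 := dpot_Na_ge0.
by apply: slopesS; rewrite /phi_lip; lra.
Qed.

Variable th : R.

Local Notation Ps := (Psi q th phi).

(** The constant of the cohomological equation, hence the integral of an invariant measure carried
    by the arc. *)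
Definition beta : R := phi 0 + Ps 0.

Hypothesis kap0 : kap q th phi = 0.

Lemma Ps_periodic t (n : int) : Ps (t + n%:~R) = Ps t.
Proof. by rewrite (PsiDz hq th t n phi_lipschitz) kap0 mulr0 addr0. Qed.

Lemma Ps1 : Ps 1 = Ps 0.
Proof. by rewrite -(Ps_periodic 0 1) add0r. Qed.

(** The form in which [kap = 0] is used: [phi + Psi] takes the same value at both ends of the
    arc. *)
Lemma balance : pot q b + Ps r = pot q (- a) + Ps 0.
Proof.
sides; have := kap0; rewrite /kap /phi sub0r; have -> : r - a = b by lra.
by move=> h; lra.
Qed.

Lemma Ps_slopes t t' : t <= t' ->
  dpot q b / (q%:R - 1) * (t' - t) <= Ps t' - Ps t <= dpot q (- a) / (q%:R - 1) * (t' - t).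
Proof.
by move=> tt; exact: (Psi_slopes hq th phi_lipschitz phi_slopes (lexx t) tt (lexx t')).
Qed.

Lemma mul_frac_le (x d : R) : 0 <= x -> 0 <= d -> x / (q%:R - 1) * d <= x * d.
Proof.
sides; move=> x0 d0; rewrite ler_wpM2r// ler_pdivrMr; last by have := natq_ge2; lra.
by rewrite ler_peMr//; have := natq_ge2; lra.
Qed.

(** The point [r + s] just past the right end is still in the main lobe and is congruent to [s]
    modulo [1/q]. The growth of [Psi] over [[r, r + s]] is bounded by [bathtub], cut at [s] with
    [lam] the slope of [phi] there; strictness comes from the tangent to [pot] at [b]. *)
Lemma sturm_right s : 0 < s -> s < a -> pot q (b + s) + Ps (r + s) < pot q (s - a) + Ps s.
Proof.
sides; move=> s0 sa; have q2 := natq_ge2; have r0 := invq_gt0; have r2 := invq_le2.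
have sr : s <= r by lra.
have B := bathtub hq th (ltW s0) sr phi_lipschitz (phi_slopes_hi (ltW s0) sr)
  (phi_slopes_lo (ltW s0) sr) (lexx r) (_ : r <= r + s) (_ : r + s <= 1).
have {}B := B ltac:(lra) ltac:(lra).
have /andP[S _] := Ps_slopes (ltW s0).
have T : pot q (b + s) - pot q b < dpot q b * (b + s - b).
  by apply: (pot_tangent_lt hq); [apply: lobe_itv; lra..|rewrite gt_eqF//; lra].
have L : dpot q b <= dpot q (s - a) by apply: (dpot_le hq); [apply: lobe_itv; lra..|lra].
have bal := balance.
have L0 : 0 <= dpot q (s - a) - dpot q b by rewrite subr_ge0.
have L' := mul_frac_le L0 (ltW s0).
move: B; rewrite /phi sub0r => B; lra.
Qed.

(** The mirror image at the left end: [1 - s] is congruent to [r - s] modulo [1/q]. *)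
Lemma sturm_left s : 0 < s -> s < b -> pot q (- a - s) + Ps (1 - s) < pot q (b - s) + Ps (r - s).
Proof.
sides; move=> s0 sb; have q2 := natq_ge2; have r0 := invq_gt0; have r2 := invq_le2.
have u0 : 0 <= r - s by lra.
have u1 : r - s <= r by lra.
have B := bathtub_lower hq th u0 u1 phi_lipschitz (phi_slopes_hi u0 u1)
  (phi_slopes_lo u0 u1) (_ : r <= 1 - s) (_ : 1 - s <= 1) (lexx 1).
have {}B := B ltac:(lra) ltac:(lra).
have /andP[_ S] := Ps_slopes u1.
have T : pot q (- a - s) - pot q (- a) < dpot q (- a) * (- a - s - - a).
  by apply: (pot_tangent_lt hq); [apply: lobe_itv; lra..|rewrite lt_eqF//; lra].
have eb : r - s - a = b - s by lra.
have er : r - a = b by lra.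
have L : dpot q (b - s) <= dpot q (- a) by apply: (dpot_le hq); [apply: lobe_itv; lra..|lra].
have bal := balance; have p1 := Ps1.
have L0 : 0 <= dpot q (- a) - dpot q (b - s) by rewrite subr_ge0.
have L' := mul_frac_le L0 (ltW s0).
move: B; rewrite /phi eb er => B; lra.
Qed.

(** The cut is at the top [a] of the lobe, where the slope is [0]. Periodicity brings [Psi] from [1]
    back to [0], and the slope bound leads from there to [t']. *)
Lemma loss_left t t' : 0 <= t' -> t' <= r -> r <= t -> t <= 1 ->
  Ps t - Ps t' <= pot q 0 - pot q b - dpot q b * t' / (q%:R - 1).
Proof.
sides; move=> t'0 t'r rt t1.
have sa0 : 0 <= a := ltW a0; have sa1 : a <= r by lra.
have B := bathtub_lower hq th sa0 sa1 phi_lipschitz (phi_slopes_hi sa0 sa1)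
  (phi_slopes_lo sa0 sa1) rt t1 (lexx 1).
have /andP[S _] := Ps_slopes t'0.
have p1 := Ps1; have er : r - a = b by lra.
move: B; rewrite /phi subrr dpot0 !mul0r er => B; lra.
Qed.

Lemma loss_right t t' : 0 <= t' -> t' <= r -> r <= t -> t <= 1 ->
  Ps t - Ps t' <= pot q 0 - pot q a - dpot q a * (r - t') / (q%:R - 1).
Proof.
sides; move=> t'0 t'r rt t1.
have sa0 : 0 <= a := ltW a0; have sa1 : a <= r by lra.
have B := bathtub hq th sa0 sa1 phi_lipschitz (phi_slopes_hi sa0 sa1)
  (phi_slopes_lo sa0 sa1) (lexx r) rt t1.
have /andP[_ S] := Ps_slopes t'r.
move: B S; rewrite /phi subrr dpot0 !mul0r sub0r (potN hq) (dpotN hq) => B S; lra.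
Qed.

(** The left side is [fc] at [z], since [|sin (q pi z)|] is unchanged when [t] is replaced by the
    congruent arc point [t']. The sign of [t' - a] selects the end from which the loss is measured;
    when it is positive, [gain_lt] is used with [a] and [b] exchanged. *)
Lemma sturm_side z t' (k : int) : let t := t' + k%:~R * r in
  0 <= t' -> t' < r -> z = t - a -> r <= z -> z <= 1 - r ->
  sin (q%:R * (pi * z)) != 0 -> 
  pot q (t' - a) + lns `|t' - a| - lns z < pot q (t' - a) + Ps t' - Ps t.
Proof.
sides; move=> t t'0 t'r zE rz z1 sz; have q2 := natq_ge2; have r0 := invq_gt0; have r2 := invq_le2.
have qr := mulqV.
have zq : q%:R * (pi * z) = q%:R * (pi * (t' - a)) + k%:~R * pi.
  by rewrite zE /t; transitivity (q%:R * (pi * (t' - a)) + k%:~R * pi * (q%:R * r)); [ring | rewrite qr mulr1].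
have wN0 : t' - a != 0.
  apply: contra_neq sz => w0; apply/eqP; rewrite -normr_eq0 zq norm_sinDzpi w0 !mulr0 sin0.
  by rewrite normr0.
(* For [q = 2] only [z = 1/2] remains, a zero of [sin (q pi z)]. *)
have q3 : (3 <= q)%N.
  rewrite ltn_neqAle hq andbT; apply: contra_neq sz => q2e.
  have rh : r = 1 / 2 by rewrite -q2e; lra.
  have -> : z = 1 / 2 by lra.
  by rewrite -q2e (_ : 2%:R * (pi * (1 / 2)) = pi) ?sinpi//; field.
have tz : t = z + a by lra.
have t1 : t <= 1 by lra.
have rt : r <= t by lra.
have kr (m : int) : (m%:~R * r <= k%:~R * r) = (m <= k) by rewrite ler_pM2r// ler_int.
have rk (m : int) : (k%:~R * r <= m%:~R * r) = (k <= m) by rewrite ler_pM2r// ler_int.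
have kz : k%:~R * r = z + a - t' by rewrite -tz /t; ring.
case: (ltrgt0P (t' - a)) wN0 => // w0 _.
- have k1 : 1 <= k.
    have [//|k0] := leP 1 k; have : k%:~R * r <= 0%:~R * r by rewrite rk -ltzD1 add0r.
    by rewrite kz mul0r => h; exfalso; lra.
  have k2 : k <= q%:Z - 2.
    have [//|] := leP k (q%:Z - 2); rewrite -lezD1 -kr kz !intrD intrN -pmulrn.
    by rewrite mulrDl mulrBl qr mul1r => h; exfalso; have : 2%:~R * r = 2 * r by []; lra.
  have L := loss_right t'0 (ltW t'r) rt t1.
  have G := gain_lt q3 b0 a0 (_ : b + a = r) w0 (_ : t' - a <= b).
  have {}G := G ltac:(lra) ltac:(lra).
  have S : gain q (t' - a) <= lns z - lns (t' - a).
    apply: side_gain => //; first by lra.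
    left; move: k1 k2; rewrite -rk -kr kz.
    rewrite intrD intrN -pmulrn mulrBl qr => k1 k2.
    have : 2%:~R * r = 2 * r by [].
    by move: k1 k2; rewrite mul1r => k1 k2 k3; lra.
  have -> : lns (t' - a) = lns z - (lns z - lns (t' - a)) by ring.
  have eb : b - (t' - a) = r - t' by lra.
  rewrite eb in G; lra.
have k1 : 2 <= k.
  have [//|k0] := leP 2 k; have : k%:~R * r <= 1%:~R * r by rewrite rk -ltzD1.
  by rewrite kz mul1r => h; exfalso; lra.
have k2 : k <= q%:Z - 1.
  have [//|] := leP k (q%:Z - 1); rewrite -lezD1 subrK -kr kz -pmulrn qr.
  by move=> h; exfalso; lra.
have L := loss_left t'0 (ltW t'r) rt t1.
have wa : 0 < a - t' by lra.
have wa' : a - t' <= a by lra.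
have G := gain_lt q3 a0 b0 ab wa wa'.
have S : gain q (a - t') <= lns z - lns (a - t').
  apply: side_gain => //; first by lra.
  right; move: k1 k2; rewrite -rk -kr kz intrD intrN -pmulrn mulrBl qr => k1 k2.
  have : 2%:~R * r = 2 * r by [].
  by move: k1 k2; rewrite mul1r => k1 k2 k3; lra.
have ea : a - (a - t') = t' by lra.
rewrite opprB; rewrite ea in G; lra.
Qed.

Definition psi c x : R := Ps (x + a + c).

Lemma psiDz c x (n : int) : psi c (x + n%:~R) = psi c x.
Proof.
by rewrite /psi (_ : x + n%:~R + a + c = x + a + c + n%:~R) ?Ps_periodic//; ring.
Qed.

Lemma psi_lipschitz c x y : `|psi c x - psi c y| <= phi_lip * `|x - y|.
Proof.
have P z z' : z <= z' -> `|Ps z' - Ps z| <= phi_lip * (z' - z).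
  move=> zz; have /andP[h1 h2] := Ps_slopes zz; have d0 : 0 <= z' - z by lra.
  have m0 : 0 <= - dpot q b by have := dpot_b_le0; lra.
  have h3 := mul_frac_le m0 d0; have h4 := mul_frac_le dpot_Na_ge0 d0.
  have m1 : 0 <= - dpot q b * (z' - z) by rewrite mulr_ge0.
  have m2 : 0 <= dpot q (- a) * (z' - z) by rewrite mulr_ge0 ?dpot_Na_ge0.
  by rewrite /phi_lip; apply/ler_normlP; split; lra.
rewrite /psi; case: (leP x y) => xy.
  rewrite distrC [`|x - y|]distrC (ger0_norm (_ : 0 <= y - x)) ?subr_ge0//.
  by apply: le_trans (P _ _ _) _; [lra | rewrite le_eqVlt; apply/orP; left; apply/eqP; ring].
rewrite (gtr0_norm (_ : 0 < x - y)) ?subr_gt0//.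
by apply: le_trans (P _ _ _) _; [lra | rewrite le_eqVlt; apply/orP; left; apply/eqP; ring].
Qed.

Variable c : R.
Hypothesis thE : th = (q%:R - 1) * (- a - c).

Lemma Ps_branch t s (k : int) : 0 <= s -> s <= r -> q%:R * t = q%:R * s + k%:~R ->
  Ps (q%:R * t + th) = phi s + Ps s - beta.
Proof.
move=> s0 s1 e; rewrite (_ : _ + th = q%:R * s + th + k%:~R); last by rewrite e; ring.
by rewrite Ps_periodic (Psi_branch hq th phi_lipschitz s0 s1).
Qed.

Lemma fc_lns z t' (k : int) x : z = t' - a + k%:~R * r -> 0 < z < 1 -> `|t' - a| < r -> z = x + c ->
  sin (q%:R * (pi * z)) != 0 ->
  fc q c x = (pot q (t' - a) + lns `|t' - a| - lns z)%:E.
Proof.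
move=> zE z01 wr zx sz; have qr := mulqV.
have zq : q%:R * (pi * z) = q%:R * (pi * (t' - a)) + k%:~R * pi.
  by rewrite zE; transitivity (q%:R * (pi * (t' - a)) + k%:~R * pi * (q%:R * r)); [ring | rewrite qr mulr1].
have sz0 : 0 < sin (pi * z) by apply/sin_gt0_pi/itv_pi.
rewrite fc_ratioE -zx !normr_eq0 gt_eqF// (negbTE sz).
have sw : `|sin (q%:R * (pi * (t' - a)))| != 0 by rewrite -(norm_sinDzpi k) -zq normr_eq0.
have wN0 : t' - a != 0 by apply: contra_neq sw => ->; rewrite !mulr0 sin0 normr0.
have [s1 s2] := sin_lobe_neq0 hq wr wN0.
rewrite (pot_ratio hq wr wN0) normrM normfV zq norm_sinDzpi.
have -> : lns `|t' - a| = ln `|sin (pi * (t' - a))|.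
  rewrite /lns; case: (ltrgt0P (t' - a)) wN0 => // w0 _; last first.
    rewrite -normrN -sinN -mulrN; congr ln; rewrite gtr0_norm//.
    by apply/sin_gt0_pi/itv_pi; move: wr; rewrite ltr0_norm//; have := invq_le2; lra.
  congr ln; rewrite gtr0_norm//.
  by apply/sin_gt0_pi/itv_pi; move: wr; rewrite gtr0_norm//; have := invq_le2; lra.
rewrite !ln_div ?posrE ?normr_gt0//; last by rewrite gt_eqF.
by rewrite (gtr0_norm sz0) /lns; congr (_%:E); ring.
Qed.

(** Four cases for [t - a]: the right part of the main lobe, the left part of its translate by [1],
    a point where [fc] is [-oo], and the inside of a side lobe. *)
Lemma sturm_gap t x : r < t -> t < 1 -> x + c = t - a ->
  (fc q c x < (beta + Ps (q%:R * t + th) - Ps t)%:E)%E.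
Proof.
move=> rt t1 xE; sides; have q2 := natq_ge2; have r0 := invq_gt0; have r2 := invq_le2.
have qr := mulqV.
have [zr|rz] := ltP (t - a) r.
  have s0 : 0 < t - r by lra.
  have sr : t - r <= r by lra.
  have e : q%:R * t = q%:R * (t - r) + 1%:~R by rewrite mulrBr qr subrK.
  rewrite (Ps_branch (ltW s0) sr e) fc_lobe ?xE//; last by apply: lobe_itv; lra.
  have := @sturm_right (t - r) s0; rewrite lte_fin /phi.
  have -> : b + (t - r) = t - a by lra.
  have -> : r + (t - r) = t by lra.
  by move=> h; have := h ltac:(lra); lra.
have [zr|zr] := ltP (1 - r) (t - a).
  have s0 : 0 < 1 - t by lra.
  have sr0 : 0 <= r - (1 - t) by lra.
  have sr : r - (1 - t) <= r by lra.
  have e : q%:R * t = q%:R * (r - (1 - t)) + (q%:Z - 1)%:~R.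
    by rewrite intrD intrN -pmulrn mulrBr qr; ring.
  rewrite (Ps_branch sr0 sr e) -(fcDz q c x (- 1)).
  have xE' : x + (-1)%:~R + c = - a - (1 - t) by rewrite intrN; lra.
  rewrite fc_lobe ?xE'//; last by apply: lobe_itv; lra.
  have := @sturm_left (1 - t) s0; rewrite lte_fin /phi.
  have -> : r - (1 - t) - a = b - (1 - t) by lra.
  have -> : 1 - (1 - t) = t by lra.
  by move=> h; have := h ltac:(lra); lra.
have [sz|sz] := eqVneq (sin (q%:R * (pi * (t - a)))) 0.
  rewrite /fc xE sz eqxx gt_eqF ?ltNyr//.
  by apply/sin_gt0_pi/itv_pi; lra.
have [t' [k [t'0 t'r' tE]]] : exists t' (k : int), [/\ 0 <= t', t' < r & t = t' + k%:~R * r].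
  exists (frac (q%:R * t) / q%:R), (Num.floor (q%:R * t)).
  have [t'0 _] := branch_itv hq (q%:R * t); split => //.
    by rewrite -[ltRHS]mul1r ltr_pM2r// frac_lt1.
  by rewrite /frac -mulrDl subrK mulrAC qr mul1r.
have t'r := ltW t'r'.
have e : q%:R * t = q%:R * t' + k%:~R by rewrite tE mulrDr mulrCA qr mulr1.
rewrite (Ps_branch t'0 t'r e).
have zE : t - a = t' - a + k%:~R * r by rewrite tE; ring.
have z01 : 0 < t - a < 1 by apply/andP; split; lra.
have wr : `|t' - a| < r by apply: lobe_itv; lra.
rewrite (fc_lns zE z01 wr (esym xE) sz).
have zE' : t - a = t' + k%:~R * r - a by rewrite -tE.
have := @sturm_side (t - a) t' k t'0 t'r' zE' rz zr sz.
rewrite -tE lte_fin /phi; lra.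
Qed.

Lemma sturm_arc t x : 0 <= t -> t <= r -> x + c = t - a ->
  fc q c x = (beta + Ps (q%:R * t + th) - Ps t)%:E.
Proof.
move=> t0 tr xE; sides.
have wr : `|x + c| < r by rewrite xE; apply: lobe_itv; lra.
rewrite (fc_lobe hq wr) xE (@Ps_branch t t 0 t0 tr) ?addr0//.
by congr (_%:E); rewrite /phi; ring.
Qed.

(* [fc] is cohomologous to a function that is maximal exactly on the arc [-a - c, -a - c + 1/q]. *)
Lemma sturmian_condition x :
  (frac (x + a + c) <= r -> fc q c x = (beta + psi c (q%:R * x) - psi c x)%:E) /\
  (r < frac (x + a + c) -> (fc q c x < (beta + psi c (q%:R * x) - psi c x)%:E)%E).
Proof.
pose t := frac (x + a + c); pose n := Num.floor (x + a + c).
have xt : x + a + c = t + n%:~R by rewrite /t /frac subrK.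
have e1 : psi c x = Ps t by rewrite /psi xt Ps_periodic.
have e2 : psi c (q%:R * x) = Ps (q%:R * t + th).
  rewrite /psi -(Ps_periodic (q%:R * t + th) (q%:Z * n)); congr (Psi _ _ _ _).
  have -> : x = t + n%:~R - a - c by rewrite -xt; ring.
  by rewrite thE intrM -pmulrn; ring.
have e3 : fc q c x = fc q c (t - a - c).
  by rewrite -(fcDz q c (t - a - c) n); congr fc; move: xt; lra.
have e4 : t - a - c + c = t - a by rewrite subrK.
rewrite e1 e2 e3 -/t; split => ht.
  exact: (sturm_arc (frac_ge0 _) ht e4).
exact: sturm_gap ht (frac_lt1 _) e4.
Qed.

End SturmianCondition.

(** * Existence of the arc, and how it varies with [th] *)

Section ArcExistence.
Variables (R : realType) (q : nat).
Hypothesis hq : (2 <= q)%N.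
Implicit Types x y z t s a b c e th : R.

Local Notation r := (@GRing.inv R q%:R).

Lemma is_derive_bigsum (I : Type) (l : seq I) (F : I -> R -> R) (dF : I -> R) (P : pred I) z :
  (forall i, P i -> is_derive z 1 (F i) (dF i)) ->
  is_derive z 1 (fun y => \sum_(i <- l | P i) F i y) (\sum_(i <- l | P i) dF i).
Proof.
move=> dFi; elim: l => [|i l ih].
  rewrite big_nil (_ : (fun y => _) = cst 0); first exact: is_derive_cst.
  by apply/funext => y; rewrite big_nil.
rewrite big_cons (_ : (fun y => _) = fun y => (if P i then F i y else 0) + \sum_(i <- l | P i) F i y); last first.
  by apply/funext => y; rewrite big_cons; case: (P i); rewrite ?add0r.
case: ifPn => Pi; first by apply: (is_deriveD (dFi i Pi) ih).
by rewrite (_ : (fun y => _) = fun y => \sum_(i <- l | P i) F i y)//; apply/funext => y; rewrite add0r.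
Qed.

Lemma is_derive_pot z : `|z| < r -> is_derive z 1 (pot q) (dpot q z).
Proof.
move=> zr; rewrite /dpot mulr_sumr /pot big_nat_cond.
rewrite (_ : (fun z => _) = fun z : R => \sum_(1 <= k < q | (1 <= k < q)%N && true)
   ln (2 * sin (pi * (z + k%:R / q%:R)))); last by apply/funext => y; rewrite big_nat_cond.
apply: is_derive_bigsum => k; rewrite andbT => hk.
have /sin_gt0_pi s0 := pot_arg hq zr hk.
have d1 : is_derive z 1 (fun z : R => pi * (z + k%:R / q%:R)) pi.
  have d0 : is_derive z 1 (fun z : R => z + k%:R / q%:R) 1.
    by apply: (is_derive_eq (is_deriveD (is_derive_id z 1) (is_derive_cst (k%:R / q%:R : R) z 1))); rewrite addr0.
  by apply: (is_derive_eq (is_deriveZ pi d0)); rewrite /GRing.scale/= mulr1.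
have d2 := @is_derive1_comp R sin (fun z : R => pi * (z + k%:R / q%:R)) z _ _ (is_derive_sin _) d1.
have d3 : is_derive z 1 (fun z : R => 2 * sin (pi * (z + k%:R / q%:R)))
    (2 * (cos (pi * (z + k%:R / q%:R)) * pi)) by exact: (is_deriveZ 2 d2).
have s2 : 0 < 2 * sin (pi * (z + k%:R / q%:R)) by rewrite mulr_gt0.
have d4 := @is_derive1_comp R (@ln R) (fun z : R => 2 * sin (pi * (z + k%:R / q%:R))) z _ _ (is_derive1_ln s2) d3.
apply: (is_derive_eq d4).
by rewrite /cotan; field; rewrite gt_eqF.
Qed.

(** The derivative of the difference is [dpot (s - a') - dpot (s - a)]; the lower bound is
    [dpot_expand], the upper one the Lipschitz hypothesis. *)
Lemma phi_diff_slopes e (K : R) a a' : 0 < e ->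
  (forall y z, `|y| <= r - e -> `|z| <= r - e -> z <= y -> dpot q z - dpot q y <= K * (y - z)) ->
  e <= a -> a <= a' -> a' <= r - e ->
  slopes (a' - a) (K * (a' - a)) 0 r (fun s => phi q a' s - phi q a s).
Proof.
move=> e0 HK ea; rewrite le_eqVlt => /predU1P[<- _|aa ae] x y x0.
  by move=> *; rewrite !subrr mulr0 !mul0r lexx.
rewrite le_eqVlt => /predU1P[<- _|xy yr].
  by rewrite !subrr !mulr0 lexx.
pose g s := phi q a' s - phi q a s.
have dg s : - e < s < r + e -> is_derive s 1 g (dpot q (s - a') - dpot q (s - a)).
  move=> /andP[s0 s1].
  have sub_d u : is_derive s 1 (fun s : R => s - u) 1.
    by apply: (is_derive_eq (is_deriveB (is_derive_id s 1) (is_derive_cst u s 1))); rewrite subr0.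
  have dphi u : e <= u -> u <= r - e -> is_derive s 1 (phi q u) (dpot q (s - u)).
    move=> eu ue; have lu : `|s - u| < r by apply: lobe_itv; lra.
    by apply: (is_derive_eq (@is_derive1_comp R (pot q) (fun s => s - u) s _ _ (is_derive_pot lu) (sub_d u))); rewrite mulr1.
  by apply: is_deriveB; apply: dphi; lra.
have [||w /andP[xw wy] ->] := MVT_open dg _ xy _; [lra|lra|].
have l1 : `|w - a'| < r by apply: lobe_itv; lra.
have l2 : `|w - a| < r by apply: lobe_itv; lra.
have d1 : a' - a <= dpot q (w - a') - dpot q (w - a).
  by apply: le_trans (dpot_expand hq l2 l1 _); lra.
have d2 : dpot q (w - a') - dpot q (w - a) <= K * (a' - a).
  have -> : a' - a = w - a - (w - a') by ring.
  by apply: HK; [apply/ler_normlP; split; lra|apply/ler_normlP; split; lra|lra].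
by rewrite !ler_wpM2r//; lra.
Qed.

Definition kapF a th := kap q th (phi q a).

Lemma phi_lipschitz_unif e a : 0 < e -> e <= a -> a <= r - e ->
  slopes (- (- (dpot q (r - e)) *+ 2)) (- (dpot q (r - e)) *+ 2) 0 r (phi q a).
Proof.
move=> e0 ea ae.
have ab : a + (r - a) = r by rewrite addrC subrK.
have a0 : 0 < a by lra.
have b0 : 0 < r - a by lra.
have lob z : - r < z -> z < r -> `|z| < r := @lobe_itv R q z.
have h1 : dpot q (r - e) <= dpot q (r - a) by apply: (dpot_le hq); [apply: lob; lra..|lra].
have h2 : dpot q (r - e) <= dpot q a by apply: (dpot_le hq); [apply: lob; lra..|lra].
have h3 := dpot_b_le0 hq a0 b0 ab; have h4 := dpot_Na_ge0 hq a0 b0 ab.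
apply: (slopesS _ _ (phi_lipschitz hq a0 b0 ab)); rewrite /phi_lip (dpotN hq) mulr2n in h4 *; lra.
Qed.

Lemma kapF_diff e (K : R) a a' th : 0 < e -> 0 <= K ->
  (forall y z, `|y| <= r - e -> `|z| <= r - e -> z <= y -> dpot q z - dpot q y <= K * (y - z)) ->
  e <= a -> a <= a' -> a' <= r - e ->
  (a' - a) / (q%:R - 1) <= kapF a' th - kapF a th <= K * (a' - a) / (q%:R - 1).
Proof.
move=> e0 K0 HK ea aa ae; have sd := phi_diff_slopes e0 HK ea aa ae.
have aa0 : 0 <= a' - a by rewrite subr_ge0.
have Ka0 : 0 <= K * (a' - a) by rewrite mulr_ge0.
have sM : slopes (- (K * (a' - a) + (a' - a))) (K * (a' - a) + (a' - a)) 0 r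
    (fun s => phi q a' s - phi q a s) by apply: (slopesS _ _ sd); lra.
have sa := @phi_lipschitz_unif e a e0 ea (le_trans aa ae).
have -> : kapF a' th = kapF a th + kap q th (fun s => phi q a' s - phi q a s).
  rewrite /kapF -(kapD hq th sa sM); congr (kap _ _ _).
  by apply/funext => s; rewrite addrC subrK.
have /andP[h1 h2] := kap_slopes hq th sM sd; apply/andP; split; lra.
Qed.

Lemma pot_decr x y : 0 <= x -> x <= y -> y < r -> pot q y <= pot q x.
Proof.
move=> x0 xy yr; have lx : `|x| < r by rewrite ger0_norm; lra.
have ly : `|y| < r by rewrite ger0_norm; lra.
have l0 : `|0 : R| < r by rewrite normr0; lra.
have T := pot_tangent hq ly lx.
have D : dpot q x <= dpot q 0 := dpot_le hq lx l0 x0.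
rewrite (dpot0 R hq) in D.
have : dpot q x * (y - x) <= 0 by rewrite mulr_le0_ge0//; lra.
lra.
Qed.

(** For [a = e] the arc reaches within [e] of the right end of the lobe, where [pot] is so low that
    the variation of [Psi] cannot compensate; [a = r - e] is the symmetric situation. *)
Lemma kapF_ends : exists2 e, 0 < e < r / 2 & forall th, kapF e th <= 0 /\ 0 <= kapF (r - e) th.
Proof.
have q2 := natq_ge2 R hq; have r0 := invq_gt0 R hq.
(* As [e < r / 2], monotonicity makes [M] a lower bound for [pot e + dpot e * r / (q - 1)], the
   level below which [pot (r - e)] has to lie. *)
pose M := pot q (r / 2) + dpot q (r / 2) * r / (q%:R - 1).
have [e /andP[e0 e1] eM] := pot_unbounded hq M.
have h2 : (2 * q%:R)^-1 = r / 2 by field; rewrite gt_eqF//; lra.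
rewrite h2 in e1; exists e; first by rewrite e0.
have lob z : - r < z -> z < r -> `|z| < r := @lobe_itv R q z.
have b0 : 0 < r - e by lra.
have p1 : pot q (r / 2) <= pot q e by apply: pot_decr; lra.
have d1 : dpot q (r / 2) <= dpot q e by apply: (dpot_le hq); [apply: lob; lra..|lra].
have d2 : dpot q (r / 2) * r / (q%:R - 1) <= dpot q e / (q%:R - 1) * (r - 0).
  rewrite subr0 mulrAC; do 2 (apply: ler_wpM2r; first by rewrite ?invr_ge0; lra).
  exact: d1.
move=> th; rewrite /kapF /kap /phi; split.
  have ab : e + (r - e) = r by rewrite addrC subrK.
  have /andP[_ S] := Psi_slopes hq th (phi_lipschitz hq e0 b0 ab) (phi_slopes hq e0 b0 ab)
    (lexx 0) (ltW r0) (lexx _).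
  move: S; rewrite sub0r (potN hq) (dpotN hq) !mulNr => S.
  rewrite /M in eM; lra.
have ab : r - e + e = r by rewrite subrK.
have /andP[S _] := Psi_slopes hq th (phi_lipschitz hq b0 e0 ab) (phi_slopes hq b0 e0 ab)
  (lexx 0) (ltW r0) (lexx _).
have er : r - (r - e) = e by lra.
rewrite er sub0r (potN hq).
rewrite /M in eM; lra.
Qed.

Lemma continuous_modulus (G : R -> R) (C : R) : 0 <= C ->
  (forall n x y, `|G x - G y| <= C * 2 ^+ n * `|x - y| + C * 2^-1 ^+ n) -> continuous G.
Proof.
move=> C0 HG x; apply/cvgrPdist_le => /= e e0.
have [n hn] : exists n, C * 2^-1 ^+ n <= e / 2.
  have : C * 2^-1 ^+ n @[n --> \oo] --> C * 0.
    by apply: cvgMl_tmp; apply: cvg_expr; rewrite gtr0_norm// invf_lt1// ltr1n.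
  rewrite mulr0 => /cvgrPdist_le/(_ (e / 2)); rewrite divr_gt0// => /(_ isT)[n _ /(_ n (leqnn n))/= h].
  by exists n; apply: le_trans h; rewrite sub0r normrN ler_norm.
pose d := e / 2 / (C * 2 ^+ n + 1).
have p0 : 0 <= C * 2 ^+ n by rewrite mulr_ge0// exprn_ge0.
have d0 : 0 < d by rewrite /d !divr_gt0//; lra.
near=> y; apply: le_trans (HG n x y) _.
have : `|x - y| <= d by near: y; apply: cvgr_dist_le.
move=> xyd; have : C * 2 ^+ n * `|x - y| <= e / 2.
  apply: (@le_trans _ _ ((C * 2 ^+ n + 1) * d)).
    by rewrite ler_pM// lerDl.
  by rewrite /d mulrC divfK// gt_eqF//; lra.
lra.
Unshelve. all: by end_near. Qed.

(** With [c] fixed, [th] moves along with [a]; [kapF_diff] and [kap_diff_th] together give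
    continuity but no monotonicity, and the signs at the two ends do the rest. *)
Lemma exists_arc : exists2 e, 0 < e < r / 2 & forall c,
  exists a, [/\ e <= a, a <= r - e & kapF a ((q%:R - 1) * (- a - c)) = 0].
Proof.
have [e /andP[e0 e1] ends] := kapF_ends; exists e; first by rewrite e0.
move=> c; have q2 := natq_ge2 R hq; have r0 := invq_gt0 R hq.
have er : e < r by lra.
have [K K0 HK] := dpot_lipschitz hq e0 er.
(* Clamping to [[e, r - e]] makes [G] continuous on the whole line. *)
pose cl x := Num.max e (Num.min x (r - e)).
have cl1 x : e <= cl x by rewrite le_max lexx.
have cl2 x : cl x <= r - e by rewrite /cl ge_max ge_min lexx orbT andbT; lra.
have cl3 x y : x <= y -> 0 <= cl y - cl x <= y - x.
  move=> xy; have h : e <= r - e by lra.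
  rewrite /cl; clear -h xy; apply/andP; split; case: (leP x (r - e)) => h1; case: (leP y (r - e)) => h2;
    rewrite ?(max_r h); case: (leP e x) => h3; case: (leP e y) => h4; lra.
pose M := - dpot q (r - e) *+ 2.
pose G x := kapF (cl x) ((q%:R - 1) * (- cl x - c)).
have M0 : 0 <= M by apply: (slopes_ge0 hq (phi_lipschitz_unif e0 (lexx e) _)); lra.
pose C := K + 2 * M * q%:R.
have C0 : 0 <= C by rewrite /C addr_ge0 ?(ltW K0)// !mulr_ge0//; lra.
have mod1 n x y : x <= y -> `|G y - G x| <= C * 2 ^+ n * (y - x) + C * 2^-1 ^+ n.
  move=> xy; have /andP[d0 d1] := cl3 _ _ xy.
  have clxy : cl x <= cl y by lra.
  have /andP[k1 k2] := kapF_diff ((q%:R - 1) * (- cl x - c)) e0 (ltW K0) HK (cl1 x) clxy (cl2 y).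
  have T := kap_diff_th hq ((q%:R - 1) * (- cl y - c)) ((q%:R - 1) * (- cl x - c)) n
    (phi_lipschitz_unif e0 (cl1 y) (cl2 y)).
  have thd : `|(q%:R - 1) * (- cl y - c) - (q%:R - 1) * (- cl x - c)| = (q%:R - 1) * (cl y - cl x).
    clear -q2 clxy; rewrite -mulrBr normrM gtr0_norm; last by lra.
    by rewrite ler0_norm; lra.
  rewrite thd -/M in T.
  have p1 : 1 <= 2 ^+ n :> R by rewrite exprn_ege1// ler1n.
  have h0 : 0 <= 2^-1 ^+ n :> R by rewrite exprn_ge0.
  have k3 : K * (cl y - cl x) / (q%:R - 1) <= K * 2 ^+ n * (y - x).
    clear -K0 q2 p1 d0 d1 xy; rewrite ler_pdivrMr; last by lra.
    rewrite -!mulrA ler_pM2l//; apply: (@le_trans _ _ (1 * ((y - x) * 1))); first by lra.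
    by rewrite !ler_pM//; lra.
  have k4 : 2 * M * 2 ^+ n * ((q%:R - 1) * (cl y - cl x)) <= 2 * M * q%:R * 2 ^+ n * (y - x).
    clear -M0 q2 p1 d0 d1 xy.
    have -> : 2 * M * q%:R * 2 ^+ n * (y - x) = 2 * M * 2 ^+ n * (q%:R * (y - x)) by ring.
    apply: ler_wpM2l; first by rewrite !mulr_ge0//; lra.
    by rewrite ler_pM//; lra.
  have k5 : 2 * M * 2^-1 ^+ n <= 2 * M * q%:R * 2^-1 ^+ n.
    by clear -M0 q2 h0; rewrite ler_wpM2r// ler_peMr ?mulr_ge0//; lra.
  have k6 : 0 <= K * 2^-1 ^+ n by rewrite mulr_ge0// ltW.
  have k7 : 0 <= (cl y - cl x) / (q%:R - 1) by clear -q2 d0; rewrite divr_ge0//; lra.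
  move: T => /ler_normlP[t1 t2]; rewrite /G /C.
  rewrite /kapF in k1 k2 *; clear -k1 k2 k3 k4 k5 k6 k7 t1 t2; apply/ler_normlP; split; lra.
have cG : continuous G.
  apply: (@continuous_modulus _ C) => // n x y.
  have [xy|xy] := leP x y.
    by rewrite distrC [`|x - y|]distrC [`|y - x|]ger0_norm ?subr_ge0//; exact: mod1.
  by rewrite [`|x - y|]gtr0_norm ?subr_gt0//; apply: mod1; exact: ltW.
have ee : cl e = e by rewrite /cl min_l ?max_l//; lra.
have ere : cl (r - e) = r - e by rewrite /cl min_l ?max_r//; lra.
have ele : e <= r - e by lra.
have [|a _ Ga] := @IVT R G e (r - e) 0 ele (continuous_subspaceT cG).
  rewrite /G ee ere ge_min le_max.
  by have [-> _] := ends ((q%:R - 1) * (- e - c)); have [_ ->] := ends ((q%:R - 1) * (- (r - e) - c)); rewrite orbT.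
by exists (cl a).
Qed.

(** For two zeros with [a <= a'], the growth of [kapF] from [a] to [a'] at fixed [th] equals its
    change from [th'] to [th] at fixed [a']. The former is at least [(a' - a) / (q - 1)], the latter
    is bounded by [kap_diff_th]. *)
Lemma root_modulus e : 0 < e -> e < r / 2 -> exists C : R, forall a a' th th' n,
  e <= a -> a <= r - e -> e <= a' -> a' <= r - e -> kapF a th = 0 -> kapF a' th' = 0 ->
  `|a - a'| <= C * (2 ^+ n * `|th - th'| + 2^-1 ^+ n).
Proof.
move=> e0 e1; have q2 := natq_ge2 R hq; have r0 := invq_gt0 R hq.
have er : e < r by lra.
have [K K0 HK] := dpot_lipschitz hq e0 er.
pose M := - dpot q (r - e) *+ 2.
exists (2 * M * (q%:R - 1)).
have main a a' th th' n : e <= a -> a <= a' -> a' <= r - e -> kapF a th = 0 -> kapF a' th' = 0 ->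
    a' - a <= 2 * M * (q%:R - 1) * (2 ^+ n * `|th - th'| + 2^-1 ^+ n).
  move=> ea aa ae k0 k0'; have /andP[k1 _] := kapF_diff th e0 (ltW K0) HK ea aa ae.
  have T := kap_diff_th hq th th' n (phi_lipschitz_unif e0 (le_trans ea aa) ae).
  move: T => /ler_normlP[_ t2]; rewrite -/M in t2; rewrite /kapF in k0 k0' k1.
  rewrite k0' k0 !subr0 in t2 k1; have := le_trans k1 t2.
  by rewrite ler_pdivrMr; lra.
move=> a a' th th' n ea ae ea' ae' k0 k0'; have [aa|aa] := leP a a'.
  by rewrite distrC ger0_norm ?subr_ge0//; exact: main.
by rewrite gtr0_norm ?subr_gt0// distrC; apply: main => //; exact: ltW.
Qed.

End ArcExistence.

(** * Maximizing measures live on an arc *)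

Section InvariantMeasures.
Variables (R : realType) (q : nat).
Implicit Types (x y c eps beta : R) (mu : probability R R).

Lemma measurable_floor_real : measurable_fun [set: R] (fun x : R => (Num.floor x)%:~R : R).
Proof.
move=> _; apply: (measurability _ (RGenOInfty.measurableE R)) => //.
move=> /= _ [_ [y ->] <-]; rewrite setTI; apply: is_interval_measurable => s t /=.
rewrite !in_itv/= !andbT => ys _ u /andP[su _]; rewrite /= in_itv/= andbT.
by apply: (lt_le_trans ys); rewrite ler_int le_floor.
Qed.

Lemma measurable_Tq : measurable_fun [set: R] (Tq (R:=R) q).
Proof.
have m : measurable_fun [set: R] (fun x : R => q%:R * x) by exact: mulrl_measurable.
by apply: measurable_funB => //; apply: (measurableT_comp measurable_floor_real).
Qed.

Lemma measurable_frac (g : R) : measurable_fun [set: R] (fun x => frac (x + g)).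
Proof.
have m : measurable_fun [set: R] (fun x : R => x + g) by apply: measurable_funD.
by apply: measurable_funB => //; apply: (measurableT_comp measurable_floor_real).
Qed.

Lemma measurable_fc c : measurable_fun [set: R] (fc (R:=R) q c).
Proof.
have my : measurable_fun [set: R] (fun x : R => pi * (x + c)).
  by apply: measurable_funM => //; apply: measurable_funD.
have ms : measurable_fun [set: R] (@sin R) by apply: continuous_measurable_fun; exact: continuous_sin.
have m1 : measurable_fun [set: R] (fun x : R => sin (pi * (x + c))) by exact: (measurableT_comp ms).
have m2 : measurable_fun [set: R] (fun x : R => sin (q%:R * (pi * (x + c)))).
  by apply: (measurableT_comp ms); apply: measurable_funM.
rewrite (_ : fc q c = fun x => if `|sin (pi * (x + c))| == 0 then (ln q%:R)%:E
  else if `|sin (q%:R * (pi * (x + c)))| == 0 then -oo%E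
  else (ln `|sin (q%:R * (pi * (x + c)))| - ln `|sin (pi * (x + c))|)%:E); last first.
  apply/funext => x; rewrite fc_ratioE; case: ifPn => // h1; case: ifPn => // h2.
  by rewrite ln_div// posrE lt_neqAle eq_sym normr_ge0 andbT.
have ma (f : R -> R) : measurable_fun [set: R] f -> measurable_fun [set: R] (fun x => `|f x|).
  by move=> mf; exact: (measurableT_comp (@normr_measurable R setT) mf).
apply: measurable_fun_ifT => //.
  by apply: measurable_fun_eqr => //; exact: ma.
apply: measurable_fun_ifT => //.
  by apply: measurable_fun_eqr => //; exact: ma.
apply/measurable_EFinP; apply: measurable_funB.
  by apply: (measurableT_comp (@measurable_ln R)); exact: ma.
by apply: (measurableT_comp (@measurable_ln R)); exact: ma.
Qed.

Lemma integrable_bounded mu (g : R -> R) (M : R) :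
  measurable_fun [set: R] g -> (forall x, `|g x| <= M) -> mu.-integrable [set: R] (EFin \o g).
Proof.
move=> mg gM; apply: measurable_bounded_integrable => //.
  by apply: (@le_lt_trans _ _ 1%E); [exact: probability_le1 | exact: ltry].
exists M; split; first exact: num_real.
by move=> z Mz x _; exact: le_trans (ltW Mz).
Qed.

Lemma integral_Tq mu (g : R -> R) (M : R) : Tinvariant q mu ->
  measurable_fun [set: R] g -> (forall x, `|g x| <= M) ->
  (\int[mu]_x (g (Tq q x))%:E = \int[mu]_x (g x)%:E)%E.
Proof.
move=> [_ inv] mg gM; have mT := measurable_Tq.
have mg' : measurable_fun [set: R] (EFin \o g) by exact/measurable_EFinP.
have ig : mu.-integrable (Tq q @^-1` [set: R]) ((EFin \o g) \o Tq q).
  rewrite preimage_setT; apply: (@integrable_bounded _ (g \o Tq q) M).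
    exact: (measurableT_comp mg mT).
  by move=> x; exact: gM.
have := integral_pushforward mT mg' ig measurableT.
rewrite preimage_setT => e; transitivity (\int[mu]_x ((EFin \o g) \o Tq q) x)%E => //.
by rewrite -e; apply: eq_measure_integral => A mA _; exact: inv.
Qed.

(** Stated without integrability, since [fc] takes the value [-oo] and its integral may be [-oo]. *)
Lemma le_integral_measurable mu (f g : R -> \bar R) :
  measurable_fun [set: R] f -> measurable_fun [set: R] g -> (forall x, f x <= g x)%E ->
  (\int[mu]_x f x <= \int[mu]_x g x)%E.
Proof.
move=> mf mg fg; rewrite integralE [leRHS]integralE leeB//; apply: ge0_le_integral => //.
- exact: measurable_funepos.
- exact: measurable_funepos.
- by move=> x /mem_set; apply: funepos_le => y _; exact: fg.
- exact: measurable_funeneg.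
- exact: measurable_funeneg.
- by move=> x /mem_set; apply: funeneg_le => y _; exact: fg.
Qed.

Lemma iter_TqE x k : 0 <= x -> x < 1 -> iter k (Tq q) x = frac (q%:R ^+ k * x).
Proof.
move=> x0 x1; elim: k => [|k ih]; first by rewrite expr0 mul1r frac_small.
rewrite iterS ih /Tq -/(frac _) exprS -mulrA.
apply: (@frac_eqz _ _ _ (- (q%:Z * Num.floor (q%:R ^+ k * x)))).
by rewrite intrN intrM -pmulrn /frac; ring.
Qed.

(** The average of the point masses at the first [n + 1] orbit points; counting from [n + 1] avoids
    an empty average. *)
Definition orbit_measure (y : R) (n : nat) : set R -> \bar R :=
  mscale (n.+1%:R^-1)%:nng (msum (fun k => \d_(iter k (Tq q) y)) n.+1).

HB.instance Definition _ y n := Measure.on (orbit_measure y n).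

Lemma orbit_measureE y n (A : set R) :
  orbit_measure y n A = ((n.+1%:R^-1)%:E * \sum_(k < n.+1) \d_(iter k (Tq q) y) A)%E.
Proof. by []. Qed.

Lemma orbit_measure1 y n (A : set R) : (forall k, (k <= n)%N -> A (iter k (Tq q) y)) ->
  orbit_measure y n A = 1%E.
Proof.
move=> Ak; rewrite orbit_measureE (eq_bigr (fun=> 1%E)); last first.
  by move=> k _; rewrite diracE mem_set//; apply: Ak; rewrite -ltnS.
rewrite sumEFin sumr_const card_ord -EFinM mulVf//.
Qed.

Let orbit_measureT y n : orbit_measure y n [set: R] = 1%E.
Proof. exact: orbit_measure1. Qed.

HB.instance Definition _ y n :=
  Measure_isProbability.Build _ _ _ (orbit_measure y n) (orbit_measureT y n).

Lemma orbit_measure_invariant y n : 0 <= y -> y < 1 -> iter n.+1 (Tq q) y = y ->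
  Tinvariant q (orbit_measure y n : probability R R).
Proof.
move=> y0 y1 per; split.
  apply: orbit_measure1 => k _ /=; rewrite iter_TqE// in_itv/= frac_ge0 frac_lt1//.
move=> A mA /=; rewrite !orbit_measureE; congr (_ * _)%E.
have e k : \d_(iter k (Tq q) y) (Tq q @^-1` A) = \d_(iter k.+1 (Tq q) y) A :> \bar R by [].
under eq_bigr do rewrite e.
rewrite [LHS]big_ord_recr/= [RHS]big_ord_recl/= -!iterS per addeC; congr (_ + _)%E.
Qed.

Lemma integral_cstR mu (k : R) : (\int[mu]_x (EFin \o cst k) x = k%:E)%E.
Proof.
transitivity (\int[mu]_x cst k%:E x)%E => //.
rewrite integral_cst// -[RHS]mule1; congr (_ * _)%E; exact: probability_setT.
Qed.

Section Maximizing.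
Variables (c beta L : R) (psi : R -> R) (arc : R -> bool).
Hypothesis psiL : forall x y, `|psi x - psi y| <= L * `|x - y|.
Hypothesis psi1 : forall x (n : int), psi (x + n%:~R) = psi x.
Hypothesis fc_arc : forall x, arc x -> fc q c x = (beta + psi (q%:R * x) - psi x)%:E.
Hypothesis fc_gap : forall x, ~~ arc x -> (fc q c x < (beta + psi (q%:R * x) - psi x)%:E)%E.
Hypothesis measurable_arc : measurable [set x | arc x].

Let W x := beta + psi (q%:R * x) - psi x.

Lemma psi_Tq x : psi (Tq q x) = psi (q%:R * x).
Proof. by rewrite /Tq -intrN psi1. Qed.

Lemma L_ge0 : 0 <= L.
Proof. by have := psiL 1 0; rewrite subr0 normr1 mulr1; exact: le_trans. Qed.

Lemma psi_bounded x : `|psi x| <= `|psi 0| + L.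
Proof.
have -> : psi x = psi (frac x) by rewrite -(psi1 x (- Num.floor x)) -fracK.
rewrite -[psi (frac x)](subrK (psi 0)) addrC; apply: le_trans (ler_normD _ _) _.
rewrite lerD2l; apply: le_trans (psiL _ _) _.
rewrite subr0 ger0_norm ?frac_ge0// ler_piMr ?L_ge0//.
by rewrite ltW// frac_lt1.
Qed.

Lemma psi_continuous : continuous psi.
Proof.
move=> x; apply/cvgrPdist_le => /= e e0; near=> y.
apply: le_trans (psiL _ _) _.
have : `|x - y| <= e / (L + 1) by near: y; apply: cvgr_dist_le; rewrite // divr_gt0// ltr_pwDr ?L_ge0.
move=> h; apply: le_trans (ler_wpM2l L_ge0 h) _.
rewrite mulrCA ler_piMr ?(ltW e0)// ler_pdivrMr ?ltr_pwDr ?L_ge0//.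
by rewrite mul1r lerDl.
Unshelve. all: by end_near. Qed.

Lemma measurable_psi : measurable_fun [set: R] psi.
Proof. by apply: continuous_measurable_fun; exact: psi_continuous. Qed.

Lemma measurable_W : measurable_fun [set: R] W.
Proof.
rewrite /W; apply: measurable_funB; last exact: measurable_psi.
apply: measurable_funD => //; apply: (measurableT_comp measurable_psi).
exact: mulrl_measurable.
Qed.

Lemma W_bounded x : `|W x| <= `|beta| + (`|psi 0| + L) + (`|psi 0| + L).
Proof.
rewrite /W; apply: le_trans (ler_normB _ _) _; apply: lerD; last exact: psi_bounded.
by apply: le_trans (ler_normD _ _) _; rewrite lerD2l psi_bounded.
Qed.

(** The two [psi] terms cancel by invariance: [psi] is periodic and does not distinguish [q x] from
    [Tq q x]. *)
Lemma integral_W mu : Tinvariant q mu -> (\int[mu]_x (W x)%:E = beta%:E)%E.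
Proof.
move=> inv; have mT := measurable_Tq.
have i1 : mu.-integrable [set: R] (EFin \o psi) by exact: (integrable_bounded mu measurable_psi psi_bounded).
have i2 : mu.-integrable [set: R] (EFin \o (psi \o Tq q)).
  apply: (@integrable_bounded _ _ (`|psi 0| + L)); first exact: (measurableT_comp measurable_psi mT).
  by move=> x; exact: psi_bounded.
have i3 : mu.-integrable [set: R] (EFin \o cst beta) by exact: finite_measure_integrable_cst.
transitivity (\int[mu]_x (((EFin \o cst beta) \+ (EFin \o (psi \o Tq q))) \- (EFin \o psi)) x)%E.
  by apply: eq_integral => x _; rewrite /= psi_Tq /W EFinB EFinD.
rewrite integralB//; last exact: integrableD.
rewrite integralD// [X in (_ + X - _)%E](@integral_Tq mu psi _ inv measurable_psi psi_bounded).
rewrite integral_cstR -addeA subee ?adde0//.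
exact: integrable_fin_num.
Qed.

Lemma fc_leW x : (fc q c x <= (W x)%:E)%E.
Proof. by have [ax|nax] := boolP (arc x); [rewrite fc_arc | apply/ltW/fc_gap]. Qed.

(** Truncation of [fc] from below: it lies between two bounded functions and is integrable even
    where [fc] is not. *)
Definition clip eps x : \bar R := maxe (fc q c x) (W x - eps)%:E.

Lemma clip_bounds eps x : 0 <= eps -> ((W x - eps)%:E <= clip eps x <= (W x)%:E)%E.
Proof.
by move=> e0; rewrite /clip le_max lexx orbT/= ge_max fc_leW lee_fin lerBlDr lerDl.
Qed.

Lemma measurable_Weps eps : measurable_fun [set: R] (fun x => (W x - eps)%:E).
Proof. by apply/measurable_EFinP; apply: measurable_funB => //; exact: measurable_W. Qed.

Lemma measurable_clip eps : measurable_fun [set: R] (clip eps).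
Proof. by apply: measurable_maxe; [exact: measurable_fc | exact: measurable_Weps]. Qed.

Lemma integral_Weps mu eps : Tinvariant q mu -> (\int[mu]_x (W x - eps)%:E = (beta - eps)%:E)%E.
Proof.
move=> inv; have i1 : mu.-integrable [set: R] (EFin \o W).
  exact: (integrable_bounded mu measurable_W W_bounded).
have i3 : mu.-integrable [set: R] (EFin \o cst eps) by exact: finite_measure_integrable_cst.
transitivity (\int[mu]_x ((EFin \o W) \- (EFin \o cst eps)) x)%E.
  by apply: eq_integral => x _ /=; rewrite EFinB.
by rewrite integralB// integral_W// integral_cstR EFinB.
Qed.

Lemma orbit_integral_ge y n eps : 0 <= eps -> 0 <= y -> y < 1 -> iter n.+1 (Tq q) y = y ->
  (forall k, (k <= n)%N -> ((W (iter k (Tq q) y) - eps)%:E <= fc q c (iter k (Tq q) y))%E) ->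
  ((beta - eps)%:E <= \int[orbit_measure y n]_x fc q c x)%E.
Proof.
move=> e0 y0 y1 per hk; have inv := orbit_measure_invariant y0 y1 per.
have -> : (\int[orbit_measure y n]_x fc q c x = \int[orbit_measure y n]_x clip eps x)%E.
  apply: ae_eq_integral => //; [exact: measurable_fc|exact: measurable_clip|].
  have mD : measurable [set x | fc q c x = clip eps x].
    have -> : [set x | fc q c x = clip eps x] = [set: R] `&` [set x | (fc q c x = clip eps x)%E].
      by rewrite setTI.
    by apply: emeasurable_fun_eq => //; [exact: measurable_fc | exact: measurable_clip].
  exists (~` [set x | fc q c x = clip eps x]); split.
  - exact: measurableC.
  - rewrite /= (@probability_setC _ _ _ (orbit_measure y n : probability R R))//.
    rewrite /= orbit_measure1 ?subee// => k kn /=.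
    by rewrite /clip; apply/esym/max_l; exact: hk.
  - by move=> x /= /not_implyP[_].
rewrite -(integral_Weps eps inv); apply: le_integral_measurable.
- exact: measurable_Weps.
- exact: measurable_clip.
- by move=> x; have /andP[] := clip_bounds x e0.
Qed.

(** Periodic orbits along which [fc] is almost equal to [W]; their measures are the competitors that
    force the maximum up to [beta]. *)
Hypothesis approx : forall eps, 0 < eps -> exists y n, [/\ 0 <= y, y < 1, iter n.+1 (Tq q) y = y &
  forall k, (k <= n)%N -> ((W (iter k (Tq q) y) - eps)%:E <= fc q c (iter k (Tq q) y))%E].

Lemma maximizing_integral_ge mu : maximizing q c mu -> (beta%:E <= \int[mu]_x fc q c x)%E.
Proof.
move=> [_ mx]; apply/lee_subgt0Pr => eps e0; rewrite -EFinB.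
have [y [n [y0 y1 per hk]]] := approx e0.
apply: le_trans (orbit_integral_ge (ltW e0) y0 y1 per hk) _.
exact: mx (orbit_measure_invariant y0 y1 per).
Qed.

(** [W - clip 1] is nonnegative with integral [beta - beta = 0], hence zero almost everywhere, while
    it is positive off the arc. *)
Lemma maximizing_arc mu : maximizing q c mu -> mu [set x | arc x] = 1%E.
Proof.
move=> mx; have [inv _] := mx; have ge := maximizing_integral_ge mx.
have i1 : mu.-integrable [set: R] (EFin \o W).
  exact: (integrable_bounded mu measurable_W W_bounded).
have i2 : mu.-integrable [set: R] (EFin \o (fun x => `|W x| + 1)).
  have b x : `| `|W x| + 1 | <= `|beta| + (`|psi 0| + L) + (`|psi 0| + L) + 1.
    by rewrite ger0_norm ?addr_ge0// lerD2r W_bounded.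
  apply: (integrable_bounded mu _ b); apply: measurable_funD => //.
  exact: (measurableT_comp (@normr_measurable R setT) measurable_W).
have i3 : mu.-integrable [set: R] (clip 1).
  apply: le_integrable i2 => //; first exact: measurable_clip.
  move=> x _ /=; have /andP[] := clip_bounds x (@ler01 R).
  case: (clip 1 x) => [r| |]//=; rewrite !lee_fin => h1 h2.
  rewrite [leRHS]ger0_norm ?addr_ge0//.
  have := ler_norm (W x); have := ler_norm (- W x); rewrite normrN => h3 h4.
  by apply/ler_normlP; split; lra.
have h : ae_eq mu [set: R] ((EFin \o W) \- clip 1)%E (cst 0%E).
  apply/ae_eq_integral_abs => //.
    apply: emeasurable_funB; last exact: measurable_clip.
    by apply/measurable_EFinP; exact: measurable_W.
  have d0 x : (0 <= ((EFin \o W) \- clip 1) x)%E.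
    have /andP[h1 h2] := clip_bounds x (@ler01 R).
    move: h1 h2; rewrite /=; case: (clip 1 x) => [s| |]// _ h2.
    by rewrite -EFinB lee_fin subr_ge0 -lee_fin.
  under eq_integral do rewrite gee0_abs//.
  rewrite integralB// integral_W//.
  have le1 : (\int[mu]_x clip 1 x <= beta%:E)%E.
    rewrite -(integral_W inv); apply: le_integral_measurable.
    - exact: measurable_clip.
    - by apply/measurable_EFinP; exact: measurable_W.
    - by move=> x; have /andP[] := clip_bounds x (@ler01 R).
  have ge1 : (beta%:E <= \int[mu]_x clip 1 x)%E.
    apply: le_trans ge _; apply: le_integral_measurable.
    - exact: measurable_fc.
    - exact: measurable_clip.
    - by move=> x; rewrite /clip le_max lexx.
  have -> : (\int[mu]_x clip 1 x = beta%:E)%E by apply/eqP; rewrite eq_le le1.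
  by rewrite subee.
have n0 : mu.-negligible (~` [set x | arc x]).
  apply: negligibleS h => x /= /negP nax; apply/not_implyP; split => //=.
  have W1 : (clip 1 x < (W x)%:E)%E.
    by rewrite /clip gt_max fc_gap//= lte_fin ltrBlDr ltrDl.
  move: W1; case: (clip 1 x) => [r| |]//=; rewrite ?lte_fin => h1.
  by rewrite -EFinB => -[] /eqP; rewrite subr_eq0 => /eqP e; rewrite e ltxx in h1.
have mA := measurable_arc.
have z : mu (~` [set x | arc x]) = 0%E.
  by apply/negligibleP => //; exact: measurableC.
have := probability_setC mu mA; rewrite z => e.
have f : mu [set x | arc x] \is a fin_num by apply: fin_num_measure.
by move: e f; case: (mu _) => // r [] e _; congr EFin; lra.
Qed.

End Maximizing.

End InvariantMeasures.

(** * Periodic orbits shadowing the arc *)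

Section MaximizingSturmian.
Variables (R : realType) (q : nat).
Hypothesis hq : (2 <= q)%N.
Implicit Types x y z t s a b c e th : R.

Local Notation r := (@GRing.inv R q%:R).

Lemma pot_lipschitz e y z : 0 < e -> e < r -> `|y| <= r - e -> `|z| <= r - e ->
  `|pot q y - pot q z| <= - dpot q (r - e) * `|y - z|.
Proof.
move=> e0 er.
have dD w : `|w| <= r - e -> `|dpot q w| <= - dpot q (r - e).
  move=> /ler_normlP[w1 w2].
  have l1 : `|w| < r by apply: lobe_itv; lra.
  have l2 : `|r - e| < r by apply: lobe_itv; lra.
  have l3 : `|- (r - e)| < r by rewrite normrN.
  have d1 := dpot_le hq l2 l1 w2.
  have d2 : dpot q w <= dpot q (- (r - e)) by apply: (dpot_le hq) => //; lra.
  by rewrite (dpotN hq) in d2; apply/ler_normlP; split; lra.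
have main y' z' : `|y'| <= r - e -> `|z'| <= r - e ->
    pot q y' - pot q z' <= - dpot q (r - e) * `|y' - z'|.
  move=> hy hz.
  have ly : `|y'| < r by apply: le_lt_trans hy _; lra.
  have lz : `|z'| < r by apply: le_lt_trans hz _; lra.
  apply: le_trans (pot_tangent hq ly lz) _; apply: le_trans (ler_norm _) _.
  by rewrite normrM ler_wpM2r// dD.
move=> hy hz; have h1 := main y z hy hz; have h2 := main z y hz hy.
by rewrite distrC in h2; apply/ler_normlP; split; lra.
Qed.

Lemma pigeonhole_real (v : nat -> R) (d : R) : 0 < d -> (forall i, 0 <= v i < 1) ->
  exists i j, (i < j)%N /\ `|v i - v j| <= d.
Proof.
move=> d0 hv; pose N := (Num.truncn d^-1).+1.
have NR : d^-1 < N%:R by rewrite truncnS_gt.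
have N0 : 0 < N%:R :> R by rewrite ltr0n.
have lt_N i : (Num.truncn (v i * N%:R) < N)%N.
  have /andP[v0 v1] := hv i; rewrite truncn_lt_nat ?mulr_ge0 ?ler0n//.
  by rewrite gtr_pMl.
pose f (i : 'I_N.+1) := Ordinal (lt_N i).
have : ~~ injectiveb f.
  by apply/injectiveP => /leq_card; rewrite !card_ord ltnn.
move=> /injectivePn[i [j ij /(congr1 val)/= fij]].
have cl (k l : nat) : Num.truncn (v k * N%:R) = Num.truncn (v l * N%:R) -> v k - v l <= d.
  move=> e; have /andP[vk0 vk1] := hv k; have /andP[vl0 vl1] := hv l.
  have h1 : v k * N%:R < (Num.truncn (v k * N%:R)).+1%:R by rewrite truncnS_gt.
  have h2 : (Num.truncn (v l * N%:R))%:R <= v l * N%:R by rewrite truncn_le// mulr_ge0// ltW.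
  rewrite e -natr1 in h1.
  have h3 : (v k - v l) * N%:R < 1 by rewrite mulrBl; lra.
  have h4 : 1 <= d * N%:R by rewrite -ler_pdivrMl// mulr1 ltW.
  by rewrite -(ler_pM2r N0); lra.
have /orP[lt|lt] : (i < j)%N || (j < i)%N by rewrite -neq_ltn.
  by exists i, j; split => //; apply/ler_normlP; rewrite opprB; split; apply: cl.
by exists j, i; split => //; apply/ler_normlP; rewrite opprB; split; apply: cl.
Qed.

Section Approximation.
Variables a b th c : R.
Hypotheses (a0 : 0 < a) (b0 : 0 < b) (ab : a + b = r :> R).
Hypothesis kap0 : kap q th (phi q a) = 0.
Hypothesis thE : th = (q%:R - 1) * (- a - c).

Local Notation psi := (psi q a th c).

Local Notation W x := (beta q a th + psi (q%:R * x) - psi x).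

Lemma WDz x (n : int) : W (x + n%:~R) = W x.
Proof.
rewrite (psiDz hq a0 b0 ab kap0) (_ : q%:R * (x + n%:~R) = q%:R * x + (q%:Z * n)%:~R).
  by rewrite (psiDz hq a0 b0 ab kap0).
by rewrite intrM -pmulrn mulrDr.
Qed.

(** [W - fc] vanishes on the arc, and slightly outside it [pot] and [psi] are still Lipschitz;
    [psi (q x)] accounts for the factor [q] in the constant. *)
Lemma W_near (v d eps : R) : 0 <= v -> v <= r -> `|d| <= a / 2 -> `|d| <= b / 2 ->
  (- dpot q (r - Num.min a b / 2) + phi_lip q a b * (q%:R + 1)) * `|d| <= eps ->
  ((W (- a - c + v + d) - eps)%:E <= fc q c (- a - c + v + d)%R)%E.
Proof.
move=> v0 vr da db he; have ? := a0; have ? := b0; have ? := ab.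
have /andP[m0 ma] : 0 < Num.min a b <= a by rewrite lt_min a0 b0 ge_min lexx.
have mb : Num.min a b <= b by rewrite ge_min lexx orbT.
have dm : `|d| <= Num.min a b / 2 by move: da db; rewrite /Num.min; case: ifP.
move: m0 ma mb dm he; move: (Num.min a b) => m m0 ma mb dm he.
have dm' := dm; move: dm' => /ler_normlP[d1 d2].
have z1 : `|v - a| <= r - m / 2 by apply/ler_normlP; split; lra.
have z2 : `|v + d - a| <= r - m / 2 by apply/ler_normlP; split; lra.
have m2 : 0 < m / 2 by lra.
have m3 : m / 2 < r by lra.
have := @pot_lipschitz (m / 2) (v - a) (v + d - a) m2 m3 z1 z2.
rewrite (_ : v - a - (v + d - a) = - d) ?normrN; last by ring.
move=> /ler_normlP[_ P].
have [cond _] := sturmian_condition hq a0 b0 ab kap0 thE (- a - c + v).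
have vf : frac (- a - c + v + a + c) = v.
  rewrite (_ : - a - c + v + a + c = v); last by ring.
  by rewrite frac_small//; have := invq_le2 R hq; lra.
rewrite vf in cond; have {cond} := cond vr.
rewrite fc_lobe//; last first.
  by rewrite (_ : - a - c + v + c = v - a); [apply: le_lt_trans z1 _; lra | ring].
rewrite (_ : - a - c + v + c = v - a); last by ring.
move=> [] e1.
rewrite fc_lobe//; last first.
  by rewrite (_ : - a - c + v + d + c = v + d - a); [apply: le_lt_trans z2 _; lra | ring].
rewrite (_ : - a - c + v + d + c = v + d - a); last by ring.
rewrite lee_fin.
have /ler_normlP[p1 p2] := psi_lipschitz hq a0 b0 ab th c (- a - c + v) (- a - c + v + d).
have /ler_normlP[p3 p4] := psi_lipschitz hq a0 b0 ab th c (q%:R * (- a - c + v)) (q%:R * (- a - c + v + d)).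
move: p1 p2 p3 p4.
rewrite (_ : - a - c + v - (- a - c + v + d) = - d) ?normrN; last by ring.
rewrite (_ : q%:R * (- a - c + v) - q%:R * (- a - c + v + d) = - (q%:R * d)) ?normrN; last by ring.
rewrite normrM ger0_norm ?ler0n// => p1 p2 p3 p4.
lra.
Qed.

(** The backward orbit [v] of [0] under the inverse branch stays in the arc. Two of its positions
    [v i] and [v j], [i < j], are close; the forward orbit of [v j] reaches [v i] after [n = j - i]
    steps, and a small correction closes it up. *)
Lemma approx_periodic eps : 0 < eps -> exists y n, [/\ 0 <= y, y < 1, iter n.+1 (Tq q) y = y &
  forall k, (k <= n)%N -> ((W (iter k (Tq q) y) - eps)%:E <= fc q c (iter k (Tq q) y))%E].
Proof.
move=> eps0; have q2 := natq_ge2 R hq; have r2 := invq_le2 R hq; have r0 := invq_gt0 R hq.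
pose C := - dpot q (r - Num.min a b / 2) + phi_lip q a b * (q%:R + 1).
pose d := Num.min (Num.min (a / 2) (b / 2)) (eps / (`|C| + 1)).
have C1 : 0 < `|C| + 1 by rewrite ltr_wpDl.
have d0 : 0 < d by rewrite !lt_min !divr_gt0.
have dC x : `|x| <= d -> [/\ `|x| <= a / 2, `|x| <= b / 2 & C * `|x| <= eps].
  rewrite !le_min => /andP[/andP[-> ->] h]; split => //.
  apply: (@le_trans _ _ ((`|C| + 1) * `|x|)); last by rewrite mulrC -ler_pdivlMr.
  by rewrite ler_wpM2r//; have := ler_norm C; lra.
pose tau t := frac (t - th) / q%:R.
pose v i := iter i tau 0.
have v0r i : 0 <= v i <= r.
  by case: i => [|i]; [rewrite lexx ltW | have [-> ->] := branch_itv hq (v i - th)].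
have vS i : exists m : int, q%:R * v i.+1 + th = v i + m%:~R.
  exists (- Num.floor (v i - th)); rewrite /v iterS /tau -/(v i) mulrCA mulfV ?gt_eqF//; last by lra.
  by rewrite mulr1 /frac intrN; ring.
have [|i [j [ij vij]]] := pigeonhole_real (v := v) d0.
  by move=> i; have /andP[-> h] := v0r i; apply: le_lt_trans h _; lra.
pose n := (j - i)%N; pose g := - a - c.
have orb k : (k <= n)%N -> exists m : int, q%:R ^+ k * (g + v j) = g + v (j - k)%N + m%:~R.
  elim: k => [|k ih] kn; first by exists 0; rewrite expr0 mul1r subn0 addr0.
  have [m e] := ih (ltnW kn); have [m' e'] := vS (j - k.+1)%N.
  exists (m' + q%:Z * m); rewrite exprS -mulrA e.
  have -> : (j - k = (j - k.+1).+1)%N.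
    by rewrite subnSK// (leq_trans kn)// leq_subr.
  rewrite intrD intrM -pmulrn; move: e'; rewrite thE -/g => e'.
  have -> : q%:R * (g + v (j - k.+1).+1 + m%:~R) =
    (q%:R * v (j - k.+1).+1 + (q%:R - 1) * g) + g + q%:R * m%:~R by ring.
  by rewrite e'; ring.
have n0 : (0 < n)%N by rewrite subn_gt0.
have [N nN] : exists N, n = N.+1 by exists n.-1; rewrite prednK.
have Q1 k : 1 <= q%:R ^+ k :> R by rewrite exprn_ege1//; lra.
have Qn : q%:R ^+ N <= q%:R ^+ n - 1 :> R.
  by rewrite nN exprS; have := Q1 N; nra.
have Qn0 : 0 < q%:R ^+ n - 1 :> R by have := Q1 N; lra.
(* The correction solves [q^n e = e + (v j - v i)]; through step [n - 1] it stays below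
   [q^(n-1) d / (q^n - 1) <= d]. *)
pose e := (v j - v i) / (q%:R ^+ n - 1).
have [m me] := orb n (leqnn n).
have eE : q%:R ^+ n * e = e + (v j - v i).
  have : (q%:R ^+ n - 1) * e = v j - v i by rewrite /e mulrC divfK// gt_eqF.
  by rewrite mulrBl mul1r => <-; ring.
have ji : (j - n)%N = i by rewrite /n subKn// ltnW.
pose y0 := g + v j + e.
have y0n : q%:R ^+ n * y0 = y0 + m%:~R by rewrite /y0 mulrDr me eE ji; ring.
have iterE k : iter k (Tq q) (frac y0) = frac (q%:R ^+ k * y0).
  rewrite iter_TqE ?frac_ge0 ?frac_lt1//.
  apply: (@frac_eqz _ _ _ (- (q%:Z ^+ k * Num.floor y0))).
  by rewrite intrN intrM rmorphXn/= -pmulrn /frac; ring.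
exists (frac y0), N; split; rewrite ?frac_ge0 ?frac_lt1//.
  by rewrite iterE -nN y0n fracDz.
move=> k kN; rewrite iterE fracK WDz fcDz.
have kn : (k <= n)%N by rewrite nN leqW.
have [m' e'] := orb k kn.
have -> : q%:R ^+ k * y0 = g + v (j - k)%N + q%:R ^+ k * e + m'%:~R.
  by rewrite /y0 mulrDr e'; ring.
rewrite WDz fcDz.
have ed : `|q%:R ^+ k * e| <= d.
  rewrite normrM ger0_norm ?exprn_ge0 ?ler0n// /e normrM normfV (gtr0_norm Qn0) mulrCA.
  rewrite -[leRHS]mulr1 distrC ler_pM ?mulr_ge0 ?exprn_ge0 ?ler0n ?invr_ge0 ?(ltW Qn0)//.
  rewrite ler_pdivrMr// mul1r; apply: le_trans _ Qn.
  by rewrite ler_weXn2l//; lra.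
have [h1 h2 h3] := dC _ ed; have /andP[vk0 vk1] := v0r (j - k)%N.
exact: W_near.
Qed.

End Approximation.

(** The margin [e] does not depend on [c], so that the constants of the covers are uniform. *)
Theorem maximizing_sturmian : exists2 e, 0 < e < r / 2 &
  forall c (mu : probability R R), maximizing q c mu ->
  exists a, [/\ e <= a, a <= r - e, kapF q a ((q%:R - 1) * (- a - c)) = 0 &
    mu [set x | frac (x + a + c) <= r] = 1%E].
Proof.
have [e /andP[e0 e1] arc] := exists_arc R hq; exists e; first by rewrite e0.
move=> c mu mx; have [a [ea ae k0]] := arc c; exists a; split => //.
have a0 : 0 < a by lra.
have b0 : 0 < r - a by lra.
have ab : a + (r - a) = r by rewrite addrC subrK.
have cond := sturmian_condition hq a0 b0 ab k0 erefl.
apply: (@maximizing_arc R q c (beta q a ((q%:R - 1) * (- a - c))) (phi_lip q a (r - a))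
  (psi q a ((q%:R - 1) * (- a - c)) c) (fun x => frac (x + a + c) <= r)) => //.
- exact: (psi_lipschitz hq a0 b0 ab).
- exact: (psiDz hq a0 b0 ab k0).
- by move=> x; have [h _] := cond x.
- by move=> x; rewrite -ltNge; have [_ h] := cond x.
- have -> : [set x | frac (x + a + c) <= r] = (fun x => frac (x + (a + c))) @^-1` `]-oo, r].
    by apply/seteqP; split => x /=; rewrite in_itv/= addrA.
  by rewrite -[X in measurable X]setTI; apply: measurable_frac.
- exact: (approx_periodic a0 b0 ab k0 erefl).
Qed.

End MaximizingSturmian.

(** * Rotation numbers *)

Section Coding.
Variables (R : realType) (q : nat).
Hypothesis hq : (2 <= q)%N.
Variables (g : R).
Implicit Types (v w : nat -> R) (d f : nat -> int) (rho : R).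

Local Notation r := (@GRing.inv R q%:R).
Local Notation th := ((q%:R - 1) * g).

(* [v] is the position relative to the left end [g] of the arc, along an orbit that never leaves
   the arc; [d] counts the turns made at each step. *)
Definition coded v d := forall k,
  [/\ 0 <= v k, v k <= r & q%:R * v k + th = (d k)%:~R + v k.+1].

Definition turns d n : int := \sum_(i < n) d i.

Lemma turnsS d n : turns d n.+1 = turns d n + d n.
Proof. by rewrite /turns big_ord_recr. Qed.

Lemma coded_shift v d k : coded v d -> coded (fun i => v (k + i)%N) (fun i => d (k + i)%N).
Proof. by move=> cd i; rewrite addnS. Qed.

Lemma coded_lt1 v d k : coded v d -> v k < 1.
Proof. by move=> /(_ k)[_ h _]; have := invq_le2 R hq; lra. Qed.

(** The lift [x + K -> q x + K] maps [K + [0, 1/q]] onto [[K, K + 1]], so it is nondecreasing on the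
    union of these intervals. *)
Lemma lift_mono (x y : R) (K L : int) : 0 <= x -> x <= r -> 0 <= y -> y <= r ->
  x + K%:~R <= y + L%:~R -> q%:R * x + K%:~R <= q%:R * y + L%:~R.
Proof.
move=> x0 xr y0 yr h; have q2 := natq_ge2 R hq; have r2 := invq_le2 R hq.
have qx : q%:R * x <= 1 by have := ler_wpM2l (ler0n R q) xr; rewrite mulqV.
have qy : 0 <= q%:R * y by rewrite mulr_ge0//; lra.
case: (ltgtP K L) => [KL|LK|e].
- have h1 : (K + 1)%:~R <= L%:~R :> R by rewrite ler_int lezD1.
  by rewrite intrD in h1; lra.
- have h1 : (L + 1)%:~R <= K%:~R :> R by rewrite ler_int lezD1.
  by rewrite intrD in h1; lra.
- by move: h; rewrite e !lerD2r => h; rewrite ler_pM2l//; lra.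
Qed.

Lemma turns_lift v d w f (m : int) : coded v d -> coded w f -> v 0 <= w 0 + m%:~R ->
  forall j, v j + (turns d j)%:~R <= w j + (turns f j + m)%:~R.
Proof.
move=> cv cw h; elim=> [|j ih]; first by rewrite /turns !big_ord0 add0r addr0.
have [v0 vr ve] := cv j; have [w0 wr we] := cw j.
have := lift_mono v0 vr w0 wr ih; rewrite !turnsS !intrD => h'.
lra.
Qed.

Lemma int_le_near (x y : R) (K L : int) : 0 <= x -> y < 1 -> x + K%:~R <= y + L%:~R -> K <= L.
Proof.
move=> x0 y1 h; rewrite -ltzD1 -(ltr_int R) intrD; lra.
Qed.

Lemma turns_le v d w f j : coded v d -> coded w f -> v 0 <= w 0 -> turns d j <= turns f j.
Proof.
move=> cv cw h; have [v0 _ _] := cv j; have w1 := coded_lt1 j cw.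
apply: (int_le_near v0 w1).
by have := @turns_lift v d w f 0 cv cw; rewrite mulr0z addr0 => /(_ h j); rewrite addr0.
Qed.

(** Order preservation with [m = 1]: any position lies below any other one raised by a full turn. *)
Lemma turns_le1 v d w f j : coded v d -> coded w f -> turns d j <= turns f j + 1.
Proof.
move=> cv cw; have [v0 _ _] := cv j; have w1 := coded_lt1 j cw.
apply: (int_le_near v0 w1); apply: turns_lift => //.
by have [h _ _] := cw 0; have := coded_lt1 0 cv; lra.
Qed.

Lemma coded_diff v d w f n : coded v d -> coded w f -> (forall i, (i < n)%N -> d i = f i) ->
  v n - w n = q%:R ^+ n * (v 0 - w 0).
Proof.
move=> cv cw; elim: n => [|n ih] h; first by rewrite mul1r.
have [_ _ ve] := cv n; have [_ _ we] := cw n; rewrite h// in ve.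
rewrite exprS -mulrA -ih; last by move=> i /ltnW; exact: h.
by rewrite mulrBr; lra.
Qed.

Lemma coded_dist v d k w f l : coded v d -> coded w f -> `|v k - w l| <= 1.
Proof.
move=> cv cw; have [v0 _ _] := cv k; have [w0 _ _] := cw l.
have := coded_lt1 k cv; have := coded_lt1 l cw => h1 h2.
by apply/ler_normlP; split; lra.
Qed.

Lemma expand_small x : (forall n, q%:R ^+ n * `|x| <= 1) -> x = 0 :> R.
Proof.
move=> h; apply/eqP; rewrite -normr_eq0 eq_le normr_ge0 andbT leNgt; apply/negP => x0.
have q2 := natq_ge2 R hq.
have [n hn] : exists n, `|x|^-1 < q%:R ^+ n.
  exists (Num.truncn `|x|^-1).+1; apply: lt_le_trans (truncnS_gt _) _.
  by rewrite -natrX ler_nat ltnW// ltn_expl.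
by have := h n; rewrite -ler_pdivlMr// mul1r leNgt hn.
Qed.

Lemma coded_rigid v d w f : coded v d -> coded w f -> d =1 f -> v 0 = w 0.
Proof.
move=> cv cw df; apply/eqP; rewrite -subr_eq0; apply/eqP/expand_small => n.
have q0 : 0 <= q%:R ^+ n :> R by rewrite exprn_ge0.
rewrite -{1}(ger0_norm q0) -normrM -(coded_diff cv cw (fun i _ => df i)).
exact: coded_dist cv cw.
Qed.

Definition expansion d n : R := \sum_(i < n) (d i)%:~R / q%:R ^+ i.+1.

(** Iteration of [v k = (d k + v k.+1 - th) / q]; the contributions of [th = (q - 1) g] add up to
    [g (1 - q^-n)]. *)
Lemma coded_expansion v d n : coded v d ->
  v 0 + g * (1 - r ^+ n) = expansion d n + v n * r ^+ n.
Proof.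
move=> cv; have q2 := natq_ge2 R hq; elim: n => [|n ih].
  by rewrite /expansion big_ord0 !expr0; ring.
rewrite /expansion big_ord_recr/= -/(expansion d n).
have [_ _ ve] := cv n.
have e : r ^+ n = q%:R * r ^+ n.+1 by rewrite exprS mulrA mulqV// mul1r.
rewrite -[(q%:R ^+ n.+1)^-1]exprVn; move: ih; rewrite e.
move: (r ^+ n.+1) => s ih.
have -> : (d n)%:~R = q%:R * v n + th - v n.+1 by rewrite ve addrK.
by lra.
Qed.

Lemma expansion_turns d n :
  expansion d n = \sum_(i < n) (turns d i.+1 - turns d i)%:~R / q%:R ^+ i.+1.
Proof. by apply: eq_bigr => i _; rewrite turnsS addrAC subrr add0r. Qed.

(** Base [q] expansion with the Sturmian word of slope [rho] as digits. *)
Definition sturmian_sum rho n : R :=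
  \sum_(i < n) (Num.floor (i.+1%:R * rho) - Num.floor (i%:R * rho))%:~R / q%:R ^+ i.+1.

Lemma floorM0 rho : Num.floor (0%:R * rho) = 0.
Proof. by rewrite mul0r floor0. Qed.

(* Both orbits have [turns j] within one of each other, so the hypotheses force
   [turns d j = floor (j rho)] and [turns f j = floor (j rho) + 1] for [0 < j]; their positions are
   then almost [1 / q] apart, which pushes [v 0] to the left end of the arc. *)
Lemma sturmian_approx v d w f rho n : coded v d -> coded w f ->
  (forall j, (0 < j <= n.+1)%N -> (Num.floor (j%:R * rho))%:~R < j%:R * rho) ->
  (forall j, (j <= n.+1)%N -> (turns d j)%:~R <= j%:R * rho) ->
  (forall j, (j <= n.+1)%N -> j%:R * rho <= (turns f j)%:~R) ->
  `|g - sturmian_sum rho n.+1| <= (`|g| + 2) * r ^+ n.+1.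
Proof.
move=> cv cw irr lo hi; have q2 := natq_ge2 R hq; have r0 := invq_gt0 R hq.
have dE j : (j <= n.+1)%N -> turns d j = Num.floor (j%:R * rho).
  case: j => [|j] jn; first by rewrite floorM0 /turns big_ord0.
  have le1 : turns d j.+1 <= Num.floor (j.+1%:R * rho) by rewrite floor_ge_int lo.
  have lt1 : Num.floor (j.+1%:R * rho) < turns f j.+1.
    by rewrite -(ltr_int R); apply: lt_le_trans (hi _ jn); apply: irr.
  apply/le_anti; rewrite le1/= -ltzD1; apply: lt_le_trans lt1 _; exact: turns_le1.
have fE j : (0 < j <= n.+1)%N -> turns f j = turns d j + 1.
  move=> jn; have /andP[j0 jn1] := jn; apply/le_anti; rewrite (turns_le1 _ cw cv) lezD1/=.
  by rewrite dE// -(ltr_int R); apply: lt_le_trans (hi _ jn1); apply: irr.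
have f0 : f 0 = d 0 + 1 by have := fE 1%N isT; rewrite /turns !big_ord1.
have fS i : (i < n)%N -> f (1 + i)%N = d (1 + i)%N.
  move=> lt_in; have := fE i.+2 lt_in.
  rewrite [turns f i.+2]turnsS [turns d i.+2]turnsS fE; last by rewrite /= ltnW.
  by rewrite addrAC => /addIr; apply: addrI.
have dif := coded_diff (coded_shift 1 cw) (coded_shift 1 cv) fS.
have dist := coded_dist (1 + n) (1 + n) cw cv.
rewrite dif normrM ger0_norm ?exprn_ge0 ?ler0n// in dist.
have close : `|w 1%N - v 1%N| <= r ^+ n.
  by rewrite exprVn -[leRHS]mul1r ler_pdivlMr ?exprn_gt0 1?mulrC//; lra.
have [v0 _ ve] := cv 0; have [_ wr we] := cw 0.
have v0le : v 0 <= r ^+ n.+1.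
  rewrite exprS -(ler_pM2l (_ : 0 < q%:R)) ?mulrA ?mulqV ?mul1r//; last by lra.
  have wq : q%:R * w 0 <= 1 by have := ler_wpM2l (ler0n R q) wr; rewrite mulqV.
  rewrite f0 intrD in we; move: close => /ler_normlP[c1 c2]; lra.
have e := coded_expansion n.+1 cv.
have -> : sturmian_sum rho n.+1 = expansion d n.+1.
  rewrite expansion_turns; apply: eq_bigr => i _; rewrite !dE//; first exact: ltnW.
have [vn0 _ _] := cv n.+1; have vn1 := coded_lt1 n.+1 cv.
have -> : g - expansion d n.+1 = g * r ^+ n.+1 + v n.+1 * r ^+ n.+1 - v 0.
  by move: e; rewrite mulrBr mulr1; lra.
have R0 : 0 <= r ^+ n.+1 by rewrite exprn_ge0// ltW.
move: R0 v0le; move: (r ^+ n.+1) => s R0 v0le.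
have g1 : `|g * s| <= `|g| * s by rewrite normrM [`|s|]ger0_norm.
have v1 : v n.+1 * s <= s by rewrite ler_piMl// ltW.
have v2 : 0 <= v n.+1 * s by rewrite mulr_ge0.
move: g1 => /ler_normlP[g1 g2]; rewrite mulrDl; apply/ler_normlP; split; lra.
Qed.

Section Periodic.
Variables (v : nat -> R) (d : nat -> int) (n : nat) (p : int).
Hypothesis n0 : (0 < n)%N.
Hypothesis cv : coded v d.
Hypothesis per : forall k, turns (fun i => d (k + i)%N) n = p.

(** Consecutive windows of length [n] have equal sums, so the digit that leaves equals the one that
    enters. *)
Lemma digits_periodic k : d (k + n)%N = d k.
Proof.
have h1 := per k; have h2 := per k.+1.
have e : turns (fun i => d (k + i)%N) n.+1 = d k + turns (fun i => d (k.+1 + i)%N) n.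
  rewrite /turns big_ord_recl/= addn0; congr (_ + _); apply: eq_bigr => i _.
  by rewrite /bump/= add1n addnS.
by move: e; rewrite turnsS h1 h2 addrC => /addIr.
Qed.

Lemma position_periodic : v n = v 0.
Proof.
have := coded_rigid (coded_shift n cv) cv; rewrite addn0; apply => i.
by rewrite addnC digits_periodic.
Qed.

(** From the leftmost position [k] one has [T k j <= T i j <= T k j + 1] for every [i]. Summing over
    [i < n] gives [n T k j <= p j < n (T k j + 1)], where the term [i = k] makes the second
    inequality strict. *)
Lemma turns_min : exists2 k, (k < n)%N &
  forall j, turns (fun i => d (k + i)%N) j = Num.floor (j%:R * (p%:~R / n%:R) : R).
Proof.
pose T i j := turns (fun l => d (i + l)%N) j.
pose k := [arg min_(i < Ordinal n0) v i]%O.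
have kmin (i : 'I_n) : v k <= v i by rewrite /k; case: arg_minP => // i0 _ /(_ i isT).
exists k => // j; rewrite -/(T k j).
have lo (i : 'I_n) : T k j <= T i j.
  by apply: turns_le (coded_shift k cv) (coded_shift i cv) _; rewrite !addn0.
have hi (i : 'I_n) : T i j <= T k j + 1.
  exact: turns_le1 (coded_shift i cv) (coded_shift k cv).
have sum : \sum_(i < n) T i j = p *+ j.
  rewrite /T /turns exchange_big/=.
  rewrite (eq_bigr (fun=> p)) ?sumr_const ?card_ord// => l _.
  by rewrite -(per l) /turns; apply: eq_bigr => i _; rewrite addnC.
have cst (z : int) : z *+ n = \sum_(i < n) z by rewrite sumr_const card_ord.
have s1 : T k j *+ n <= p *+ j.
  by rewrite -sum cst ler_sum.
have s2 : p *+ j < (T k j + 1) *+ n.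
  rewrite -sum cst (bigD1 k)//= [ltRHS](bigD1 k)//=.
  by rewrite ltr_leD ?ler_sum// ltzD1.
have nR : 0 < n%:R :> R by rewrite ltr0n.
apply/esym/floor_def; rewrite mulrA ler_pdivlMr// ltr_pdivrMr//.
by rewrite !mulr_natr mulr_natl -!rmorphMn/= ler_int ltr_int s1 s2.
Qed.

End Periodic.

End Coding.

(** * Functions on one side of their mean *)

Section Averages.
Variables (R : realType) (mu : probability R R).
Implicit Types (f : R -> R) (A G : set R).

Lemma negligible_full A : measurable A -> mu A = 1%E -> mu.-negligible (~` A).
Proof.
move=> mA A1; apply/negligibleP; first exact: measurableC.
by have := probability_setC mu mA; rewrite A1 subee.
Qed.

Lemma full_negligible A : measurable A -> mu.-negligible (~` A) -> mu A = 1%E.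
Proof.
move=> mA /(negligibleP _ (measurableC mA)) A0.
by have := probability_setC mu (measurableC mA); rewrite A0 setCK sube0.
Qed.

Lemma negligible_setT : ~ mu.-negligible [set: R].
Proof.
move=> /(negligibleP _ measurableT) h.
have /eqP : (1 = 0 :> \bar R)%E by rewrite -h; apply/esym; exact: probability_setT.
by rewrite onee_eq0.
Qed.

Variables (G : set R) (M I : R).
Hypothesis nG : mu.-negligible (~` G).

Lemma negligible_above_average f : measurable_fun [set: R] f -> (forall x, `|f x| <= M) ->
  (\int[mu]_x (f x)%:E = I%:E)%E -> (forall x, G x -> I <= f x) -> mu.-negligible [set x | f x <> I].
Proof.
move=> mf fM fI If.
have i1 : mu.-integrable [set: R] (EFin \o f) by exact: (integrable_bounded mu mf fM).
have i3 : mu.-integrable [set: R] (EFin \o cst I) by exact: finite_measure_integrable_cst.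
have m1 : measurable_fun [set: R] (fun x => (f x - I)%:E).
  by apply/measurable_EFinP; exact: measurable_funB.
have h : ae_eq mu [set: R] (fun x => (f x - I)%:E) (cst 0%E).
  apply/ae_eq_integral_abs => //.
  transitivity (\int[mu]_x (f x - I)%:E)%E.
    apply: ae_eq_integral => //; first exact: (measurableT_comp (@abse_measurable _ setT) m1).
    apply: negligibleS nG => x /= /not_implyP[_ h] Gx; apply: h.
    by rewrite ger0_norm// subr_ge0; exact: If.
  transitivity (\int[mu]_x ((EFin \o f) \- (EFin \o cst I)) x)%E.
    by apply: eq_integral => x _ /=; rewrite EFinB.
  by rewrite integralB// fI integral_cstR subee.
apply: negligibleS h => x /= fx; apply/not_implyP; split => // -[] /eqP.
by rewrite subr_eq0 => /eqP.
Qed.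

Lemma exists_le_average f : measurable_fun [set: R] f -> (forall x, `|f x| <= M) ->
  (\int[mu]_x (f x)%:E = I%:E)%E -> exists2 x, G x & f x <= I.
Proof.
move=> mf fM fI; apply: contrapT => ne.
have If x : G x -> I < f x.
  by move=> Gx; rewrite ltNge; apply/negP => h; apply: ne; exists x.
apply: negligible_setT.
have := negligibleU nG (negligible_above_average mf fM fI (fun x Gx => ltW (If x Gx))).
apply: negligibleS => x _; have [Gx|] := pselect (G x); last by left.
by right => /= e; have := If x Gx; rewrite e ltxx.
Qed.

End Averages.

Section Rotation.
Variables (R : realType) (q : nat).
Hypothesis hq : (2 <= q)%N.
Variables (g : R) (mu : probability R R).
Hypothesis inv : Tinvariant q mu.
Hypothesis arc : mu [set x | frac (x - g) <= q%:R^-1] = 1%E.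

Local Notation r := (@GRing.inv R q%:R).
Local Notation th := ((q%:R - 1) * g).

Definition pos x k : R := frac (q%:R ^+ k * x - g).
Definition dig x k : int := Num.floor (q%:R * pos x k + th).

Lemma posS x k : pos x k.+1 = frac (q%:R * pos x k + th).
Proof.
apply: (@frac_eqz _ _ _ (q%:Z * Num.floor (q%:R ^+ k * x - g))).
by rewrite intrM -pmulrn /pos /frac exprS; ring.
Qed.

Lemma pos_Tq x k : pos (Tq q x) k = pos x k.+1.
Proof.
apply: (@frac_eqz _ _ _ (- (q%:Z ^+ k * Num.floor (q%:R * x)))).
by rewrite intrN intrM rmorphXn/= -pmulrn /Tq exprSr; ring.
Qed.

Lemma dig_Tq x k : dig (Tq q x) k = dig x k.+1.
Proof. by rewrite /dig pos_Tq. Qed.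

Definition good : set R := [set x | forall k, pos x k <= r].

Lemma good_coded x : good x -> coded q g (pos x) (dig x).
Proof.
move=> Gx k; split; [exact: frac_ge0 | exact: Gx |].
by rewrite posS /dig /frac; ring.
Qed.

Lemma measurable_pos k : measurable_fun [set: R] (pos ^~ k).
Proof.
have m : measurable_fun [set: R] (fun x : R => q%:R ^+ k * x) by exact: mulrl_measurable.
exact: (measurableT_comp (measurable_frac (- g)) m).
Qed.

Lemma measurable_dig k : measurable_fun [set: R] (fun x => (dig x k)%:~R : R).
Proof.
apply: (measurableT_comp (@measurable_floor_real R)); apply: measurable_funD => //.
by apply: measurable_funM => //; exact: measurable_pos.
Qed.

Definition dig_bound : R := q%:R + `|th| + 1.

Lemma dig_le x k : `|(dig x k)%:~R : R| <= dig_bound.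
Proof.
have p0 : 0 <= pos x k by exact: frac_ge0.
have p1 : pos x k < 1 by exact: frac_lt1.
have q2 := natq_ge2 R hq.
have h1 : q%:R * pos x k <= q%:R by rewrite ler_piMr// ?ltW//; lra.
have h0 : 0 <= q%:R * pos x k by rewrite mulr_ge0//; lra.
have f1 : (dig x k)%:~R <= q%:R * pos x k + th by exact: floor_le.
have f2 : q%:R * pos x k + th < (dig x k + 1)%:~R by exact: floorD1_gt.
rewrite intrD in f2; have := ler_norm th; have := ler_norm (- th); rewrite normrN.
by move=> t1 t2; rewrite /dig_bound; apply/ler_normlP; split; lra.
Qed.

Lemma turnsE x n : (turns (dig x) n)%:~R = \sum_(i < n) (dig x i)%:~R :> R.
Proof. by rewrite /turns rmorph_sum. Qed.

Lemma measurable_turns n : measurable_fun [set: R] (fun x => (turns (dig x) n)%:~R : R).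
Proof.
under [X in measurable_fun _ X]eq_fun do rewrite turnsE.
by apply: measurable_sum => i; exact: measurable_dig.
Qed.

Lemma turns_bound x n : `|(turns (dig x) n)%:~R : R| <= n%:R * dig_bound.
Proof.
rewrite turnsE; apply: le_trans (ler_norm_sum _ _ _) _.
rewrite mulr_natl -[n in leRHS]card_ord -sumr_const; apply: ler_sum => i _; exact: dig_le.
Qed.

(** The mean number of turns per step; by invariance, [turns] over [n] steps has mean [n * rho]. *)
Definition rotation_number : R := fine (\int[mu]_x ((dig x 0)%:~R : R)%:E).
Local Notation rho := rotation_number.

Lemma integrable_dig k : mu.-integrable [set: R] (EFin \o (fun x => (dig x k)%:~R : R)).
Proof. by apply: (integrable_bounded mu (measurable_dig k)) => x; exact: dig_le. Qed.

Lemma integral_dig k : (\int[mu]_x ((dig x k)%:~R : R)%:E = rho%:E)%E.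
Proof.
elim: k => [|k ih]; first by rewrite fineK//; exact: integrable_fin_num (integrable_dig 0).
rewrite -ih -(integral_Tq inv (measurable_dig k) (dig_le ^~ k)).
by apply: eq_integral => x _; rewrite dig_Tq.
Qed.

Lemma integral_turns n : (\int[mu]_x ((turns (dig x) n)%:~R : R)%:E = (n%:R * rho)%:E)%E.
Proof.
elim: n => [|n ih].
  rewrite mul0r; under eq_integral do rewrite /turns big_ord0.
  exact: integral_cstR.
have i1 : mu.-integrable [set: R] (EFin \o (fun x => (turns (dig x) n)%:~R : R)).
  by apply: (integrable_bounded mu (measurable_turns n)) => x; exact: turns_bound.
transitivity (\int[mu]_x ((EFin \o (fun x => (turns (dig x) n)%:~R : R)) \+
    (EFin \o (fun x => (dig x n)%:~R : R))) x)%E.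
  by apply: eq_integral => x _ /=; rewrite turnsS intrD EFinD.
rewrite integralD//; last exact: integrable_dig.
by rewrite ih integral_dig -EFinD -natr1; congr EFin; ring.
Qed.

Lemma measurable_pos_le k : measurable [set x | pos x k <= r].
Proof.
have -> : [set x | pos x k <= r] = pos ^~ k @^-1` `]-oo, r].
  by apply/seteqP; split => x /=; rewrite in_itv.
by rewrite -[X in measurable X]setTI; apply: measurable_pos.
Qed.

Lemma mu_pos k : mu [set x | pos x k <= r] = 1%E.
Proof.
elim: k => [|k ih].
  by rewrite -[RHS]arc; congr (mu _); apply/seteqP; split => x /=; rewrite /pos mul1r.
rewrite -ih -(inv.2 [set x | pos x k <= r]); last exact: measurable_pos_le.
by congr (mu _); apply/seteqP; split => x /=; rewrite pos_Tq.
Qed.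

Lemma negligible_bad : mu.-negligible (~` good).
Proof.
have : mu.-negligible (\bigcup_k ~` [set x | pos x k <= r]).
  apply: negligible_bigcup => k; apply: negligible_full (mu_pos k).
  exact: measurable_pos_le.
apply: negligibleS => x /= /existsNP[k nk]; by exists k.
Qed.

Lemma exists_turns_le n : exists2 x, good x & (turns (dig x) n)%:~R <= n%:R * rho.
Proof.
exact: (exists_le_average negligible_bad (measurable_turns n) (turns_bound ^~ n) (integral_turns n)).
Qed.

Lemma integral_turnsN n : (\int[mu]_x (- (turns (dig x) n)%:~R : R)%:E = (- (n%:R * rho))%:E)%E.
Proof.
have i1 : mu.-integrable [set: R] (EFin \o (fun x => (turns (dig x) n)%:~R : R)).
  by apply: (integrable_bounded mu (measurable_turns n)) => x; exact: turns_bound.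
rewrite EFinN -integral_turns -(integralN (integrable_add_def measurableT i1)).
by apply: eq_integral => x _; rewrite EFinN.
Qed.

Lemma exists_turns_ge n : exists2 x, good x & n%:R * rho <= (turns (dig x) n)%:~R.
Proof.
have [||x Gx h] := exists_le_average (M := n%:R * dig_bound) negligible_bad _ _ (integral_turnsN n).
- by exact: (measurableT_comp (@oppr_measurable R setT) (measurable_turns n)).
- by move=> x; rewrite normrN turns_bound.
by exists x => //; rewrite -lerN2.
Qed.

Lemma rotation_number_bound : `|rho| <= dig_bound.
Proof.
have [x _ hx] := exists_turns_le 1; have [y _ hy] := exists_turns_ge 1.
move: (turns_bound x 1) (turns_bound y 1) hx hy; rewrite !mul1r => /ler_normlP[x1 x2] /ler_normlP[y1 y2] hx hy.
by apply/ler_normlP; split; lra.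
Qed.

(** One point has to serve all [j <= n]. Since [turns] is monotone in the initial position, the
    leftmost of the points found for the individual [j] will do. *)
Lemma exists_low n : exists2 x, good x & forall j, (j <= n)%N -> (turns (dig x) j)%:~R <= j%:R * rho.
Proof.
elim: n => [|n [x Gx hx]].
  by have [x Gx h] := exists_turns_le 0; exists x => // j; rewrite leqn0 => /eqP ->.
have [y Gy hy] := exists_turns_le n.+1.
have [xy|/ltW yx] := leP (pos x 0) (pos y 0).
  exists x => // j; rewrite leq_eqVlt => /predU1P[->|]; last exact: hx.
  by apply: le_trans hy; rewrite ler_int; apply: (turns_le hq _ (good_coded Gx) (good_coded Gy)).
exists y => // j; rewrite leq_eqVlt => /predU1P[->//|jn]; apply: le_trans (hx j jn).
by rewrite ler_int; apply: (turns_le hq _ (good_coded Gy) (good_coded Gx)).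
Qed.

(** Dually, the rightmost point is kept. *)
Lemma exists_high n : exists2 x, good x & forall j, (j <= n)%N -> j%:R * rho <= (turns (dig x) j)%:~R.
Proof.
elim: n => [|n [x Gx hx]].
  by have [x Gx h] := exists_turns_ge 0; exists x => // j; rewrite leqn0 => /eqP ->.
have [y Gy hy] := exists_turns_ge n.+1.
have [xy|/ltW yx] := leP (pos x 0) (pos y 0).
  exists y => // j; rewrite leq_eqVlt => /predU1P[->//|jn]; apply: le_trans (hx j jn) _.
  by rewrite ler_int; apply: (turns_le hq _ (good_coded Gx) (good_coded Gy)).
exists x => // j; rewrite leq_eqVlt => /predU1P[->|]; last exact: hx.
by apply: le_trans hy _; rewrite ler_int; apply: (turns_le hq _ (good_coded Gy) (good_coded Gx)).
Qed.

Lemma irrational_approx n : (forall j, (0 < j)%N -> j%:R * rho \isn't a Num.int) ->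
  `|g - sturmian_sum q rho n.+1| <= (`|g| + 2) * r ^+ n.+1.
Proof.
move=> irr; have [x Gx hx] := exists_low n.+1; have [y Gy hy] := exists_high n.+1.
apply: (sturmian_approx hq (good_coded Gx) (good_coded Gy) _ hx hy) => j /andP[j0 _].
rewrite lt_neqAle floor_le andbT -intrEfloor; exact: irr.
Qed.

End Rotation.

Section RationalRotation.
Variables (R : realType) (q : nat).
Hypothesis hq : (2 <= q)%N.
Variables (g : R) (mu : probability R R).
Hypothesis inv : Tinvariant q mu.
Hypothesis arc : mu [set x | frac (x - g) <= q%:R^-1] = 1%E.

Local Notation rho := (rotation_number q g mu).
Local Notation pos := (pos q g).
Local Notation dig := (dig q g).
Local Notation good := (good q g).

Variables (n : nat) (p : int).
Hypothesis n0 : (0 < n)%N.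
Hypothesis rho_np : n%:R * rho = p%:~R.

Lemma pos_iter x k j : pos (iter k (Tq q) x) j = pos x (k + j).
Proof. by elim: k j => // k ih j; rewrite iterS pos_Tq ih addnS. Qed.

Lemma dig_iter x k j : dig (iter k (Tq q) x) j = dig x (k + j).
Proof. by rewrite /dig pos_iter. Qed.

Lemma frac_eq_int (x y : R) : frac x = frac y -> exists m : int, x = y + m%:~R.
Proof. by move=> e; exists (Num.floor x - Num.floor y); rewrite intrB; move: e; rewrite /frac; lra. Qed.

Lemma pos_inj x y : 0 <= x -> x < 1 -> 0 <= y -> y < 1 -> pos x 0 = pos y 0 -> x = y.
Proof.
move=> x0 x1 y0 y1; rewrite /pos !mul1r => /frac_eq_int[m e].
rewrite -(frac_small x0 x1) -(frac_small y0 y1); apply: (@frac_eqz _ _ _ m); lra.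
Qed.

(** Between good points the values of [turns] differ by at most [1]. So either all are at least [p],
    or one is below [p] and then all are at most [p]; in both cases the mean [p] is extremal. *)
Lemma negligible_turns : mu.-negligible [set x | turns (dig x) n <> p].
Proof.
have nb := negligible_bad inv arc.
have [h|/existsNP[x /not_implyP[Gx /negP]]] := pselect (forall x, good x -> p <= turns (dig x) n).
  have := negligible_above_average (M := n%:R * dig_bound q g) nb (measurable_turns q g n)
    ((turns_bound hq g)^~ n) (integral_turns hq g inv n).
  rewrite rho_np => H; apply: negligibleS (H _) => [x /= ne e|x Gx]; last by rewrite ler_int h.
  by apply: ne; apply/eqP; rewrite -(eqr_int R) e.
rewrite -ltNge => xp.
have h y : good y -> turns (dig y) n <= p.
  move=> Gy; apply: le_trans (turns_le1 hq n (good_coded Gy) (good_coded Gx)) _.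
  by rewrite lezD1.
have := negligible_above_average (M := n%:R * dig_bound q g) nb
  (measurableT_comp (@oppr_measurable R setT) (measurable_turns q g n)) _ (integral_turnsN hq g inv n).
rewrite rho_np => H; apply: negligibleS (H _ _) => [y /= ne e|y|y Gy].
- by apply: ne; apply/eqP; rewrite -(eqr_int R) -eqr_opp e.
- by rewrite normrN; exact: turns_bound.
- by rewrite lerN2 ler_int h.
Qed.

Lemma iter_full (A : set R) k : measurable A -> mu A = 1%E ->
  measurable [set x | A (iter k (Tq q) x)] /\ mu [set x | A (iter k (Tq q) x)] = 1%E.
Proof.
move=> mA A1; elim: k => // k [mk k1].
have e : [set x | A (iter k.+1 (Tq q) x)] = Tq q @^-1` [set x | A (iter k (Tq q) x)].
  by apply/seteqP; split => x /=; rewrite -iterS iterSr.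
rewrite e; split; last by rewrite inv.2.
by rewrite -[X in measurable X]setTI; apply: measurable_Tq.
Qed.

Definition periodic_good : set R :=
  [set x | [/\ 0 <= x, x < 1, good x & forall k, turns (fun i => dig x (k + i)%N) n = p]].

Lemma negligible_not_periodic : mu.-negligible (~` periodic_good).
Proof.
pose A : set R := [set x | turns (dig x) n = p].
have mA : measurable A.
  have -> : A = (fun x => (turns (dig x) n)%:~R : R) @^-1` [set p%:~R].
    by apply/seteqP; split => x /= => [->//|/eqP]; rewrite eqr_int => /eqP.
  by rewrite -[X in measurable X]setTI; apply: measurable_turns.
have A1 : mu A = 1%E.
  by apply: full_negligible => //; apply: negligibleS negligible_turns.
have nA : mu.-negligible (\bigcup_k ~` [set x | A (iter k (Tq q) x)]).
  by apply: negligible_bigcup => k; have [mk k1] := iter_full k mA A1; exact: negligible_full.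
have n01 : mu.-negligible (~` [set` `[0%R, 1%R[]) by apply: negligible_full => //; exact: inv.1.
have := negligibleU (negligibleU n01 (negligible_bad inv arc)) nA.
apply: negligibleS => x; apply: contra_notP => /not_orP[/not_orP[/contrapT]].
rewrite /= in_itv/= => /andP[x0 x1] /contrapT Gx nx; split => // k.
apply: contrapT => ne; apply: nx; exists k => //= e; apply: ne.
by rewrite -e /turns; apply: eq_bigr => i _; rewrite dig_iter.
Qed.

Lemma periodic_good_iter x k : periodic_good x -> periodic_good (iter k (Tq q) x).
Proof.
move=> [x0 x1 Gx px]; rewrite /periodic_good/= iter_TqE//; split; [exact: frac_ge0|exact: frac_lt1| |].
  by move=> j; rewrite -iter_TqE// pos_iter; exact: Gx.
move=> j; rewrite -iter_TqE// -(px (k + j)%N) /turns; apply: eq_bigr => i _.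
by rewrite dig_iter addnA.
Qed.

Lemma periodic_good_periodic x : periodic_good x -> iter n (Tq q) x = x.
Proof.
move=> Px; have [x0 x1 Gx px] := Px; have [y0 y1 _ _] := periodic_good_iter n Px.
apply: pos_inj => //; rewrite pos_iter addn0.
exact: (position_periodic hq (good_coded Gx) px).
Qed.

(** By [turns_min] the leftmost point of each of these periodic orbits has digits depending on
    [p / n] alone, and digits determine the point, so all the orbits coincide. *)
Lemma rational_periodic : periodic_orbit_supported q mu.
Proof.
have [x0 Px0] : exists x, periodic_good x.
  apply: contrapT => ne; apply: (@negligible_setT _ mu).
  by apply: negligibleS negligible_not_periodic => x _ Px; apply: ne; exists x.
have min x : periodic_good x -> exists2 k, (k < n)%N & forall j,
    turns (dig (iter k (Tq q) x)) j = Num.floor (j%:R * (p%:~R / n%:R) : R).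
  move=> [_ _ Gx px]; have [k kn h] := turns_min hq n0 (good_coded Gx) px.
  by exists k => // j; rewrite -h /turns; apply: eq_bigr => i _; rewrite dig_iter.
have [k0 _ h0] := min _ Px0; pose z := iter k0 (Tq q) x0.
have Pz : periodic_good z by exact: periodic_good_iter.
have orb x : periodic_good x -> exists2 k, (k < n)%N & x = iter k (Tq q) z.
  move=> Px; have [k kn h] := min _ Px; have Py := periodic_good_iter k Px.
  have e : iter k (Tq q) x = z.
    have [y0 y1 Gy _] := Py; have [z0 z1 Gz _] := Pz.
    apply: pos_inj => //; apply: (coded_rigid hq (good_coded Gy) (good_coded Gz)) => j.
    by apply: (@addrI _ (turns (dig z) j)); rewrite -turnsS h0 -h -turnsS h h0.
  case: k kn {h Py} e => [|k] kn e; first by exists 0%N.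
  exists (n - k.+1)%N; first by rewrite ltn_subrL n0.
  by rewrite -e -iterD subnK ?(ltnW kn)// periodic_good_periodic.
exists z, n; split => //; split; first exact: periodic_good_periodic.
apply: full_negligible.
  have -> : [set iter k (Tq q) z | k in [set k | (k < n)%N]] =
      \bigcup_(k in [set k | (k < n)%N]) [set iter k (Tq q) z].
    apply/seteqP; split => [_ [k kn <-]|x [k kn ->]]; first by exists k.
    by exists k.
  by apply: bigcup_measurable.
apply: negligibleS negligible_not_periodic => x; apply: contra_not => Px.
by have [k kn ->] := orb x Px; exists k.
Qed.

End RationalRotation.

(** * Covers of the parameter set *)

Section SmallCovers.
Variable R : realType.
Implicit Types (x s d e K : R) (E U : set R).

(** With [t = - ln x], the power [x^N] is the inverse cube of [exp (N t / 3) >= 1 + N t / 3 >= m (N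
    + 1)], and a cube beats the square. *)
Lemma square_geometric_small K x e : 0 < x -> x < 1 -> 0 < e ->
  exists N0, forall N, (N0 <= N)%N -> K * N.+1%:R ^+ 2 * x ^+ N <= e.
Proof.
move=> x0 x1 e0; pose t := - ln x; have t0 : 0 < t by rewrite oppr_gt0 ln_lt0// x0.
pose m := Num.min 1 (t / 3).
have m0 : 0 < m by rewrite lt_min ltr01 divr_gt0.
have m1 : m <= 1 by rewrite ge_min lexx.
have mt : m <= t / 3 by rewrite ge_min lexx orbT.
exists (Num.truncn (`|K| / (m ^+ 3 * e))).+1 => N hN.
have hNR : `|K| / (m ^+ 3 * e) <= N.+1%:R.
  by apply/ltW; apply: lt_le_trans (truncnS_gt _) _; rewrite ler_nat leqW.
have xE : x ^+ N = (expR (N%:R * (t / 3)) ^+ 3)^-1.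
  rewrite -expRM_natl -expRN -[in LHS](lnK (x0 : x \is Num.pos)) -expRM_natl; congr expR.
  by rewrite /t; field.
have big : (m * N.+1%:R) ^+ 3 <= expR (N%:R * (t / 3)) ^+ 3.
  have N0 : 0 <= N%:R :> R by rewrite ler0n.
  have M0 : 0 <= m * N.+1%:R by rewrite mulr_ge0 ?ler0n// ltW.
  apply: lerXn2r => //; rewrite ?nnegrE ?expR_ge0//.
  apply: le_trans (expR_ge1Dx _); rewrite -natr1 mulrDr mulr1 addrC lerD//.
  by rewrite mulrC ler_wpM2l.
have S0 : 0 < N.+1%:R :> R by rewrite ltr0n.
have X0 : 0 < expR (N%:R * (t / 3)) ^+ 3 by rewrite exprn_gt0// expR_gt0.
rewrite xE ler_pdivrMr//; apply: (@le_trans _ _ (`|K| * N.+1%:R ^+ 2)).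
  by rewrite ler_wpM2r ?exprn_ge0 ?ler0n// ler_norm.
apply: (@le_trans _ _ (e * (m * N.+1%:R) ^+ 3)); last by rewrite ler_pM2l.
move: hNR; rewrite ler_pdivrMr ?mulr_gt0 ?exprn_gt0// => hNR.
have -> : e * (m * N.+1%:R) ^+ 3 = N.+1%:R * (m ^+ 3 * e) * N.+1%:R ^+ 2 by ring.
by rewrite ler_wpM2r ?exprn_ge0 ?ler0n.
Qed.

Definition closed_interval x d : set R := [set y | `|y - x| <= d].

Lemma hcontrib_ge0 s U : 0 <= hcontrib s U.
Proof. by rewrite /hcontrib; case: pselect => //= ?; exact: powR_ge0. Qed.

Lemma hcontrib0 s : hcontrib s (set0 : set R) = 0.
Proof. by rewrite /hcontrib; case: pselect => //= /(_ erefl). Qed.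

Lemma closed_interval_dist x d y z : closed_interval x d y -> closed_interval x d z -> `|y - z| <= 2 * d.
Proof.
rewrite /closed_interval/= => hy; rewrite distrC => hz.
have := ler_normD (y - x) (x - z); rewrite addrA subrK; lra.
Qed.

Lemma hcontrib_interval s x d : 0 <= s -> hcontrib s (closed_interval x d) <= (2 * d) `^ s.
Proof.
move=> s0; rewrite /hcontrib; case: pselect => /= [_|/eqP/set0P[y hy]]; first exact: powR_ge0.
set I := closed_interval x d; rewrite /diam; set A := [set `|y - z| | y in I & z in I].
have A0 : A 0 by exists y => //; exists y => //; rewrite subrr normr0.
have Aub : ubound A (2 * d) by move=> _ [u hu [w hw <-]]; exact: closed_interval_dist hu hw.
have A2 : sup A <= 2 * d by apply: ge_sup => //; exists 0.
have Ap : 0 <= sup A by apply: ub_le_sup => //; exists (2 * d).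
apply: ge0_ler_powR => //; rewrite ?nnegrE//.
exact: le_trans Ap A2.
Qed.

Lemma nneseries_finite_le (u : nat -> R) (n : nat) (b : R) : (forall j, 0 <= u j) -> 0 <= b ->
  (forall j, (j < n)%N -> u j <= b) -> (forall j, (n <= j)%N -> u j = 0) ->
  (\sum_(0 <= j <oo) (u j)%:E <= (n%:R * b)%:E)%E.
Proof.
move=> u0 b0 ub uz; apply: lime_le.
  by apply: is_cvg_nneseries => j _ _; rewrite lee_fin.
apply: nearW => m; rewrite sumEFin lee_fin.
have h : \sum_(0 <= j < m) u j <= (minn m n)%:R * b.
  elim: m => [|m ih]; first by rewrite big_geq// mulr_ge0.
  rewrite big_nat_recr//=; have [nm|mn] := leqP n m.
    by rewrite uz// addr0; apply: le_trans ih _; rewrite ler_wpM2r// ler_nat; lia.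
  have -> : minn m.+1 n = (minn m n).+1 by lia.
  by rewrite -natr1 mulrDl mul1r lerD// ub.
by apply: le_trans h _; rewrite ler_wpM2r// ler_nat geq_minr.
Qed.

Lemma nneseries_pair_le (h : nat -> nat -> R) (f : nat -> nat * nat) (b : nat -> R) :
  set_bij [set: nat] [set: nat * nat] f -> (forall i j, 0 <= h i j) ->
  (forall i, \sum_(0 <= j <oo) (h i j)%:E <= (b i)%:E)%E ->
  (\sum_(0 <= k <oo) (h (f k).1 (f k).2)%:E <= \sum_(0 <= i <oo) (b i)%:E)%E.
Proof.
move=> bf h0 hb.
rewrite nneseries_esumT; last by move=> k; rewrite lee_fin.
rewrite -(@reindex_esum _ _ _ _ _ f (fun k => (h k.1 k.2)%:E) bf).
have -> : [set: nat * nat] = [set: nat] `*`` (fun=> [set: nat]) by apply/seteqP; split => x.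
rewrite -(@esum_esum _ _ _ _ _ (fun i j => (h i j)%:E)); last by move=> i j _ _; rewrite lee_fin.
have b0 i : (0 <= (b i)%:E)%E.
  by apply: le_trans (hb i); apply: nneseries_ge0 => j _ _; rewrite lee_fin.
rewrite [leRHS]nneseries_esumT//; apply: le_esum => i _.
by rewrite -nneseries_esumT ?hb// => j; rewrite lee_fin.
Qed.

Variable E : set R.
Hypothesis cov : forall L : nat, exists (C : R) (B : nat), forall N, exists x : nat -> R,
  forall c, E c -> `|c| <= L%:R -> exists2 k, (k < B * N.+1 ^ 2)%N & `|c - x k| <= C * 2^-1 ^+ N.

(** A ball inside [E] contains [n + 1] points spaced by [d / (n + 1)], more than there are
    intervals. Two of them share one, so the spacing is [O(2^-N)], although [n] is only [O(N^2)]. *)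
Lemma small_cover_interior : interior E = set0.
Proof.
apply/seteqP; split => // c0 /nbhs_ballP[d /= d0 dE].
have [C [B HC]] := cov (Num.truncn (`|c0| + d)).+1.
(* [B + 1] absorbs the extra point: [n + 1 <= (B + 1) (N + 1)^2]. *)
have [N0 HN] := @square_geometric_small (2 * C * (B%:R + 1)) 2^-1 (d / 2) ltac:(lra) ltac:(lra) ltac:(lra).
have [x Hx] := HC N0; pose n := (B * N0.+1 ^ 2)%N.
pose y (i : nat) := c0 + i%:R * (d / n.+1%:R).
have nR : 0 < n.+1%:R :> R by rewrite ltr0n.
have dn : 0 < d / n.+1%:R by rewrite divr_gt0.
have yd (i : 'I_n.+1) : `|y i - c0| < d.
  have p : 0 <= i%:R * (d / n.+1%:R) by rewrite mulr_ge0 ?ler0n// ltW.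
  rewrite /y addrC addKr (ger0_norm p) mulrA ltr_pdivrMr// mulrC ltr_pM2l//.
  by rewrite ltr_nat.
have Ey : forall i : 'I_n.+1, exists2 k, (k < n)%N & `|y i - x k| <= C * 2^-1 ^+ N0.
  move=> i.
  apply: Hx; first by apply: dE; rewrite /ball/= distrC yd.
  apply: (@le_trans _ _ (`|c0| + d)).
    have := ler_normD c0 (y i - c0); rewrite addrC subrK => /le_trans; apply.
    by rewrite lerD2l ltW.
  by apply/ltW; exact: truncnS_gt.
have [f Hf] : {f : 'I_n.+1 -> 'I_n & forall i : 'I_n.+1, `|y i - x (f i)| <= C * 2^-1 ^+ N0}.
  apply: (@choice _ _ (fun (i : 'I_n.+1) (k : 'I_n) => `|y i - x k| <= C * 2^-1 ^+ N0)) => i.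
  by have [k kn hk] := Ey i; exists (Ordinal kn).
have : ~~ injectiveb f by apply/injectiveP => /leq_card; rewrite !card_ord ltnn.
move=> /injectivePn[i [j ij fij]].
have := closed_interval_dist (Hf i) (_ : closed_interval (x (f i)) _ (y j)).
rewrite {1}fij => /(_ (Hf j)).
have -> : y i - y j = (i%:R - j%:R) * (d / n.+1%:R) by rewrite /y; ring.
rewrite normrM (gtr0_norm dn) => hd.
have ij1 : 1 <= `|i%:R - j%:R : R|.
  have : i != j :> nat by [].
  rewrite neq_ltn => /orP[lt|lt]; [rewrite distrC|];
  by rewrite ger0_norm ?subr_ge0 ?ler_nat ?(ltnW lt)// lerBrDl natr1 ler_nat.
have h1 : d / n.+1%:R <= 2 * (C * 2^-1 ^+ N0).
  by apply: le_trans hd; rewrite ler_peMl// ltW.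
have C0 : 0 <= C * 2^-1 ^+ N0 by apply: le_trans (Hf i); exact: normr_ge0.
have := HN N0 (leqnn _).
suff : d <= 2 * C * (B%:R + 1) * N0.+1%:R ^+ 2 * 2^-1 ^+ N0 by lra.
move: h1; rewrite ler_pdivrMr// => /le_trans; apply.
have -> : 2 * C * (B%:R + 1) * N0.+1%:R ^+ 2 * 2^-1 ^+ N0 = 2 * (C * 2^-1 ^+ N0) * ((B%:R + 1) * N0.+1%:R ^+ 2) by ring.
apply: ler_wpM2l; first by rewrite mulr_ge0.
by rewrite natr1 -natrX -natrM ler_nat mulSn /n -addn1 addnC leq_add2r expn_gt0.
Qed.

(** The part of [E] in [[-L, L]] is covered at cost [e / 2^(L+1)], which is possible since
    [(N + 1)^2 (2^-s)^N] tends to [0] for [s > 0]. A bijection between [nat] and its square merges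
    these families. *)
Lemma hausdorff_pre_small s d e : 0 < s -> 0 < d -> 0 < e -> (hausdorff_pre s d E <= e%:E)%E.
Proof.
move=> s0 d0 e0.
have [G HG] : {G : nat -> nat -> set R & forall L, [/\
    forall c, E c -> `|c| <= L%:R -> exists k, G L k c,
    forall k y z, G L k y -> G L k z -> `|y - z| <= d &
    (\sum_(0 <= k <oo) (hcontrib s (G L k))%:E <= (e / (2 ^ L.+1)%:R)%:E)%E]}.
  apply: (@choice _ _ (fun L (G : nat -> set R) => [/\
    forall c, E c -> `|c| <= L%:R -> exists k, G k c,
    forall k y z, G k y -> G k z -> `|y - z| <= d &
    (\sum_(0 <= k <oo) (hcontrib s (G k))%:E <= (e / (2 ^ L.+1)%:R)%:E)%E])) => L.
  have [C [B HC]] := cov L.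
  have e1 : 0 < e / (2 ^ L.+1)%:R by rewrite divr_gt0// ltr0n expn_gt0.
  have h0 : 0 < 2^-1 `^ s :> R by rewrite powR_gt0.
  have h1 : 2^-1 `^ s < 1 :> R.
    have e1s : (1 : R) `^ s = 1 by rewrite powR1.
    by rewrite -[ltRHS]e1s; apply: gt0_ltr_powR; rewrite ?nnegrE; lra.
  have [N1 H1] := square_geometric_small (B%:R * (2 * `|C|) `^ s) h0 h1 e1.
  have [N2 H2] := @square_geometric_small (2 * `|C|) 2^-1 d ltac:(lra) ltac:(lra) d0.
  pose N := maxn N1 N2; have [x Hx] := HC N; pose n := (B * N.+1 ^ 2)%N.
  have {}H1 := H1 N (leq_maxl _ _); have {}H2 := H2 N (leq_maxr _ _).
  pose rad := `|C| * 2^-1 ^+ N.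
  have hN0 : 0 <= 2^-1 ^+ N :> R by rewrite exprn_ge0// invr_ge0.
  have rad0 : 0 <= rad by rewrite mulr_ge0.
  (* The finite family is padded with empty sets, which contribute [0]. *)
  exists (fun k => if (k < n)%N then closed_interval (x k) rad else set0); split.
  - move=> c Ec cL; have [k kn hk] := Hx c Ec cL; exists k; rewrite kn.
    by rewrite /closed_interval/=; apply: le_trans hk _; rewrite ler_wpM2r// ler_norm.
  - move=> k y z; case: ifP => // _ hy hz; apply: le_trans (closed_interval_dist hy hz) _.
    apply: le_trans H2; rewrite /rad mulrA ler_wpM2r// ler_peMr ?mulr_ge0//.
    by rewrite exprn_ege1// ler1n.
  - apply: (@le_trans _ _ (n%:R * ((2 * rad) `^ s))%:E).
      apply: nneseries_finite_le; [by move=> j; exact: hcontrib_ge0 | exact: powR_ge0 | |].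
        by move=> j jn; rewrite jn; apply: hcontrib_interval; exact: ltW.
      by move=> j; rewrite leqNgt => /negbTE ->; exact: hcontrib0.
    rewrite lee_fin; apply: le_trans H1; rewrite /rad mulrA powRM//.
    rewrite -[in leLHS]powR_mulrn ?invr_ge0// -powRrM [N%:R * s]mulrC powRrM powR_mulrn ?powR_ge0//.
    by rewrite /n natrM natrX le_eqVlt; apply/orP; left; apply/eqP; ring.
have /card_esym/ppcard_eqP[f] := card_nat2.
apply: (@le_trans _ _ (\sum_(0 <= k <oo) (hcontrib s (G (f k).1 (f k).2))%:E)%E); last first.
  apply: le_trans (nneseries_pair_le (h := fun i j => hcontrib s (G i j))
    (b := fun L => e / (2 ^ L.+1)%:R) _ _ _) _.
  - by [].
  - by move=> i j; exact: hcontrib_ge0.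
  - by move=> L; have [_ _] := HG L.
  - by apply: epsilon_trick0; exact: ltW.
apply: ereal_inf_lbound; exists (fun k => G (f k).1 (f k).2) => //; split.
  move=> c Ec; pose L := (Num.truncn `|c|).+1.
  have [HL _ _] := HG L; have [|k Gk] := HL c Ec; first by apply/ltW; exact: truncnS_gt.
  exists (f^-1%FUN (L, k)) => //=; by rewrite invK ?inE.
by move=> k y z; have [_ H _] := HG (f k).1; exact: H.
Qed.

Lemma small_cover_measure s : 0 < s -> hausdorff_measure s E = 0%E.
Proof.
move=> s0; have pre_ge0 d : (0 <= hausdorff_pre s d E)%E.
  apply: le_ereal_inf_tmp => _ [U _ <-]; apply: nneseries_ge0 => i _ _.
  by rewrite lee_fin hcontrib_ge0.
apply/eqP; rewrite eq_le; apply/andP; split.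
  apply: ge_ereal_sup => _ [d d0 <-]; apply/lee_addgt0Pr => e e0; rewrite add0e.
  exact: hausdorff_pre_small.
apply: le_trans (pre_ge0 1) _; apply: ereal_sup_ubound; exists 1 => //=; exact: ltr01.
Qed.

Lemma small_cover_dim : hausdorff_dim E = 0%E.
Proof.
apply/eqP; rewrite eq_le; apply/andP; split.
  apply/lee_addgt0Pr => e e0; rewrite add0e; apply: ereal_inf_lbound; exists e => //.
  by split; [exact: ltW | exact: small_cover_measure].
by apply: le_ereal_inf_tmp => _ [s [s0 _] <-]; rewrite lee_fin.
Qed.

End SmallCovers.

(** * Counting the parameters *)

Section ParameterCover.
Variables (R : realType) (q : nat).
Hypothesis hq : (2 <= q)%N.
Implicit Types (a c e g rho : R).

Local Notation r := (@GRing.inv R q%:R).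

(* The arc starts at [g = - a - c], so that [- g - c] is the parameter [a] of [kapF]. *)
Definition sturmian_parameter e c g rho :=
  [/\ e <= - g - c, - g - c <= r - e, kapF q (- g - c) ((q%:R - 1) * g) = 0,
     `|rho| <= dig_bound q g &
      forall n, `|g - sturmian_sum q rho n.+1| <= (`|g| + 2) * r ^+ n.+1].

Lemma Pset_sturmian : exists2 e, 0 < e < r / 2 &
  forall c, Pset q c -> exists g rho, sturmian_parameter e c g rho.
Proof.
have [e e12 He] := maximizing_sturmian R hq; exists e => // c [mu [mx np]].
have [a [ea ae k0 arc]] := He c mu mx; have [inv _] := mx.
pose g := - a - c; exists g, (rotation_number q g mu).
have {}arc : mu [set x | frac (x - g) <= r] = 1%E.
  rewrite -[RHS]arc; congr (mu _); apply/funext => x /=.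
  by rewrite (_ : x - g = x + a + c)// /g; ring.
have ag : - g - c = a by rewrite /g; ring.
split; rewrite ?ag//; first exact: (rotation_number_bound hq inv arc).
move=> n; apply: (irrational_approx hq inv arc) => j j0; apply/negP => /intrP[p hp].
exact/np/(rational_periodic hq inv arc j0 hp).
Qed.

(* Each term is monotone in [rho], so this single integer of size O(n^2) determines all of them. *)
Definition floor_sum rho n : int := \sum_(i < n) Num.floor (i.+1%:R * rho).

Lemma floor_sum_inj rho rho' n j : floor_sum rho n = floor_sum rho' n -> (j <= n)%N ->
  Num.floor (j%:R * rho) = Num.floor (j%:R * rho').
Proof.
have main s s' : s <= s' -> floor_sum s n = floor_sum s' n -> (j <= n)%N ->
    Num.floor (j%:R * s) = Num.floor (j%:R * s').
  move=> ss /eqP; rewrite eq_sym -subr_eq0 /floor_sum -sumrB => /eqP e.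
  case: j => [|j] jn; first by rewrite !floorM0.
  apply/eqP; rewrite eq_sym -subr_eq0; apply/eqP.
  move/psumr_eq0P: e => /(_ _ (Ordinal jn) isT); apply => i _.
  by rewrite subr_ge0 le_floor// ler_wpM2l.
have [h|/ltW h] := leP rho rho'; first exact: main.
by move=> /esym e jn; apply/esym/(main _ _ h e jn).
Qed.

Lemma floor_sum_bound rho n (B : nat) : `|rho| <= B%:R -> `|floor_sum rho n| <= (n * (n * B))%:Z.
Proof.
move=> /ler_normlP[r1 r2]; apply: le_trans (ler_norm_sum _ _ _) _.
have -> : (n * (n * B))%:Z = \sum_(i < n) (n * B)%:Z.
  by rewrite sumr_const card_ord -mulr_natl natz PoszM.
apply: ler_sum => i _; apply: (@le_trans _ _ (i.+1 * B)%:Z); last by rewrite lez_nat leq_mul2r ltn_ord orbT.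
have i0 : 0 <= i.+1%:R :> R by rewrite ler0n.
apply/ler_normlP; split.
  rewrite lerNl floor_ge_int intrN -pmulrn natrM -mulrN ler_wpM2l//; lra.
rewrite -(ler_int R) -pmulrn natrM; apply: le_trans (floor_le _) _.
by rewrite ler_wpM2l.
Qed.

(** With [h = 2^-(N+1)], equal floors up to [2 (N + 1)] give [|g - g'| = O(h^2)]. In [root_modulus]
    with [n = N + 1] this is multiplied by [1 / h], so both terms there are [O(h)]. *)
Lemma sturmian_parameter_close e (L : nat) : 0 < e -> e < r / 2 -> exists C : R, forall N c c' g g' rho rho',
  `|c| <= L%:R -> `|c'| <= L%:R -> sturmian_parameter e c g rho -> sturmian_parameter e c' g' rho' ->
  floor_sum rho (2 * N.+1) = floor_sum rho' (2 * N.+1) -> `|c - c'| <= C * 2^-1 ^+ N.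
Proof.
move=> e0 e1; have [C HC] := root_modulus hq e0 e1.
have q2 := natq_ge2 R hq; have r0 := invq_gt0 R hq; have r2 := invq_le2 R hq.
(* [|g|] and [|g'|] are at most [L + 1], so each of [g] and [g'] is within [(L + 3) h^2] of the
   common Sturmian sum. *)
pose D : R := 2 * (L%:R + 3); pose C' := `|C| * ((q%:R - 1) * D + 1) + D.
have L0 : 0 <= L%:R :> R by rewrite ler0n.
have D0 : 0 <= D by rewrite /D; lra.
exists C' => N c c' g g' rho rho' cL cL' [ea ae k0 _ ap] [ea' ae' k0' _ ap'] fs.
have gL x y : `|x| <= L%:R -> e <= - y - x -> - y - x <= r - e -> `|y| <= L%:R + 1.
  by move=> /ler_normlP[x1 x2] y1 y2; apply/ler_normlP; split; lra.
pose h : R := 2^-1 ^+ N.+1.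
have h0 : 0 <= h by rewrite exprn_ge0// invr_ge0.
have hN : h <= 2^-1 ^+ N by rewrite /h exprS ler_piMl ?exprn_ge0// ?invr_ge0//; lra.
have h1 : h <= 1 by rewrite exprn_ile1//; lra.
have n2 : (2 * N.+1 = (2 * N).+1.+1)%N by rewrite mulnS.
have rn : r ^+ (2 * N.+1) <= h ^+ 2.
  have r12 : r <= 2^-1 by lra.
  by rewrite /h -exprM mulnC lerXn2r// nnegrE ?invr_ge0// ltW.
have near x y s : `|x| <= L%:R -> e <= - y - x -> - y - x <= r - e ->
    (forall n, `|y - sturmian_sum q s n.+1| <= (`|y| + 2) * r ^+ n.+1) ->
    `|y - sturmian_sum q s (2 * N.+1)| <= (L%:R + 3) * h ^+ 2.
  move=> xL y1 y2 H; have yL := gL x y xL y1 y2.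
  have := H (2 * N).+1; rewrite -n2 => /le_trans; apply.
  by apply: ler_pM => //; lra.
have S : sturmian_sum q rho (2 * N.+1) = sturmian_sum q rho' (2 * N.+1).
  by apply: eq_bigr => i _; rewrite !(floor_sum_inj fs)//; exact: ltnW.
have gg : `|g - g'| <= D * h ^+ 2.
  have := near _ _ _ cL ea ae ap; have := near _ _ _ cL' ea' ae' ap'; rewrite S /D.
  move: (sturmian_sum _ _ _) (h ^+ 2) => z w /ler_normlP[z1 z2] /ler_normlP[z3 z4].
  by apply/ler_normlP; split; lra.
have th : `|(q%:R - 1) * g - (q%:R - 1) * g'| <= (q%:R - 1) * D * h ^+ 2.
  rewrite -mulrBr normrM ger0_norm; last by lra.
  by rewrite -mulrA ler_wpM2l//; lra.
have aa : `|(- g - c) - (- g' - c')| <= `|C| * ((q%:R - 1) * D + 1) * h.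
  apply: le_trans (HC _ _ _ _ N.+1 ea ae ea' ae' k0 k0') _.
  rewrite -/h; apply: (@le_trans _ _ (`|C| * (2 ^+ N.+1 * ((q%:R - 1) * D * h ^+ 2) + h))).
    apply: (@le_trans _ _ (`|C| * (2 ^+ N.+1 * `|(q%:R - 1) * g - (q%:R - 1) * g'| + h))).
      by rewrite ler_wpM2r ?ler_norm// addr_ge0// mulr_ge0// exprn_ge0.
    by rewrite ler_wpM2l// lerD2r ler_wpM2l// exprn_ge0.
  have e2 : 2 ^+ N.+1 * h = 1 by rewrite /h -exprMn mulfV ?expr1n// pnatr_eq0.
  have -> : 2 ^+ N.+1 * ((q%:R - 1) * D * h ^+ 2) = (2 ^+ N.+1 * h) * ((q%:R - 1) * D * h) by ring.
  by rewrite e2 le_eqVlt; apply/orP; left; apply/eqP; ring.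
have Dh : D * h ^+ 2 <= D * h by rewrite ler_wpM2l// expr2 ler_piMl.
have C0 : 0 <= C'.
  by rewrite /C' addr_ge0// mulr_ge0// addr_ge0// mulr_ge0//; lra.
apply: (@le_trans _ _ (C' * h)); last by rewrite ler_wpM2l.
rewrite /C' mulrDl; move: aa gg => /ler_normlP[a1 a2] /ler_normlP[g1 g2].
by apply/ler_normlP; split; lra.
Qed.

Lemma dig_bound_le (L : nat) g : `|g| <= L%:R + 1 -> dig_bound q g <= (q * (L + 3))%:R.
Proof.
move=> gL; have q2 := natq_ge2 R hq; have L0 : 0 <= L%:R :> R by rewrite ler0n.
rewrite /dig_bound normrM ger0_norm; last by lra.
have : (q%:R - 1) * `|g| <= (q%:R - 1) * (L%:R + 1) by rewrite ler_wpM2l//; lra.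
by rewrite natrM natrD; lra.
Qed.

Lemma absz_shift_inj (x y : int) (m : nat) : `|x| <= m%:Z -> `|y| <= m%:Z ->
  absz (x + m%:Z) = absz (y + m%:Z) -> x = y.
Proof. lia. Qed.

Lemma absz_shift_le (x : int) (m : nat) : `|x| <= m%:Z -> (absz (x + m%:Z)%R <= m + m)%N.
Proof. lia. Qed.

(** The value of [floor_sum], shifted to a natural number, indexes the intervals; each is centred at
    an arbitrary parameter with that index, if there is one. *)
Lemma Pset_cover (L : nat) : exists (C : R) (B : nat), forall N, exists x : nat -> R,
  forall c, Pset q c -> `|c| <= L%:R -> exists2 k, (k < B * N.+1 ^ 2)%N & `|c - x k| <= C * 2^-1 ^+ N.
Proof.
have [e /andP[e0 e1] He] := Pset_sturmian.
have [C HC] := sturmian_parameter_close L e0 e1.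
have r2 := invq_le2 R hq.
(* [A] bounds the rotation number, so the index is at most [2 n^2 A], which is [8 A (N + 1)^2]; the
   [+ 1] makes the inequality strict. *)
pose A := (q * (L + 3))%N; exists C, (8 * A + 1)%N => N; pose n := (2 * N.+1)%N.
pose ind rho := absz (floor_sum rho n + (n * (n * A))%:Z).
pose at_ind c k := `|c| <= L%:R /\ exists g rho, sturmian_parameter e c g rho /\ ind rho = k.
have bound c g rho : `|c| <= L%:R -> sturmian_parameter e c g rho ->
    `|floor_sum rho n| <= (n * (n * A))%:Z.
  move=> cL [g1 g2 _ rB _]; apply: floor_sum_bound; apply: le_trans rB _; apply: dig_bound_le.
  by move: cL => /ler_normlP[c1 c2]; apply/ler_normlP; split; lra.
have [x Hx] : {x : nat -> R & forall k c, at_ind c k -> `|c - x k| <= C * 2^-1 ^+ N}.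
  apply: (@choice _ _ (fun k y => forall c, at_ind c k -> `|c - y| <= C * 2^-1 ^+ N)) => k.
  have [[y [yL [g [rho [Pg ik]]]]]|no] := pselect (exists y, at_ind y k); last first.
    by exists 0 => c ck; case: no; exists c.
  exists y => c [cL [g' [rho' [Pg' ik']]]]; apply: (HC N _ _ _ _ _ _ cL yL Pg' Pg).
  by apply: (absz_shift_inj (bound _ _ _ cL Pg') (bound _ _ _ yL Pg)); rewrite -/(ind _) ik'.
exists x => c Pc cL; have [g [rho Pg]] := He c Pc.
exists (ind rho); last by apply: Hx; split => //; exists g, rho.
apply: leq_ltn_trans (absz_shift_le (bound _ _ _ cL Pg)) _.
have -> : (n * (n * A) + n * (n * A) = 8 * A * N.+1 ^ 2)%N by rewrite /n; ring.
by rewrite ltn_pmul2r ?expn_gt0// addn1.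
Qed.

(** A point of the closure is within [2^-N <= 1] of a parameter, whence [L + 1] for the range and
    [C + 1] for the radius. *)
Lemma closure_Pset_cover (L : nat) : exists (C : R) (B : nat), forall N, exists x : nat -> R,
  forall c, closure (Pset (R := R) q) c -> `|c| <= L%:R ->
    exists2 k, (k < B * N.+1 ^ 2)%N & `|c - x k| <= C * 2^-1 ^+ N.
Proof.
have [C [B HC]] := Pset_cover L.+1; exists (C + 1), B => N.
have [x Hx] := HC N; exists x => c cP cL.
have h0 : 0 < 2^-1 ^+ N :> R by rewrite exprn_gt0.
have h1 : 2^-1 ^+ N <= 1 :> R by rewrite exprn_ile1//; lra.
have [y [Py]] := cP _ (nbhsx_ballx c _ h0); rewrite /ball/= => cy.
have [|k kB yk] := Hx y Py.
  have := ler_normD c (y - c); rewrite addrC subrK distrC -natr1; lra.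
exists k => //; have := ler_normD (c - y) (y - x k); rewrite addrA subrK; lra.
Qed.

End ParameterCover.

Theorem theorem4p6 (R : realType) (q : nat) (hq : (2 <= q)%N) :
  nowhere_dense (closure (Pset (R:=R) q)) /\
  hausdorff_dim (closure (Pset (R:=R) q)) = 0%E.
Proof.
have cover := closure_Pset_cover R hq; split; last exact: small_cover_dim cover.
by rewrite /nowhere_dense -(closure_id _).1; [exact: small_cover_interior cover | exact: closed_closure].
Qed.
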